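(* Let $F$ be a probability measure on $\mathbb R_+^2$ given by $F(\mathrm du)=f_1(u_1)f_2(u_2)\,\mathrm du_1\,\mathrm du_2$ with $$v_i=\int_{\mathbb R_+}u_i^2f_i(u_i)\,\mathrm du_i<\infty\quad\text{for }i=1,2,$$ and suppose that $\lambda_\rho\to\infty$ as $\rho\to0$. Then, as $\rho\to0$, the random field $$\left(\frac{\widetilde J_\rho(\mu)}{\rho^2\sqrt{\lambda_\rho v_1v_2}}\right)_{\mu\in\mathcal M_P}$$ converges in finite-dimensional distributions to $(X(\mu))_{\mu\in\mathcal M_P}$, where $X$ is the centred Gaussian linear random field with covariance function $$C_X(\mu,\nu)=\int_{\mathbb R^2}f_\mu(x)f_\nu(x)\,\mathrm dx.$$
   Context: $\mathbb R_+=(0,\infty)$. For $x\in\mathbb R^2$, $u\in\mathbb R_+^2$, $B(x,u)=[x_1-\frac{u_1}{2},x_1+\frac{u_1}{2}]\times[x_2-\frac{u_2}{2},x_2+\frac{u_2}{2}]$ is the rectangle with centre $x$ and edge lengths $u_1,u_2$. Here $f_1,f_2\ge0$ are measurable functions on $\mathbb R_+$ (no heavy-tail assumption is made). For $\rho>0$, $F_\rho$ is the image measure of $F$ under $u\mapsto\rho u$, and $\lambda_\rho=\lambda(\rho)>0$ is a given function of $\rho$. $\mathcal M_2$ is the linear space of signed measures $\mu$ on $\mathbb R^2$ with finite total variation. Let $N_\rho$ be a Poisson random measure on $\mathbb R^2\times\mathbb R_+^2$ with intensity measure $\lambda_\rho\,\mathrm dx\,F_\rho(\mathrm du)$. For $\mu\in\mathcal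 M_2$ put $J_\rho(\mu)=\int_{\mathbb R^2\times\mathbb R_+^2}\mu(B(x,u))\,N_\rho(\mathrm dx,\mathrm du)$ and $\widetilde J_\rho(\mu)=J_\rho(\mu)-\mathbb E J_\rho(\mu)$. $\mathcal M_P$ is the set of all $\mu\in\mathcal M_2$ having a continuous density $f_\mu$, $\mu(\mathrm dx)=f_\mu(x)\,\mathrm dx$, for which there exist $C_\mu>0$, $c_\mu>0$ with $|f_\mu(x)|\le C_\mu e^{-c_\mu(|x_1|+|x_2|)}$ for all $x\in\mathbb R^2$. A random field $W$ indexed by a linear space of measures is linear if $W(a\mu+b\nu)=aW(\mu)+bW(\nu)$ almost surely for all $a,b\in\mathbb R$ and all $\mu,\nu$. *)

(* Defs.v *)
From HB Require Import structures.
From mathcomp Require Import all_boot all_order all_algebra.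
From mathcomp Require Import all_classical all_reals all_analysis.
From mathcomp Require Import measurable_realfun.

Set Implicit Arguments.
Unset Strict Implicit.
Unset Printing Implicit Defensive.

Import Order.TTheory GRing.Theory Num.Theory.
Import numFieldNormedType.Exports.

Local Open Scope classical_set_scope.
Local Open Scope ring_scope.

(* Two-dimensional Lebesgue measure; a notation, so that its measure structure
   stays inferable. *)
Notation leb2 R :=
  (product_measure1 (@lebesgue_measure R) (@lebesgue_measure R)).

Section geometry.
Context {R : realType}.

(* R_+^2 with R_+ = (0, oo), as a subset of the plane. *)
Definition quadrant : set (R * R) := `]0, +oo[ `*` `]0, +oo[.

Definition rectangle (x u : R * R) : set (R * R) :=
  `[x.1 - u.1 / 2, x.1 + u.1 / 2] `*` `[x.2 - u.2 / 2, x.2 + u.2 / 2].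

Definition dilation (rho : R) (u : R * R) : R * R := (rho * u.1, rho * u.2).

Let measurable_dilation (rho : R) : measurable_fun [set: R * R] (dilation rho).
Proof. by apply: measurable_fun_pair; apply: measurable_funM. Qed.

HB.instance Definition _ (rho : R) :=
  isMeasurableFun.Build _ _ _ _ (dilation rho) (measurable_dilation rho).

Definition second_moment (f : R -> R) : \bar R :=
  (\int[lebesgue_measure]_(u in [set` `]0, +oo[%R]) (u ^+ 2 * f u)%:E)%E.

End geometry.

(* A charge is countably additive and finite on every measurable set, hence has
   finite total variation. Its values on non-measurable sets are unconstrained
   and are never used. *)
Definition signed_measure (R : realType) := {charge set (R * R)%type -> \bar R}.

Section signed_measures.
Context {R : realType}.
Implicit Types mu nu : signed_measure R.

Definition continuous_density mu (f : R * R -> R) : Prop :=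
  continuous f /\
  forall A, measurable A -> mu A = (\int[leb2 R]_(x in A) (f x)%:E)%E.

Definition exp_decay (f : R * R -> R) : Prop :=
  exists C c : R, [/\ 0 < C, 0 < c &
    forall x, `|f x| <= C * expR (- c * (`|x.1| + `|x.2|))].

Definition M_P : set (signed_measure R) :=
  [set mu | exists2 f, continuous_density mu f & exp_decay f].

(* The continuous density f_mu; it is unique when it exists. *)
Definition density mu : R * R -> R :=
  xget (fun=> 0) [set f | continuous_density mu f].

Definition cov_X mu nu : \bar R :=
  (\int[leb2 R]_x (density mu x * density nu x)%:E)%E.

End signed_measures.

Section poisson_random_measure.
Context d (Om : measurableType d) (R : realType) (P : probability Om R).
Context d' (E : measurableType d').

(* As every finite family of events is allowed, the product rule for all
   subfamilies follows by taking some of the B i full. *)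
Definition mutually_independent n (Y : 'I_n -> Om -> \bar R) : Prop :=
  forall B : 'I_n -> set (\bar R), (forall i, measurable (B i)) ->
    P (\bigcap_(i in [set: 'I_n]) (Y i @^-1` B i)) =
    (\prod_(i < n) P (Y i @^-1` B i))%E.

(* The second argument of the library's poisson_prob is a dummy; for a zero
   rate poisson_prob is the Dirac mass at 0. *)
Record is_poisson_random_measure (nu : set E -> \bar R) (N : R.-ker Om ~> E) :
    Prop := {
  prm_poisson : forall A, measurable A -> (nu A < +oo)%E ->
    forall k : nat,
      P [set w | N w A = (k%:R)%:E] = poisson_prob (fine (nu A)) 0%N [set k] ;
  prm_infinite : forall A, measurable A -> nu A = +oo%E ->
    {ae P, forall w, N w A = +oo%E} ;
  prm_independent : forall n (A : 'I_n -> set E),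
    (forall i, measurable (A i)) -> trivIset [set: 'I_n] A ->
    mutually_independent (fun i w => N w (A i)) }.

End poisson_random_measure.

Section random_rectangles.
Context {R : realType}.

(* The intensity lambda dx F_rho(du), where F_rho is the image of F under
   u |-> rho u; it lives on all of R^2 x R^2 but, for F carried by the quadrant
   and rho > 0, it is carried by R^2 x R_+^2. *)
Definition intensity (F : probability (R * R)%type R) (lambda rho : R) :
    set ((R * R) * (R * R)) -> \bar R :=
  fun A => (lambda%:E *
    product_measure1 (leb2 R) (distribution F (dilation rho)) A)%E.

Context d (Om : measurableType d) (P : probability Om R).
Variable N : R.-ker Om ~> ((R * R) * (R * R))%type.

(* Rintegral is 0 when the extended-real integral is infinite. *)
Definition J (mu : signed_measure R) (w : Om) : R :=
  \int[N w]_(z in [set: R * R] `*` quadrant) fine (mu (rectangle z.1 z.2)).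

Definition J_centred (mu : signed_measure R) (w : Om) : R :=
  J mu w - fine ('E_P[J mu])%E.

End random_rectangles.

Section gaussian_field.
Context d (Om : measurableType d) (R : realType) (Q : probability Om R).

(* Degenerate Gaussians are Dirac masses; they are treated separately because
   the library's normal_prob m 0 is not a Dirac mass. *)
Definition is_gaussian (V : Om -> R) : Prop :=
  exists m s : R, 0 <= s /\ forall A, measurable A ->
    Q (V @^-1` A) = if s == 0 then \d_m A else normal_prob m s A.

Record is_centred_gaussian_linear_field (X : signed_measure R -> {RV Q >-> R}) :
    Prop := {
  field_gaussian : forall n (a : 'I_n -> R) (mu : 'I_n -> signed_measure R),
    (forall i, M_P (mu i)) ->
    is_gaussian (fun w => \sum_(i < n) a i * X (mu i) w) ;
  field_centred : forall mu, M_P mu -> ('E_Q[X mu] = 0)%E ;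
  field_linear : forall (a b : R) mu nu, M_P mu -> M_P nu ->
    {ae Q, forall w, X (cadd (cscale a mu) (cscale b nu)) w =
                     a * X mu w + b * X nu w} }.

End gaussian_field.

(* Convergence in finite-dimensional distributions as rho -> 0+ of random
   fields indexed by D, the fields being allowed to live on different
   probability spaces: weak convergence of all finite-dimensional marginals. *)
Definition cvg_fdd (R : realType) (I : Type) (D : set I)
    (dOm : R -> measure_display) (Om : forall rho, measurableType (dOm rho))
    (P : forall rho, probability (Om rho) R)
    (Y : forall rho, I -> Om rho -> R)
    (d : measure_display) (Om' : measurableType d) (Q : probability Om' R)
    (X : I -> Om' -> R) : Prop :=
  forall (n : nat) (mu : 'I_n -> I), (forall i, D (mu i)) ->
  forall g : 'rV[R]_n -> R, continuous g ->
    (exists M : R, forall x, `|g x| <= M) ->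
    'E_(P rho)[fun w => g (\row_i Y rho (mu i) w)]%E @[rho --> 0^'+] -->
    'E_Q[fun w => g (\row_i X (mu i) w)]%E.

(* Main.v *)
Require Import Defs.
From HB Require Import structures.
From mathcomp Require Import all_boot all_order all_algebra.
From mathcomp Require Import all_classical all_reals all_analysis.
From mathcomp Require Import measurable_realfun.
From mathcomp Require Import ring lra zify.

(** Convergence in law of the finite-dimensional marginals is reduced to that of
    the means of cosines of affine forms, which are explicit on both sides.

    The reduction is [cramer_wold]. If the means of
    [cos (\sum_i t i * Y i + b)] converge for all [t] and [b], then so do the means
    of all linear combinations of such cosines. These form an algebra, and on a large box they
    approximate a bounded continuous function uniformly, by Bernstein polynomials in
    [(1 + sin (y i / (2 * L))) / 2]. Bounded second moments control what
    happens outside of the box.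

    For a Poisson random measure [N] with intensity [nu] and an integrable [h],
    [prm_cos] is the real part of the exponential formula: the mean of
    [cos (int h dN + b)] is
    [expR (int (cos h - 1) dnu) * cos (int sin h dnu + b)]. It follows from the
    independence of the counts of disjoint sets for simple [h], and by continuity in
    [L^1] in general. Expanding it to second order bounds the variance of [int h dN] by
    [int h ^+ 2 dnu] ([prm_variance_le]), which is where the bounded second moments
    come from.

    A linear combination of the [J (mu i)] is the integral against [N] of one
    function, the mass of the rectangle for the combined density [f]. Let [a] be
    this mass divided by the normalisation [rho ^+ 2 * sqrt (lambda * v1 * v2)].
    After centring, the transform is governed by [lambda] times the integrals
    of [cos a - 1] and of [sin a - a]. The rectangle with centre [x] and edges
    [rho * u] has mass about [rho ^+ 2 * u.1 * u.2 * f x] ([mass_average]), so that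
    [lambda * a ^+ 2] tends to [f x ^+ 2 * (u.1 * u.2) ^+ 2 / (v1 * v2)], whereas [a]
    tends to [0] since [lambda] tends to infinity. Hence only the quadratic term of
    the cosine survives ([cvg_integral_1Bcos], [cvg_integral_Bsin]), and the limit
    is [expR (- (int f ^+ 2) / 2) * cos b], because [u.1 ^+ 2 * u.2 ^+ 2] has mean
    [v1 * v2]. This is the transform of a Gaussian variable with variance
    [int f ^+ 2] ([gaussian_cos]), that is of the same linear combination of the
    limit field.

    Dominated convergence rests on [sqr_mass_le]. The densities lie below a multiple of
    [weight x.1 * weight x.2] with [weight y = (1 + y ^+ 2)^-1]. The integral of
    [weight] over a segment of length [r] around [x] is at most a multiple of
    [r / (1 + `|x|)] for every [r], small or large ([segment_weight_le]), so
    [lambda * a ^+ 2] is at most a multiple of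
    [weight x.1 * weight x.2 * u.1 ^+ 2 * u.2 ^+ 2]. The latter is
    integrable precisely because the second moments [v1] and [v2] are finite. *)

Set Implicit Arguments.
Unset Strict Implicit.
Unset Printing Implicit Defensive.
Import Order.TTheory GRing.Theory Num.Theory.
Import numFieldNormedType.Exports.
Local Open Scope classical_set_scope.
Local Open Scope ring_scope.

(** * The cosine transform of independent Poisson variables *)

Section poisson_series.
Context {R : realType}.
Implicit Types c p th x : R.

Definition cos_series c th : R^nat := fun l => cos (c * l%:R + th) / l`!%:R.

Lemma cvg_cos_series c th x : cvgn (pseries (cos_series c th) x).
Proof.
apply: normed_cvg.
apply: series_le_cvg (is_cvg_series_exp_coeff `|x|) => n.
- exact: normr_ge0.
- by rewrite /exp_coeff /= divr_ge0 ?exprn_ge0.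
rewrite /cos_series /exp_coeff/= !normrM normrX normfV [`|_`!%:R|]ger0_norm//.
by rewrite mulrC ler_wpM2l ?exprn_ge0// ler_piMl ?cos_max// invr_ge0.
Qed.

Lemma pseries_diffs_cos_series c th :
  pseries_diffs (cos_series c th) = cos_series c (c + th).
Proof.
apply/funext => n; rewrite /pseries_diffs /cos_series.
rewrite factS natrM -natr1; have n0 : (n%:R + 1 : R) != 0 by rewrite natr1.
have f0 : (n`!%:R : R) != 0 by rewrite pnatr_eq0 -lt0n fact_gt0.
have -> : c * (n%:R + 1) + th = c * n%:R + (c + th) by ring.
by field; rewrite f0 n0.
Qed.

Lemma is_derive_cos_series c th x :
  is_derive x (1 : R) (fun x => limn (pseries (cos_series c th) x))
    (limn (pseries (cos_series c (c + th)) x)).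
Proof.
rewrite -pseries_diffs_cos_series.
apply: (@pseries_snd_diffs _ _ (`|x| + 1)).
- exact: cvg_cos_series.
- rewrite pseries_diffs_cos_series; exact: cvg_cos_series.
- rewrite !pseries_diffs_cos_series; exact: cvg_cos_series.
- by rewrite [ltRHS]ger0_norm ?addr_ge0// ltrDl.
Qed.

Lemma cos_seriesE c th :
  cos_series c th = cos th *: cos_series c 0 + sin th *: cos_series c (pi / 2).
Proof.
apply/funext => n; rewrite /cos_series !fctE !addr0 cosDpihalf cosD /GRing.scale/=.
ring.
Qed.

Lemma lim_cos_seriesE c th x :
  limn (pseries (cos_series c th) x) =
  cos th * limn (pseries (cos_series c 0) x) +
  sin th * limn (pseries (cos_series c (pi / 2)) x).
Proof.
have -> : pseries (cos_series c th) x =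
   cos th *: pseries (cos_series c 0) x + sin th *: pseries (cos_series c (pi / 2)) x.
  apply/funext => n; rewrite /pseries/= !fctE /series/= !scaler_sumr -big_split/=.
  by apply: eq_bigr => i _; rewrite cos_seriesE !fctE mulrDl !scalerAl.
apply/cvg_lim => //; apply: cvgD; apply: cvgZl_tmp; exact: cvg_cos_series.
Qed.

Lemma pseries_cos_series0 c th : limn (pseries (cos_series c th) 0) = cos th.
Proof.
apply/cvg_lim => //; apply: cvg_near_cst; near=> n.
have n0 : (0 < n)%N by near: n; exact: nbhs_infty_gt.
rewrite -(prednK n0) /pseries /series/= big_nat_recl//= big1 ?addr0.
  by rewrite expr0 mulr1 /cos_series mulr0 add0r fact0 divr1.
by move=> i _; rewrite expr0n mulr0.
Unshelve. all: by end_near. Qed.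

(** The real and imaginary parts of [x |-> exp (x * exp (i * c))], without complex
    numbers: the phases [0] and [pi / 2] give a linear system [U, V], and undoing
    the expected growth and rotation leaves functions with zero derivative. *)
Lemma lim_cos_series c th x :
  limn (pseries (cos_series c th) x) =
  expR (x * cos c) * cos (x * sin c + th).
Proof.
pose U y := limn (pseries (cos_series c 0) y).
pose V y := limn (pseries (cos_series c (pi / 2)) y).
have dU y : is_derive y (1 : R) U (cos c * U y + sin c * V y).
  have := is_derive_cos_series c 0 y.
  by rewrite addr0 [X in is_derive _ _ _ X]lim_cos_seriesE.
have dV y : is_derive y (1 : R) V (- sin c * U y + cos c * V y).
  have := is_derive_cos_series c (pi / 2) y.
  by rewrite [X in is_derive _ _ _ X]lim_cos_seriesE cosDpihalf sinDpihalf.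
pose G y := expR (- y * cos c) * (U y * cos (y * sin c) - V y * sin (y * sin c)).
pose H y := expR (- y * cos c) * (V y * cos (y * sin c) + U y * sin (y * sin c)).
have dG y : is_derive y (1 : R) G 0.
  apply: is_derive_eq; rewrite /GRing.scale/=. ring.
have dH y : is_derive y (1 : R) H 0.
  apply: is_derive_eq; rewrite /GRing.scale/=. ring.
(* [G] and [H] are constant, hence equal to their values at [0]. *)
have GE : G x = 1.
  rewrite (is_derive_0_is_cst x 0 dG) /G oppr0 !mul0r expR0 cos0 sin0 mulr0 mulr1 subr0 mul1r.
  by rewrite /U pseries_cos_series0 cos0.
have HE : H x = 0.
  rewrite (is_derive_0_is_cst x 0 dH) /H oppr0 !mul0r expR0 cos0 sin0 mulr0 mulr1 addr0 mul1r.
  by rewrite /V pseries_cos_series0 cos_pihalf.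
rewrite lim_cos_seriesE -/(U x) -/(V x) cosD.
have e0 : expR (x * cos c) * expR (- x * cos c) = 1.
  by rewrite -expRD mulNr subrr expR0.
have cs := cos2Dsin2 (x * sin c).
have UE : U x = expR (x * cos c) * cos (x * sin c).
  transitivity (expR (x * cos c) * (G x * cos (x * sin c) + H x * sin (x * sin c))).
    rewrite /G /H. transitivity (expR (x * cos c) * expR (- x * cos c) *
      (U x * (cos (x * sin c) ^+ 2 + sin (x * sin c) ^+ 2))); last by ring.
    by rewrite e0 cs; ring.
  by rewrite GE HE; ring.
have VE : V x = - expR (x * cos c) * sin (x * sin c).
  transitivity (expR (x * cos c) * (H x * cos (x * sin c) - G x * sin (x * sin c))).
    rewrite /G /H. transitivity (expR (x * cos c) * expR (- x * cos c) *
      (V x * (cos (x * sin c) ^+ 2 + sin (x * sin c) ^+ 2))); last by ring.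
    by rewrite e0 cs; ring.
  by rewrite GE HE; ring.
rewrite UE VE; ring.
Qed.

Definition poisson_weight p l : R := p ^+ l / l`!%:R * expR (- p).

Lemma poisson_cos_series c th p :
  series (fun l => cos (c * l%:R + th) * poisson_weight p l) @ \oo -->
  expR (p * (cos c - 1)) * cos (p * sin c + th).
Proof.
have -> : (fun l => cos (c * l%:R + th) * poisson_weight p l) =
  expR (- p) *: (fun l => cos_series c th l * p ^+ l).
  by apply/funext => l; rewrite !fctE /poisson_weight /cos_series /GRing.scale/=; ring.
have -> : expR (p * (cos c - 1)) * cos (p * sin c + th) =
   expR (- p) *: limn (pseries (cos_series c th) p).
  by rewrite lim_cos_series /GRing.scale/= mulrA -expRD; congr (expR _ * _); ring.
have -> : series (expR (- p) *: (fun l => cos_series c th l * p ^+ l)) =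
   expR (- p) *: pseries (cos_series c th) p.
  by apply/funext => n; rewrite /pseries/= !fctE /series/= scaler_sumr.
by apply: cvgZl_tmp; exact: cvg_cos_series.
Qed.

End poisson_series.

Section measurable_trigo.
Context d (T : measurableType d) (R : realType).
Implicit Types f : T -> R.

Lemma measurable_cos f : measurable_fun setT f -> measurable_fun setT (fun x => cos (f x)).
Proof.
by move=> mf; apply: measurableT_comp => //; apply: continuous_measurable_fun; exact: continuous_cos.
Qed.

Lemma measurable_sin f : measurable_fun setT f -> measurable_fun setT (fun x => sin (f x)).
Proof.
by move=> mf; apply: measurableT_comp => //; apply: continuous_measurable_fun; exact: continuous_sin.
Qed.

Lemma measurable_sum_cond (I : finType) (Q : pred I) (h : I -> T -> R) :
  (forall i, measurable_fun setT (h i)) ->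
  measurable_fun setT (fun x => \sum_(i | Q i) h i x).
Proof.
move=> mh; under eq_fun do rewrite big_mkcond/=.
by apply: measurable_sum => i; case: (Q i).
Qed.

Lemma integrable_cos (mu : probability T R) f A : measurable A ->
  measurable_fun setT f -> mu.-integrable A (fun x => (cos (f x))%:E).
Proof.
move=> mA mf; apply: measurable_bounded_integrable => //.
- by rewrite (le_lt_trans (probability_le1 _ mA)) ?ltry.
- by apply: measurable_funTS; exact: measurable_cos.
- by exists 1%R; split => // M M1 x _; rewrite /= (le_trans (cos_max _)) ?ltW.
Qed.

End measurable_trigo.

Lemma eseries_EFin (R : realType) (u : R^nat) (l : R) :
  series u @ \oo --> l -> (\sum_(0 <= k <oo) (u k)%:E = l%:E)%E.
Proof.
move=> ul; apply/cvg_lim => //; apply: cvg_EFin.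
  by near=> n; rewrite sumEFin.
by apply: cvg_trans ul; apply: near_eq_cvg; near=> n; rewrite /= sumEFin.
Unshelve. all: by end_near. Qed.

Lemma poisson_ae_nat d (Om : measurableType d) (R : realType) (P : probability Om R)
    (Y : Om -> \bar R) (p : R) : measurable_fun setT Y ->
  (forall k : nat, P (Y @^-1` [set k%:R%:E]) = (poisson_weight p k)%:E) ->
  (P (~` \bigcup_k (Y @^-1` [set k%:R%:E])) = 0)%E.
Proof.
move=> mY YP.
have mYk k : measurable (Y @^-1` [set k%:R%:E]) by rewrite -[X in measurable X]setTI; exact: mY.
rewrite probability_setC//; last exact: bigcup_measurable.
rewrite measure_bigcup//=; last first.
  by move=> k l _ _ [w [/= -> /eqP]]; rewrite eqe eqr_nat => /eqP.
have /eseries_EFin := @poisson_cos_series R 0 0 p.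
rewrite cos0 sin0 subrr !mulr0 addr0 expR0 cos0 mul1r => h.
rewrite (_ : (\sum_(_ <oo | _) _)%E = 1%E) ?subee// -h.
rewrite [in LHS]eseries_mkcond; apply: eq_eseriesr => k _.
by rewrite in_setT YP mul0r addr0 cos0 mul1r.
Qed.

Lemma poisson_probE (R : realType) (p : R) k : 0 <= p ->
  poisson_prob p 0%N [set k] = (poisson_weight p k)%:E.
Proof.
rewrite le_eqVlt => /predU1P[<-|p0]; rewrite /poisson_prob ?ltxx ?p0.
  rewrite diracE /poisson_weight oppr0 expR0 mulr1 expr0n.
  have -> : (0%N \in [set k]) = (k == 0%N) by apply/idP/eqP => [/set_mem ->//|->]; rewrite inE.
  by case: k => [|k]; rewrite ?fact0 ?divr1 ?mul0r.
by rewrite esum_set1/= /poisson_pmf ?p0 ?lee_fin// !mulr_ge0 ?exprn_ge0 ?expR_ge0 ?invr_ge0 ?ltW.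
Qed.

(** As [Y] is almost surely a natural number, its mean is the series of
    [k * poisson_weight p k], which is [p] times the total mass shifted by one. *)
Lemma poisson_mean d (Om : measurableType d) (R : realType) (P : probability Om R)
    (Y : Om -> \bar R) (p : R) : measurable_fun setT Y -> (forall w, 0 <= Y w)%E ->
  (forall k : nat, P (Y @^-1` [set k%:R%:E]) = (poisson_weight p k)%:E) ->
  (\int[P]_w Y w = p%:E)%E.
Proof.
move=> mY Y0 YP.
have mYk k : measurable (Y @^-1` [set k%:R%:E]) by rewrite -[X in measurable X]setTI; exact: mY.
have mU : measurable (\bigcup_k (Y @^-1` [set k%:R%:E])) by exact: bigcup_measurable.
rewrite (ge0_negligible_integral (N := ~` \bigcup_k (Y @^-1` [set k%:R%:E])))//; last 2 first.
- exact: measurableC.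
- exact: poisson_ae_nat YP.
rewrite setDE setCK setTI ge0_integral_bigcup//; last 2 first.
- exact: measurable_funTS.
- by move=> k l _ _ [w [/= -> /eqP]]; rewrite eqe eqr_nat => /eqP.
transitivity (\sum_(0 <= k <oo) (k%:R * poisson_weight p k)%:E)%E.
  apply: eq_eseriesr => k _.
  under eq_integral => w do rewrite inE/= => ->.
  by rewrite integral_cst// EFinM -YP.
apply: eseries_EFin.
have := @poisson_cos_series R 0 0 p.
rewrite cos0 sin0 subrr !mulr0 addr0 expR0 cos0 mul1r => h.
rewrite -cvg_shiftS/=; rewrite [X in X @ _ --> _](_ : _ = p *: series (fun l => cos (0 * l%:R + 0) * poisson_weight p l)).
  have h' : p *: series (fun l => cos (0 * l%:R + 0) * poisson_weight p l) @ \oo --> p *: (1 : R).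
    exact: cvgZl_tmp.
  by move: h'; rewrite /GRing.scale/= mulr1.
apply/funext => n; rewrite !fctE /series/= big_nat_recl// mul0r add0r scaler_sumr.
apply: eq_bigr => i _; rewrite mul0r addr0 cos0 mul1r /poisson_weight factS natrM exprS /GRing.scale/=.
have f0 : (i`!%:R : R) != 0 by rewrite pnatr_eq0 -lt0n fact_gt0.
have i0 : (i.+1%:R : R) != 0 by rewrite pnatr_eq0.
by field; rewrite f0 addrC natr1.
Qed.

Section independent_poisson.
Local Open Scope ereal_scope.
Context d (Om : measurableType d) (R : realType) (P : probability Om R).
Variables (n : nat) (Y : 'I_n -> Om -> \bar R) (p c : 'I_n -> R).
Hypothesis mY : forall i, measurable_fun setT (Y i).
Hypothesis YP : forall i k, P (Y i @^-1` [set k%:R%:E]) = (poisson_weight (p i) k)%:E.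
Hypothesis YI : mutually_independent P Y.

(* The summands are conditioned away one at a time; [ev B] keeps track of the
   events met by those already fixed, so that the product rule applies. *)
Let ev (B : 'I_n -> set (\bar R)) := \bigcap_(i in [set: 'I_n]) (Y i @^-1` B i).

Let mYB i B : measurable B -> measurable (Y i @^-1` B).
Proof. by move=> mB; rewrite -[X in measurable X]setTI; exact: mY. Qed.

Let mev B : (forall i, measurable (B i)) -> measurable (ev B).
Proof. by move=> mB; apply: fin_bigcap_measurable => // i _; exact: mYB. Qed.

Let S k b w : R := (\sum_(i < n | (i < k)%N) c i * fine (Y i w) + b)%R.

Let mS k b : measurable_fun setT (S k b).
Proof.
apply: measurable_funD => //; apply: measurable_sum_cond => i.
by apply: measurable_funM => //; exact: measurableT_comp.
Qed.

Let A k : R := expR (\sum_(i < n | (i < k)%N) p i * (cos (c i) - 1)).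
Let T k b : R := (\sum_(i < n | (i < k)%N) p i * sin (c i) + b)%R.

Let evnat i : set Om := \bigcup_k (Y i @^-1` [set k%:R%:E]).

Let mevnat i : measurable (evnat i).
Proof. by apply: bigcup_measurable => k _; exact: mYB. Qed.

Let evnat1 i : P (~` evnat i) = 0.
Proof. exact: poisson_ae_nat. Qed.

(** Induction on the number [k] of variables still random: the event
    [Y k = l] turns the term [c k * Y k] into a shift of the phase, and the sum
    over [l] is [poisson_cos_series]. *)
Let claim k B b : (k <= n)%N -> (forall i, measurable (B i)) ->
  (forall i : 'I_n, (i < k)%N -> B i = setT) ->
  \int[P]_(w in ev B) (cos (S k b w))%:E =
  (A k * cos (T k b))%:E * \prod_(i < n) P (Y i @^-1` B i).
Proof.
elim: k B b => [|k IH] B b kn mB BT.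
  rewrite /A /T big_pred0// big_pred0// expR0 add0r mul1r -YI//.
  under eq_integral do rewrite /S big_pred0// add0r.
  by rewrite integral_cst//; exact: mev.
pose K := Ordinal kn.
pose Bl l i : set (\bar R) := if i == K then [set l%:R%:E] else B i.
have mBl l i : measurable (Bl l i) by rewrite /Bl; case: ifP.
have pK (i : 'I_n) : (i < k.+1)%N && (i != K) = (i < k)%N.
  rewrite -(inj_eq val_inj)/= ltnS; lia.
have SK b' w : S k.+1 b' w = S k (c K * fine (Y K w) + b')%R w.
  rewrite /S (bigD1 K)//= addrAC addrA addrC addrA; congr (_ + _)%R.
  by rewrite (eq_bigl _ _ pK).
have evE : ev B `\` ~` evnat K = \bigcup_l ev (Bl l).
  rewrite setDE setCK; apply/seteqP; split => w.
  - move=> [Bw [l _ /= lw]]; exists l => // i _; rewrite /Bl/=.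
    by case: eqP => [->//|_]; exact: Bw.
  - move=> [l _ lw]; split.
      move=> i _; have := lw i I; rewrite /Bl/=; case: eqP => [-> _|//].
      by rewrite BT /=.
    by exists l => //; have := lw K I; rewrite /Bl eqxx.
have tB : trivIset setT (fun l => ev (Bl l)).
  move=> k' l _ _ [w [/(_ K I) + /(_ K I)]]; rewrite /Bl eqxx/= => -> /eqP.
  by rewrite eqe eqr_nat => /eqP.
have mcos k' b' E : measurable E -> P.-integrable E (fun w => (cos (S k' b' w))%:E).
  by move=> mE; exact: integrable_cos.
rewrite (negligible_integral (N := ~` evnat K))//; last 4 first.
- exact: measurableC.
- exact: mev.
- by apply: mcos; exact: mev.
- exact: evnat1.
rewrite evE integral_bigcup//; last 2 first.
- by move=> l; exact: mev.
- by apply: mcos; apply: bigcup_measurable => l _; exact: mev.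
pose q := fine (\prod_(i < n | i != K) P (Y i @^-1` B i)).
have qE : \prod_(i < n | i != K) P (Y i @^-1` B i) = q%:E.
  rewrite /q fineK//; elim/big_ind : _ => //; first by move=> x y fx fy; exact: fin_numM.
  by move=> i _; apply: fin_num_measure; exact: mYB.
have El l : \int[P]_(w in ev (Bl l)) (cos (S k.+1 b w))%:E =
   (A k * q * (cos (c K * l%:R + T k b) * poisson_weight (p K) l))%:E.
  transitivity (\int[P]_(w in ev (Bl l)) (cos (S k (c K * l%:R + b) w))%:E).
    apply: eq_integral => w; rewrite inE => /(_ K I); rewrite /Bl eqxx/= => YE.
    by rewrite SK YE.
  rewrite IH//; last 2 first.
  - exact: ltnW.
  - move=> i ik; rewrite /Bl; case: eqP => [iK|_]; first by move: ik; rewrite iK/= ltnn.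
    by apply: BT; rewrite ltnS ltnW.
  rewrite (bigD1 K)//= {1}/Bl eqxx YP.
  under eq_bigr => i iK do rewrite /Bl (negbTE iK).
  rewrite qE -!EFinM; congr _%:E.
  by rewrite /T addrCA; ring.
under eq_eseriesr do rewrite El.
rewrite (bigD1 K)//= BT//= preimage_setT probability_setT mul1e qE -EFinM.
have -> : (A k.+1 * cos (T k.+1 b) * q)%R =
   (A k * q * (expR (p K * (cos (c K) - 1)) * cos (p K * sin (c K) + T k b)))%R.
  rewrite /A /T (bigD1 K)//= (bigD1 K (P := fun i : 'I_n => (i < k.+1)%N))//=.
  by rewrite !(eq_bigl _ _ pK) expRD -addrA; ring.
apply: eseries_EFin; rewrite [X in X @ _](_ : _ = (A k * q) *:
  series (fun l => cos (c K * l%:R + T k b) * poisson_weight (p K) l)%R).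
  by apply: cvgZl_tmp; exact: poisson_cos_series.
by apply/funext => m; rewrite !fctE /series/= scaler_sumr.
Qed.

Lemma cos_sum_poisson b :
  \int[P]_w (cos (\sum_(i < n) c i * fine (Y i w) + b))%:E =
  (expR (\sum_(i < n) p i * (cos (c i) - 1)) *
   cos (\sum_(i < n) p i * sin (c i) + b))%:E.
Proof.
have := @claim n (fun=> setT) b (leqnn n) (fun=> measurableT) (fun _ _ => erefl).
have -> : ev (fun=> setT) = setT by apply/seteqP; split.
have e : (fun i : 'I_n => (i < n)%N) =1 xpredT by move=> i; rewrite ltn_ord.
rewrite /A /T /S !(eq_bigl _ _ e) => h.
transitivity (\int[P]_w (cos (\sum_(i < n | (i < n)%N) c i * fine (Y i w) + b))%:E).
  by apply: eq_integral => w _; rewrite (eq_bigl _ _ e).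
rewrite h [X in _ * X]big1 ?mule1// => i _.
by rewrite preimage_setT probability_setT.
Qed.

End independent_poisson.

(** * Poisson random measures: means, cosine transforms and variances *)

Section indicator_sum.
Local Open Scope ereal_scope.
Context d (T : measurableType d) (R : realType) (m : {measure set T -> \bar R}).

Lemma Rintegral_indic_sum n (A : 'I_n -> set T) (a : 'I_n -> R) :
  (forall i, measurable (A i)) -> (forall i, m (A i) < +oo) ->
  m.-integrable setT (fun x => (\sum_(i < n) a i * \1_(A i) x)%:E) /\
  (\int[m]_x (\sum_(i < n) a i * \1_(A i) x) = \sum_(i < n) a i * fine (m (A i)))%R.
Proof.
move=> mA finA.
have iI i : m.-integrable setT (fun x => (\1_(A i) x)%:E).
  apply/integrableP; split; first exact/measurable_EFinP.
  under eq_integral do rewrite gee0_abs ?lee_fin//.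
  by rewrite integral_indic// setIT.
have iA i : m.-integrable setT (fun x => (a i * \1_(A i) x)%:E).
  under eq_fun do rewrite EFinM.
  by apply: integrableZl => //; exact: iI.
split.
  under eq_fun do rewrite -sumEFin.
  exact: integrable_sum.
rewrite /Rintegral; under eq_integral do rewrite -sumEFin.
rewrite integral_sum// (_ : \sum_(i < n) _ = (\sum_(i < n) a i * fine (m (A i)))%:E)//.
rewrite -sumEFin; apply: eq_bigr => i _; under eq_integral do rewrite EFinM.
rewrite integralZl//.
by rewrite integral_indic// setIT EFinM fineK// ge0_fin_numE.
Qed.
End indicator_sum.

Section campbell.
Local Open Scope ereal_scope.
Context d (Om : measurableType d) (R : realType) (P : probability Om R).
Context d' (E : measurableType d') (nu : {measure set E -> \bar R}).
Variable N : R.-ker Om ~> E.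
Hypothesis NP : is_poisson_random_measure P nu N.

Lemma prm_weight A : measurable A -> nu A < +oo ->
  forall k : nat, P ((N ^~ A) @^-1` [set k%:R%:E]) = (poisson_weight (fine (nu A)) k)%:E.
Proof.
by move=> mA Aoo k; rewrite -poisson_probE ?fine_ge0//; exact: (prm_poisson NP).
Qed.

Lemma campbell_set A : measurable A -> \int[P]_w N w A = nu A.
Proof.
move=> mA; have mNA := measurable_kernel N _ mA.
have [Aoo|/negPf Aoo] := boolP (nu A == +oo); last first.
  have Afin : nu A < +oo by rewrite ltey Aoo.
  by rewrite (poisson_mean mNA _ (prm_weight mA Afin))// fineK// ge0_fin_numE.
rewrite (eqP Aoo) (ae_eq_integral (cst +oo))//.
  rewrite integral_cst//.
  by transitivity (+oo * 1 : \bar R); [congr (_ * _); exact: probability_setT|rewrite mule1].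
by apply: filterS (prm_infinite NP mA (eqP Aoo)) => w /= wA _.
Qed.

Import HBNNSimple.

Let campbell_nnsfun (f : {nnsfun E >-> R}) :
  \int[P]_w \int[N w]_z (f z)%:E = \int[nu]_z (f z)%:E.
Proof.
transitivity (\int[P]_w \sum_(r \in range f) (r%:E * N w (f @^-1` [set r]))).
  by apply: eq_integral => w _; rewrite integralT_nnsfun sintegralE.
rewrite ge0_integral_fsum//; last 2 first.
- by move=> r; apply: measurable_funeM; exact: measurable_kernel.
- move=> r w _; have [r0|r0] := leP 0%R r; first by rewrite mule_ge0.
  by rewrite preimage_nnfun0// measure0 mule0.
rewrite integralT_nnsfun sintegralE; apply: eq_fsbigr => r _.
have [r0|r0] := leP 0%R r; last first.
  rewrite preimage_nnfun0// measure0 mule0 integral0_eq// => w _.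
  by rewrite measure0 mule0.
by rewrite ge0_integralZl_EFin// ?campbell_set//; exact: measurable_kernel.
Qed.

Lemma measurable_kernel_integral (f : E -> \bar R) : measurable_fun setT f ->
  (forall z, 0 <= f z) -> measurable_fun setT (fun w => \int[N w]_z f z).
Proof.
move=> mf f0; apply: measurable_fun_integral_kernel => // U mU.
exact: measurable_kernel.
Qed.

(** Campbell's formula: on indicators it is the mean of a Poisson variable, and
    it passes to monotone limits. *)
Lemma campbell (f : E -> \bar R) : measurable_fun setT f -> (forall z, 0 <= f z) ->
  \int[P]_w \int[N w]_z f z = \int[nu]_z f z.
Proof.
move=> mf f0.
pose f_ := nnsfun_approx measurableT mf.
have fE z : lim ((f_ n z)%:E @[n --> \oo]) = f z.
  by apply/cvg_lim => //=; exact: cvg_nnsfun_approx.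
have limE (m : {measure set E -> \bar R}) :
    \int[m]_z f z = lim ((\int[m]_z (f_ n z)%:E) @[n --> \oo]).
  rewrite -monotone_convergence//; first by apply: eq_integral => z _; rewrite fE.
  - by move=> n; exact/measurable_EFinP.
  - by move=> n z _; rewrite lee_fin.
  - by move=> z _ a b ab; rewrite lee_fin; exact/lefP/nd_nnsfun_approx.
transitivity (\int[P]_w lim ((\int[N w]_z (f_ n z)%:E) @[n --> \oo])).
  by apply: eq_integral => w _; exact: limE.
rewrite monotone_convergence//; last 3 first.
- by move=> n; apply: measurable_kernel_integral; [exact/measurable_EFinP|move=> z; rewrite lee_fin].
- by move=> n w _; apply: integral_ge0 => z _; rewrite lee_fin.
- move=> w _ a b ab; apply: ge0_le_integral => //.
  + by move=> z _; rewrite lee_fin.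
  + exact/measurable_EFinP.
  + exact/measurable_EFinP.
  + by move=> z _; rewrite lee_fin; exact/lefP/nd_nnsfun_approx.
by rewrite limE; congr (limn _); apply/funext => n; exact: campbell_nnsfun.
Qed.

End campbell.

Lemma dist_sin (R : realType) (x y : R) : `|sin x - sin y| <= `|x - y|.
Proof.
wlog xy : x y / y <= x.
  move=> H; have [|/ltW] := leP y x; first exact: H.
  by move=> /H; rewrite distrC (distrC y).
have [<-|yx] := eqVneq y x; first by rewrite !subrr.
have {}yx : y < x by rewrite lt_neqAle yx.
have [|z _ ->] := @MVT R sin cos y x yx (fun z _ => is_derive_sin z).
  by apply: continuous_subspaceT => z; exact: continuous_sin.
by rewrite normrM ler_piMl// cos_max.
Qed.

Lemma dist_cos (R : realType) (x y : R) : `|cos x - cos y| <= `|x - y|.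
Proof.
have := dist_sin (x + pi / 2) (y + pi / 2).
by rewrite !sinDpihalf opprD addrACA subrr addr0.
Qed.

(** The bounds on [cos] and [sin] below come from this identity and from
    [abs_sin_le], so that no Taylor formula is used. *)
Lemma oneBcosE (R : realType) (x : R) : 1 - cos x = sin (x / 2) ^+ 2 *+ 2.
Proof.
have -> : cos x = cos ((x / 2) *+ 2) by rewrite mulr2n -splitr.
by rewrite cos_mulr2n cos2sin2 !mulr2n; ring.
Qed.

Lemma abs_sin_le (R : realType) (x : R) : `|sin x| <= `|x|.
Proof. by have := dist_sin x 0; rewrite sin0 !subr0. Qed.

Lemma le1Bcos_sqr (R : realType) (x : R) : 1 - cos x <= x ^+ 2 / 2.
Proof.
rewrite oneBcosE -(real_normK (num_real (sin _))) -(real_normK (num_real x)).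
have h : `|sin (x / 2)| <= `|x| / 2.
  by rewrite (le_trans (abs_sin_le _))// normrM [`|2^-1|]ger0_norm.
have -> : `|x| ^+ 2 / 2 = (`|x| / 2) ^+ 2 *+ 2 by rewrite mulr2n; field.
by rewrite lerMn2r/= ler_sqr ?nnegrE// divr_ge0.
Qed.

Lemma dist_sin_id (R : realType) (x : R) : `|x - sin x| <= `|x| ^+ 3 / 2.
Proof.
wlog x0 : x / 0 <= x.
  move=> H; have [|/ltW x0] := leP 0 x; first exact: H.
  by have := H (- x); rewrite oppr_ge0 sinN -opprD !normrN => /(_ x0).
have [<-|x1] := eqVneq 0 x; first by rewrite sin0 subrr !normr0 expr0n mul0r.
have {}x0 : 0 < x by rewrite lt_neqAle x1.
have [|z] := @MVT R (fun y => y - sin y) (fun y => 1 - cos y) 0 x x0 _.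
- by apply: continuous_subspaceT => z; apply: cvgB => //; exact: continuous_sin.
rewrite in_itv/= sin0 !subr0 => /andP[z0 zx] ->.
rewrite normrM ger0_norm ?subr_ge0 ?cos_le1// exprSr mulrAC ler_wpM2r//.
rewrite (le_trans (le1Bcos_sqr _))// ler_wpM2r ?invr_ge0// ger0_norm ?(ltW x0)//.
by rewrite ler_sqr ?nnegrE ltW.
Qed.

Lemma dist_sin_id_sqr (R : realType) (x : R) : `|x - sin x| <= x ^+ 2.
Proof.
have [x1|x1] := leP `|x| 2.
  rewrite (le_trans (dist_sin_id _))// -(real_normK (num_real x)) exprSr -mulrA ler_piMr ?exprn_ge0//.
  by rewrite ler_pdivrMr// mul1r.
rewrite (le_trans (ler_normB _ _))// (le_trans (lerD (lexx _) (abs_sin_le _)))//.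
by rewrite -(real_normK (num_real x)) expr2 -mulr2n -mulr_natl ler_wpM2r// ltW.
Qed.

Lemma dist_1Bcos_sqr (R : realType) (x : R) : `|1 - cos x - x ^+ 2 / 2| <= `|x| ^+ 4.
Proof.
rewrite oneBcosE.
have -> : sin (x / 2) ^+ 2 *+ 2 - x ^+ 2 / 2 =
   - ((x / 2 - sin (x / 2)) * (x / 2 + sin (x / 2)) *+ 2) by rewrite !mulr2n; field.
rewrite normrN normrMn normrM.
have h1 := dist_sin_id (x / 2).
have h2 : `|x / 2 + sin (x / 2)| <= `|x|.
  rewrite (le_trans (ler_normD _ _))// (le_trans (lerD (lexx _) (abs_sin_le _)))//.
  by rewrite normrM [`|2^-1|]ger0_norm// -splitr.
have h3 : `|x / 2| ^+ 3 / 2 <= `|x| ^+ 3 / 2.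
  rewrite ler_pM2r ?invr_gt0// ler_pXn2r ?nnegrE// normrM [`|2^-1|]ger0_norm//.
  by rewrite ler_piMr// invf_le1// ler1n.
have h4 := ler_pM (normr_ge0 _) (normr_ge0 _) (le_trans h1 h3) h2.
rewrite mulr2n; have -> : `|x| ^+ 4 = `|x| ^+ 3 / 2 * `|x| + `|x| ^+ 3 / 2 * `|x| by field.
exact: lerD.
Qed.

Lemma integral_prob_cst d (T : measurableType d) (R : realType) (P : probability T R)
  (r : \bar R) : (\int[P]_w r = r)%E.
Proof.
rewrite -[LHS]/(\int[P]_w cst r w)%E integral_cst//.
by transitivity (r * 1)%E; [congr (_ * _)%E; exact: probability_setT|rewrite mule1].
Qed.

Section poisson_characteristic.
Local Open Scope ereal_scope.
Context d (Om : measurableType d) (R : realType) (P : probability Om R).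
Context d' (E : measurableType d') (nu : {measure set E -> \bar R}).
Variable N : R.-ker Om ~> E.
Hypothesis NP : is_poisson_random_measure P nu N.
Import HBSimple.

(** Listing the nonzero values only keeps every level set of finite measure when
    [g] is integrable. *)
Lemma sfun_indic_sum (g : {sfun E >-> R}) : exists n (c : 'I_n -> R),
  [/\ forall i, c i != 0%R, injective c &
   forall (phi : R -> R), phi 0%R = 0%R ->
   forall z, phi (g z) = (\sum_(i < n) phi (c i) * \1_(g @^-1` [set c i]) z)%R].
Proof.
pose s := [seq r <- finmap.enum_fset (fset_set (range g)) | r != 0%R].
have us : uniq s by rewrite filter_uniq// finmap.fset_uniq.
exists (size s), (fun i => tnth (in_tuple s) i); split.
- by move=> i; have := mem_tnth i (in_tuple s); rewrite mem_filter => /andP[].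
- by apply/tuple_uniqP.
move=> phi phi0 z; have [gz0|gz0] := eqVneq (g z) 0%R.
  rewrite gz0 phi0 big1// => i _; rewrite indicE memNset ?mulr0//= gz0 => i0.
  by have := mem_tnth i (in_tuple s); rewrite mem_filter -i0 eqxx.
have : g z \in s.
  by rewrite mem_filter gz0/= in_fset_set ?inE.
move=> /(tnthP (in_tuple s))[i gzi].
rewrite (bigD1 i)//= indicE mem_set/= ?gzi// mulr1 big1 ?addr0// => j ji.
rewrite indicE memNset ?mulr0//= gzi => ij.
have /tuple_uniqP tI : uniq (in_tuple s) by exact: us.
by rewrite (tI _ _ ij) eqxx in ji.
Qed.

Lemma measurable_kernel_Rintegral (h : E -> R) : measurable_fun setT h ->
  measurable_fun setT (fun w => \int[N w]_z h z)%R.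
Proof.
move=> mh; apply: measurableT_comp => //.
under eq_fun do rewrite integralE.
have mh' : measurable_fun setT (EFin \o h) by exact/measurable_EFinP.
apply: emeasurable_funB; apply: measurable_kernel_integral => //.
- exact: measurable_funepos.
- exact: measurable_funeneg.
Qed.

Lemma prm_lty A : measurable A -> nu A < +oo -> {ae P, forall w, N w A < +oo}.
Proof.
move=> mA Aoo; have iNA : P.-integrable setT (N ^~ A).
  apply/integrableP; split; first exact: measurable_kernel.
  under eq_integral do rewrite gee0_abs//.
  by rewrite (campbell_set NP).
apply: filterS (integrable_ae measurableT iNA) => w /= /(_ I).
by rewrite ge0_fin_numE.
Qed.

Lemma integrable_preimage_lty (g : E -> R) r : measurable_fun setT g ->
  nu.-integrable setT (EFin \o g) -> r != 0%R -> nu (g @^-1` [set r]) < +oo.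
Proof.
move=> mg ig r0.
have mA : measurable (g @^-1` [set r]) by rewrite -[X in measurable X]setTI; exact: mg.
have h : `|r|%:E * nu (g @^-1` [set r]) < +oo.
  have /integrableP[_] := ig; apply: le_lt_trans.
  apply: (@le_trans _ _ (\int[nu]_(z in g @^-1` [set r]) `|(EFin \o g) z|)).
    rewrite -[leLHS](integral_cst _ mA) le_eqVlt; apply/orP; left; apply/eqP.
    by apply: eq_integral => z; rewrite inE/= => ->.
  apply: ge0_subset_integral => //; apply/measurableT_comp => //.
  exact/measurable_EFinP.
rewrite ltey; apply/eqP => Aoo; move: h.
by rewrite Aoo gt0_muley ?ltxx// lte_fin normr_gt0.
Qed.

(** The level sets of a simple function carry independent Poisson counts, so
    this is [cos_sum_poisson]. *)
Lemma prm_cos_sfun (g : {sfun E >-> R}) b : nu.-integrable setT (EFin \o g) ->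
  \int[P]_w (cos (\int[N w]_z g z + b))%:E =
  (expR (\int[nu]_z (cos (g z) - 1)) * cos (\int[nu]_z sin (g z) + b))%:E.
Proof.
move=> ig; have [n [c [c0 cI gE]]] := sfun_indic_sum g.
pose A i := g @^-1` [set c i].
have mA i : measurable (A i) by rewrite -[X in measurable X]setTI; exact: measurable_funP.
have Aoo i : nu (A i) < +oo by exact: integrable_preimage_lty.
have tA : trivIset setT A by move=> i j _ _ [z []]; rewrite /A/= => -> /cI.
have RE (m : {measure set E -> \bar R}) (phi : R -> R) : phi 0%R = 0%R ->
    (forall i, m (A i) < +oo) ->
    (\int[m]_z phi (g z) = \sum_(i < n) phi (c i) * fine (m (A i)))%R.
  move=> phi0 moo; rewrite -(Rintegral_indic_sum _ mA moo).2.
  by apply: eq_Rintegral => z _; exact: gE.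
transitivity (\int[P]_w (cos (\sum_(i < n) c i * fine (N w (A i)) + b))%:E).
  apply: ae_eq_integral => //.
  - apply/measurable_EFinP; apply: measurable_cos; apply: measurable_funD => //.
    by apply: measurable_kernel_Rintegral; exact: measurable_funP.
  - apply/measurable_EFinP; apply: measurable_cos; apply: measurable_funD => //.
    apply: measurable_sum => i; apply: measurable_funM => //.
    by apply: measurableT_comp => //; exact: measurable_kernel.
  - have : {ae P, forall w, forall i, N w (A i) < +oo}.
      by apply: filter_forall => i; exact: prm_lty.
    by apply: filterS => w Nw _; rewrite (RE (N w) id).
rewrite (@cos_sum_poisson _ _ _ P n (fun i w => N w (A i)) (fun i => fine (nu (A i))))//.
- rewrite (RE nu (fun x => cos x - 1)%R) ?cos0 ?subrr// (RE nu sin) ?sin0//.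
  by congr ((expR _ * cos (_ + _))%:E); apply: eq_bigr => i _; rewrite mulrC.
- by move=> i; exact: measurable_kernel.
- by move=> i k; exact: prm_weight.
- exact: (prm_independent NP).
Qed.

Lemma integrable_prm (h : E -> R) : nu.-integrable setT (EFin \o h) ->
  {ae P, forall w, (N w).-integrable setT (EFin \o h)}.
Proof.
move=> ih; have mh := measurable_int _ ih.
have mah : measurable_fun setT (fun z => `|(EFin \o h) z|) by exact: measurableT_comp.
pose H w := \int[N w]_z `|(EFin \o h) z|.
have iH : P.-integrable setT H.
  apply/integrableP; split; first exact: measurable_kernel_integral.
  under eq_integral do rewrite gee0_abs ?integral_ge0//.
  by rewrite (campbell NP)//; have /integrableP[] := ih.
apply: filterS (integrable_ae measurableT iH) => w /= /(_ I) Hw.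
by apply/integrableP; split => //; rewrite ltey_eq Hw.
Qed.

(** By [dist_cos] and Campbell's formula the left-hand side of [prm_cos_sfun] is
    continuous in [L^1]; [Rintegral_dist] does the same for the right-hand side, and
    [prm_cos] follows by density of the simple functions. *)
Lemma cos_prm_dist (h g : E -> R) b : nu.-integrable setT (EFin \o h) ->
  nu.-integrable setT (EFin \o g) ->
  `| \int[P]_w (cos (\int[N w]_z h z + b))%:E - \int[P]_w (cos (\int[N w]_z g z + b))%:E |
   <= \int[nu]_z `| (h z)%:E - (g z)%:E|.
Proof.
move=> ih ig; have /measurable_EFinP mh := measurable_int _ ih.
have /measurable_EFinP mg := measurable_int _ ig.
have mI k c : measurable_fun setT k -> measurable_fun setT (fun w => \int[N w]_z k z + c)%R.
  by move=> mk; apply: measurable_funD => //; exact: measurable_kernel_Rintegral.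
rewrite -integralB//; try (apply: integrable_cos => //; exact: mI).
apply: (le_trans (le_abse_integral _ _ _)) => //.
  apply: emeasurable_funB; apply/measurable_EFinP; apply: measurable_cos; exact: mI.
rewrite -(campbell NP)//; last first.
  by apply: measurableT_comp => //; apply: emeasurable_funB; exact/measurable_EFinP.
apply: ae_ge0_le_integral => //.
- apply: measurableT_comp => //.
  apply: emeasurable_funB; apply/measurable_EFinP; apply: measurable_cos; exact: mI.
- by move=> w _; exact: integral_ge0.
- apply: measurable_kernel_integral => //.
  by apply: measurableT_comp => //; apply: emeasurable_funB; exact/measurable_EFinP.
have := integrable_prm ih; have := integrable_prm ig.
apply: filterS2 => w wg wh _.
have iB : (N w).-integrable setT (EFin \o (h \- g)%R).
  rewrite (_ : EFin \o _ = (EFin \o h) \- (EFin \o g)); last exact/funext.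
  exact: integrableB.
apply: (@le_trans _ _ (`|\int[N w]_z (h z - g z)|%R)%:E).
  rewrite RintegralB// -EFinB abse_EFin lee_fin.
  apply: le_trans (dist_cos _ _) _.
  by rewrite opprD addrACA subrr addr0.
rewrite EFin_normr_Rintegral//.
apply: (le_trans (le_abse_integral _ _ _)) => //; first exact: measurable_int iB.
Qed.

Lemma Rintegral_dist (m : {measure set E -> \bar R}) (h g : E -> R) (phi : R -> R) :
  m.-integrable setT (EFin \o h) -> m.-integrable setT (EFin \o g) ->
  measurable_fun setT phi -> phi 0%R = 0%R ->
  (forall x y, `|phi x - phi y| <= `|x - y|)%R ->
  (`|\int[m]_z phi (h z) - \int[m]_z phi (g z)| <= \int[m]_z `|h z - g z|)%R.
Proof.
move=> ih ig mphi phi0 Lphi.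
have /measurable_EFinP mh := measurable_int _ ih.
have /measurable_EFinP mg := measurable_int _ ig.
have iphi k : m.-integrable setT (EFin \o k) -> m.-integrable setT (EFin \o (phi \o k)).
  move=> ik; have /measurable_EFinP mk := measurable_int _ ik.
  apply: le_integrable ik => //; first by apply/measurable_EFinP; exact: measurableT_comp.
  by move=> z _ /=; rewrite lee_fin; have := Lphi (k z) 0%R; rewrite phi0 !subr0.
have iB k l : m.-integrable setT (EFin \o k) -> m.-integrable setT (EFin \o l) ->
    m.-integrable setT (EFin \o (k \- l)%R).
  move=> ik il; rewrite (_ : EFin \o _ = (EFin \o k) \- (EFin \o l)); last exact/funext.
  exact: integrableB.
rewrite -RintegralB//; [|exact: iphi|exact: iphi].
apply: le_trans (le_normr_Rintegral _ _) _ => //; first exact: iB (iphi _ ih) (iphi _ ig).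
apply: le_Rintegral => //; first by apply: integrable_norm; exact: iB (iphi _ ih) (iphi _ ig).
by apply: integrable_norm; exact: iB.
Qed.

(** The real part of [E exp (i (int h dN + b)) = exp (i b + int (exp (i h) - 1) dnu)]. *)
Lemma prm_cos (h : E -> R) b : nu.-integrable setT (EFin \o h) ->
  \int[P]_w (cos (\int[N w]_z h z + b))%:E =
  (expR (\int[nu]_z (cos (h z) - 1)) * cos (\int[nu]_z sin (h z) + b))%:E.
Proof.
move=> ih; have [g [ig gh g0]] := approximation_sfun_integrable measurableT ih.
have /measurable_EFinP mh := measurable_int _ ih.
pose LHS k := \int[P]_w (cos (\int[N w]_z k z + b))%:E.
have LHSfin k : measurable_fun setT k -> LHS k \is a fin_num.
  move=> mk; apply: integrable_fin_num => //; apply: integrable_cos => //.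
  by apply: measurable_funD => //; exact: measurable_kernel_Rintegral.
pose D n := fine (\int[nu]_z `|(h z)%:E - (g n z)%:E|).
have DE n : \int[nu]_z `|(h z)%:E - (g n z)%:E| = (D n)%:E.
  rewrite fineK//; apply: integrable_fin_num => //.
  by apply: integrable_abse; exact: (integrableB measurableT ih (ig n)).
have D0 : (D n @[n --> \oo] --> 0)%R by exact: fine_cvg g0.
have DR n : D n = (\int[nu]_z `|h z - g n z|)%R.
  by rewrite /D /Rintegral; congr fine; apply: eq_integral => z _.
have cvgphi (phi : R -> R) : measurable_fun setT phi -> phi 0%R = 0%R ->
    (forall x y, `|phi x - phi y| <= `|x - y|)%R ->
    (\int[nu]_z phi (g n z) @[n --> \oo] --> \int[nu]_z phi (h z))%R.
  move=> mphi phi0 L; apply/cvgrPdist_le => e e0.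
  have /cvgrPdist_le/(_ e e0) := D0; apply: filterS => n; apply: le_trans.
  by rewrite sub0r normrN (le_trans (Rintegral_dist ih (ig n) mphi phi0 L))// -DR ler_norm.
have RHSn : (expR (\int[nu]_z (cos (g n z) - 1)) * cos (\int[nu]_z sin (g n z) + b)
    @[n --> \oo] -->
    expR (\int[nu]_z (cos (h z) - 1)) * cos (\int[nu]_z sin (h z) + b))%R.
  apply: cvgM.
    apply: continuous_cvg; first exact: continuous_expR.
    apply: (cvgphi (fun x => cos x - 1)%R); rewrite ?cos0 ?subrr//.
      by apply: measurable_funB => //; exact: measurable_cos.
    by move=> x y; rewrite (_ : cos x - 1 - (cos y - 1) = cos x - cos y)%R ?dist_cos//; ring.
  apply: continuous_cvg; first exact: continuous_cos.
  apply: cvgD; last exact: cvg_cst.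
  apply: cvgphi; rewrite ?sin0//; first exact: measurable_sin.
  exact: dist_sin.
have LHSn : (fine (LHS (g n)) @[n --> \oo] --> fine (LHS h))%R.
  apply/cvgrPdist_le => e e0.
  have /cvgrPdist_le/(_ e e0) := D0; apply: filterS => n; apply: le_trans.
  rewrite sub0r normrN (le_trans _ (ler_norm _))// -lee_fin -DE.
  apply: le_trans (cos_prm_dist b ih (ig n)).
  rewrite -abse_EFin EFinB fineK; last exact: LHSfin.
  by rewrite fineK; last exact: LHSfin.
rewrite -/(LHS h) -(fineK (LHSfin _ mh)); congr EFin.
apply: (cvg_unique _ LHSn) => //.
rewrite (_ : (fun n => _) = (fun n => expR (\int[nu]_z (cos (g n z) - 1)) * cos (\int[nu]_z sin (g n z) + b)))%R//.
by apply/funext => n; rewrite /LHS prm_cos_sfun.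
Qed.

Lemma prm_cosZ (h : E -> R) t b : nu.-integrable setT (EFin \o h) ->
  \int[P]_w (cos (t * (\int[N w]_z h z) + b))%:E =
  (expR (\int[nu]_z (cos (t * h z) - 1)) * cos (\int[nu]_z sin (t * h z) + b))%:E.
Proof.
move=> ih; have /measurable_EFinP mh := measurable_int _ ih.
have ith : nu.-integrable setT (EFin \o (fun z => t * h z)%R).
  by rewrite (_ : EFin \o _ = (fun z => t%:E * (h z)%:E)%E)//; exact: integrableZl.
rewrite -(prm_cos b ith); apply: ae_eq_integral => //.
- apply/measurable_EFinP; apply: measurable_cos; apply: measurable_funD => //.
  by apply: measurable_funM => //; exact: measurable_kernel_Rintegral.
- apply/measurable_EFinP; apply: measurable_cos; apply: measurable_funD => //.
  by apply: measurable_kernel_Rintegral; exact: measurable_funM.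
- by have := integrable_prm ih; apply: filterS => w wh _; rewrite RintegralZl.
Qed.

(** The modulus is at least [1 - W / 2] and the phase at most [W], because
    [1 - cos g <= g ^+ 2 / 2] and [`|sin g - g| <= g ^+ 2]. *)
Lemma prm_char_bound (g : E -> R) (W : R) : nu.-integrable setT (EFin \o g) ->
  \int[nu]_z (g z ^+ 2)%:E <= W%:E ->
  (1 - expR (\int[nu]_z (cos (g z) - 1)) * cos (\int[nu]_z sin (g z) - \int[nu]_z g z)
   <= W / 2 + W ^+ 2 / 2)%R.
Proof.
move=> ig gW; have /measurable_EFinP mg := measurable_int _ ig.
have ig2 : nu.-integrable setT (EFin \o (fun z => g z ^+ 2)%R).
  apply/integrableP; split; first by apply/measurable_EFinP; exact: measurable_funX.
  rewrite (le_lt_trans _ (ltry W))//; apply: le_trans gW.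
  by under eq_integral do rewrite /= ger0_norm ?sqr_ge0//.
have ig2' : nu.-integrable setT (EFin \o (fun z => g z ^+ 2 / 2)%R).
  by rewrite (_ : EFin \o _ = (fun z => (g z ^+ 2)%:E * 2^-1%:E)%E)//; exact: integrableZr.
have {}gW : (\int[nu]_z (g z ^+ 2) <= W)%R.
  by rewrite /Rintegral -lee_fin fineK//; exact: integrable_fin_num.
have isin : nu.-integrable setT (EFin \o (fun z => sin (g z))%R).
  apply: le_integrable ig => //; first by apply/measurable_EFinP; exact: measurable_sin.
  by move=> z _; rewrite /= lee_fin abs_sin_le.
have icos : nu.-integrable setT (EFin \o (fun z => 1 - cos (g z))%R).
  apply: le_integrable ig2' => //.
    by apply/measurable_EFinP; apply: measurable_funB => //; exact: measurable_cos.
  move=> z _; rewrite /= lee_fin !ger0_norm ?subr_ge0 ?cos_le1 ?le1Bcos_sqr//.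
  by rewrite divr_ge0// sqr_ge0.
set a := (\int[nu]_z (1 - cos (g z)))%R.
have -> : (\int[nu]_z (cos (g z) - 1) = - a)%R.
  transitivity (-1 * a)%R; last by rewrite mulN1r.
  rewrite /a -RintegralZl//; apply: eq_Rintegral => z _.
  by rewrite mulN1r opprB.
have a0 : (0 <= a)%R by apply: Rintegral_ge0 => z _; rewrite subr_ge0 cos_le1.
have aW : (a <= W / 2)%R.
  apply: (@le_trans _ _ (\int[nu]_z (g z ^+ 2 / 2))%R).
    by apply: le_Rintegral => // z _; exact: le1Bcos_sqr.
  by rewrite RintegralZr// ler_pM2r.
set beta := (\int[nu]_z sin (g z) - _)%R.
have bW : (`|beta| <= W)%R.
  rewrite /beta -RintegralB//.
  have iB : nu.-integrable setT (EFin \o (fun z => sin (g z) - g z)%R).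
    by rewrite (_ : EFin \o _ = (EFin \o (fun z => sin (g z))%R) \- (EFin \o g))//; exact: integrableB.
  apply: le_trans (le_normr_Rintegral _ iB) _ => //; apply: le_trans gW.
  apply: le_Rintegral => //; first exact: integrable_norm iB.
  by move=> z _; rewrite distrC dist_sin_id_sqr.
have e1 : (expR (- a) <= 1)%R by rewrite -expR0 ler_expR oppr_le0.
have -> : (1 - expR (- a) * cos beta = (1 - expR (- a)) + expR (- a) * (1 - cos beta))%R by ring.
apply: lerD.
  by rewrite (le_trans _ aW)// lerBlDr -lerBlDl; have := expR_ge1Dx (- a).
apply: (@le_trans _ _ (1 - cos beta)%R).
  by rewrite ler_piMl// subr_ge0 cos_le1.
rewrite (le_trans (le1Bcos_sqr _))// ler_pM2r// -(real_normK (num_real beta)).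
by rewrite ler_sqr ?nnegrE// (le_trans _ bW).
Qed.

(** The variance is read off the cosine transform: [2 / s ^+ 2 * (1 - cos (s * Y))]
    tends to [Y ^+ 2] as [s] tends to [0], its mean is bounded by [prm_char_bound],
    and Fatou's lemma concludes. *)
Lemma prm_variance_le (h : E -> R) (V : R) : nu.-integrable setT (EFin \o h) ->
  \int[nu]_z (h z ^+ 2)%:E <= V%:E ->
  \int[P]_w ((\int[N w]_z h z - \int[nu]_z h z) ^+ 2)%:E <= V%:E.
Proof.
move=> ih hV; have /measurable_EFinP mh := measurable_int _ ih.
set m := (\int[nu]_z h z)%R.
pose s n : R := (n.+1%:R^-1)%R.
have s0 n : (0 < s n)%R by rewrite invr_gt0.
pose Y w := (\int[N w]_z h z - m)%R.
have mY : measurable_fun setT Y by apply: measurable_funB => //; exact: measurable_kernel_Rintegral.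
pose f n w := (2 / s n ^+ 2 * (1 - cos (s n * Y w)))%R.
have f0 n w : (0 <= f n w)%R.
  by rewrite mulr_ge0 ?subr_ge0 ?cos_le1// divr_ge0// sqr_ge0.
have mf n : measurable_fun setT (f n).
  by apply: measurable_funM => //; apply: measurable_funB => //; apply: measurable_cos;
    exact: measurable_funM.
have s_cvg : (s n @[n --> \oo] --> 0)%R by exact: cvg_harmonic.
have s2_cvg : (s n ^+ 2 @[n --> \oo] --> 0)%R.
  by rewrite -(mulr0 0)%R; under eq_fun do rewrite expr2; exact: cvgM.
have fY w : (f n w @[n --> \oo] --> Y w ^+ 2)%R.
  apply/subr_cvg0/norm_cvg0P => /=.
  apply: (@squeeze_cvgr _ _ _ _ (fun=> 0)%R (fun n => 2 * `|Y w| ^+ 4 * s n ^+ 2)%R).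
  - near=> n; rewrite normr_ge0/= /f.
    have sn0 : (s n != 0)%R by rewrite gt_eqF.
    have -> : (2 / s n ^+ 2 * (1 - cos (s n * Y w)) - Y w ^+ 2 =
      2 / s n ^+ 2 * (1 - cos (s n * Y w) - (s n * Y w) ^+ 2 / 2))%R by field.
    rewrite normrM ger0_norm ?divr_ge0 ?sqr_ge0//.
    have -> : (2 * `|Y w| ^+ 4 * s n ^+ 2 = 2 / s n ^+ 2 * `|s n * Y w| ^+ 4)%R.
      by rewrite normrM (ger0_norm (ltW (s0 n))); field.
    by rewrite ler_wpM2l ?dist_1Bcos_sqr// divr_ge0// sqr_ge0.
    exact: ltW.
  - exact: cvg_cst.
  - rewrite -[X in _ --> X](mulr0 (2 * `|Y w| ^+ 4)%R); apply: cvgMr.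
    exact: s2_cvg.
have intf n : \int[P]_w (f n w)%:E <= (V + s n ^+ 2 * V ^+ 2)%:E.
  have iA : P.-integrable setT (fun w => (cos (s n * Y w))%:E).
    by apply: integrable_cos => //; exact: measurable_funM.
  have intE : \int[P]_w (cos (s n * Y w))%:E = (expR (\int[nu]_z (cos (s n * h z) - 1)) *
      cos (\int[nu]_z sin (s n * h z) - \int[nu]_z (s n * h z)))%:E.
    rewrite RintegralZl// -prm_cosZ//; apply: eq_integral => w _.
    by rewrite /Y mulrBr.
  under eq_integral do rewrite EFinM.
  rewrite ge0_integralZl//; last 2 first.
  - apply/measurable_EFinP; apply: measurable_funB => //; apply: measurable_cos.
    exact: measurable_funM.
  - by rewrite lee_fin divr_ge0// sqr_ge0.
  rewrite integralB_EFin//; last first.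
    exact: finite_measure_integrable_cst.
  rewrite integral_prob_cst intE -EFinB -EFinM lee_fin.
  have ish : nu.-integrable setT (EFin \o (fun z => s n * h z)%R).
    by rewrite (_ : EFin \o _ = (fun z => (s n)%:E * (h z)%:E)%E)//; exact: integrableZl.
  have bd : \int[nu]_z ((s n * h z) ^+ 2)%:E <= (s n ^+ 2 * V)%:E.
    under eq_integral do rewrite exprMn EFinM.
    rewrite ge0_integralZl//; last 3 first.
    - by apply/measurable_EFinP; exact: measurable_funX.
    - by move=> z _; rewrite lee_fin sqr_ge0.
    - by rewrite lee_fin sqr_ge0.
    by rewrite [leRHS]EFinM lee_wpmul2l// lee_fin sqr_ge0.
  have := prm_char_bound ish bd.
  rewrite -(ler_pM2l (_ : 0 < 2 / s n ^+ 2)%R) ?divr_gt0 ?exprn_gt0//.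
  move=> /le_trans; apply.
  have sn0 : (s n != 0)%R by rewrite gt_eqF.
  by rewrite le_eqVlt; apply/orP; left; apply/eqP; field.
have -> : \int[P]_w (Y w ^+ 2)%:E = \int[P]_w (limn_einf (fun n => (f n w)%:E)).
  apply: eq_integral => w _; have fYE : (f n w)%:E @[n --> \oo] --> (Y w ^+ 2)%:E.
    by apply: cvg_EFin; [exact: nearW|exact: fY].
  by rewrite (cvg_limn_einf_sup fYE).1.
apply: (le_trans (fatou P measurableT _ _)) => //.
- by move=> n; exact/measurable_EFinP.
- by move=> n w _; rewrite lee_fin.
have bcvg : (V + s n ^+ 2 * V ^+ 2)%:E @[n --> \oo] --> V%:E.
  apply: cvg_EFin; first exact: nearW.
  rewrite -[X in _ --> X]addr0; apply: cvgD; first exact: cvg_cst.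
  rewrite -(mul0r (V ^+ 2))%R; apply: cvgMl.
  exact: s2_cvg.
rewrite limn_einf_lim -(cvg_lim _ bcvg)//; apply: lee_lim.
- exact: is_cvg_einfs.
- by apply/cvg_ex; eexists; exact: bcvg.
apply: nearW => n; apply: le_trans (intf n).
by apply: ereal_inf_lbound; exists n => //=.
Unshelve. all: by end_near. Qed.

End poisson_characteristic.

(** * Convergence in law from cosine transforms *)

Section measurable_continuous.
Context {R : realType}.

Lemma measurable_floorR : measurable_fun setT (fun x : R => (Num.floor x)%:~R : R).
Proof.
apply: nondecreasing_measurable => // x y xy.
by rewrite ler_int; apply: le_floor.
Qed.

(** Rounding the coordinates down to
    multiples of [1 / (k + 1)] gives functions with countably many values that
    converge pointwise, by continuity of [g]. *)
Lemma measurable_continuous_row d (T : measurableType d) n (g : 'rV[R]_n -> R)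
    (Y : 'I_n -> T -> R) : continuous g -> (forall i, measurable_fun setT (Y i)) ->
  measurable_fun setT (fun w => g (\row_i Y i w)).
Proof.
move=> cg mY.
pose fl (k : nat) (x : R) : int := Num.floor (k.+1%:R * x).
pose D (k : nat) (w : T) : 'rV[R]_n := \row_i ((fl k (Y i w))%:~R / k.+1%:R).
apply: (@measurable_fun_cvg _ _ _ _ (fun k w => g (D k w))).
- move=> k _ B mB; rewrite setTI.
  pose F (m : {ffun 'I_n -> int}) : set T :=
    if `[< B (g (\row_i ((m i)%:~R / k.+1%:R))) >] then
      \bigcap_(i in [set: 'I_n]) [set w | fl k (Y i w) = m i] else set0.
  rewrite (_ : _ @^-1` B = \bigcup_m F m).
    apply: countable_bigcupT_measurable => // m.
    rewrite /F; case: asboolP => // _; apply: fin_bigcap_measurable => // i _.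
    have mf : measurable_fun setT (fun w => (fl k (Y i w))%:~R : R).
      by apply: (measurableT_comp measurable_floorR); apply: measurable_funM.
    have := mf measurableT [set (m i)%:~R]; rewrite setTI.
    rewrite (_ : _ @^-1` _ = [set w | fl k (Y i w) = m i]); first exact.
    by apply/seteqP; split => w /=; [move=> /eqP; rewrite eqr_int => /eqP|move=> ->].
  apply/seteqP; split => w.
  + move=> Bw; exists [ffun i => fl k (Y i w)] => //; rewrite /F asboolT.
      by move=> i _ /=; rewrite ffunE.
    rewrite (_ : \row_i _ = D k w)//; apply/rowP => i; by rewrite !mxE ffunE.
  + move=> [m _]; rewrite /F; case: asboolP => // Bm Fm.
    rewrite /= (_ : D k w = \row_i ((m i)%:~R / k.+1%:R))//.
    by apply/rowP => i; rewrite !mxE (Fm i I).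
- move=> w _; apply: (cvg_comp (fun k => D k w) g); last exact: cg.
  apply/cvg_ballP => e e0; near=> k; split => // i j; rewrite !mxE.
  rewrite /ball/= -normrN opprB.
  have k0 : (0 : R) < k.+1%:R by [].
  have -> : (fl k (Y j w))%:~R / k.+1%:R - Y j w =
     ((fl k (Y j w))%:~R - k.+1%:R * Y j w) / k.+1%:R by field; rewrite gt_eqF.
  rewrite normrM normfV (gtr0_norm k0) ltr_pdivrMr//.
  apply: (@le_lt_trans _ _ 1).
    rewrite ler_norml lerBlDl.
    have := floor_itv (k.+1%:R * Y j w); rewrite -/(fl k (Y j w)) => /andP[f1 f2].
    rewrite intrD in f2; lra.
  rewrite mulrC -ltr_pdivrMr// mul1r.
  rewrite -natr1 ltr_wpDr//; near: k; exact: nbhs_infty_gtr.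
Unshelve. all: by end_near. Qed.

Lemma continuous_prod_measurable (f : R * R -> R) : continuous f -> measurable_fun setT f.
Proof.
move=> cf.
pose g (v : 'rV[R]_2) := f (v ord0 ord0, v ord0 ord_max).
have cg : continuous g.
  move=> v; apply: (cvg_comp (fun v : 'rV[R]_2 => (v ord0 ord0, v ord0 ord_max)) f); last exact: cf.
  move=> A [[B1 B2]/= [n1 n2] sB].
  have h1 : nbhs v ((fun v' : 'rV[R]_2 => v' ord0 ord0) @^-1` B1) by exact: coord_continuous n1.
  have h2 : nbhs v ((fun v' : 'rV[R]_2 => v' ord0 ord_max) @^-1` B2) by exact: coord_continuous n2.
  by apply: filterS (filterI h1 h2) => v' [? ?]; exact: sB.
pose Y (i : 'I_2) (x : R * R) := if i == ord0 then x.1 else x.2.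
have := @measurable_continuous_row _ (R * R)%type 2 g Y cg.
rewrite (_ : (fun w => g _) = f); last first.
  by apply/funext => -[x y]; rewrite /g /Y !mxE/=.
move=> h; apply: h => i; rewrite /Y; case: (i == ord0).
  exact: measurable_fst.
exact: measurable_snd.
Qed.

End measurable_continuous.

Section bernstein.
Context {R : realType}.

(** The probability that a binomial variable with parameters [N] and [p] equals
    [j], by conditioning on the last trial: this form makes it clear that it is a
    polynomial in [p] and gives the moments by induction. *)
Fixpoint bern (N : nat) (p : R) (j : nat) : R :=
  match N with
  | 0 => (j == 0%N)%:R
  | N'.+1 => (1 - p) * bern N' p j + p * (if j is j'.+1 then bern N' p j' else 0)
  end.

Lemma bern_ge0 N p j : 0 <= p <= 1 -> 0 <= bern N p j.
Proof.
move=> /andP[p0 p1]; elim: N j => [|N IH] j //=.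
by rewrite addr_ge0 ?mulr_ge0 ?subr_ge0//; case: j.
Qed.

Lemma bern_gt N p j : (N < j)%N -> bern N p j = 0.
Proof.
elim: N j => [|N IH] [|j]//= Nj.
by rewrite !IH// ?mulr0 ?addr0// ltnW.
Qed.

Lemma bern_sumS N p (phi : nat -> R) :
  \sum_(j < N.+2) phi j * bern N.+1 p j =
  (1 - p) * (\sum_(j < N.+1) phi j * bern N p j) +
  p * \sum_(j < N.+1) phi j.+1 * bern N p j.
Proof.
under eq_bigr => j _ do rewrite /= mulrDr.
rewrite big_split/=; congr (_ + _).
  rewrite big_ord_recr/= bern_gt// !mulr0 addr0 mulr_sumr.
  by apply: eq_bigr => j _; rewrite mulrCA.
rewrite big_ord_recl/= !mulr0 add0r mulr_sumr.
by apply: eq_bigr => j _; rewrite mulrCA.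
Qed.

Lemma bern_sum1 N p : \sum_(j < N.+1) bern N p j = 1.
Proof.
elim: N => [|N IH]; first by rewrite big_ord1.
transitivity (\sum_(j < N.+2) 1 * bern N.+1 p j).
  by apply: eq_bigr => j _; rewrite mul1r.
rewrite (bern_sumS N p (fun=> 1)).
under eq_bigr => j _ do rewrite mul1r.
by rewrite IH; ring.
Qed.

Lemma bern_mean N p : \sum_(j < N.+1) (j%:R - N%:R * p) * bern N p j = 0.
Proof.
elim: N => [|N IH]; first by rewrite big_ord1/= mul0r subrr mul0r.
rewrite (bern_sumS N p (fun j => j%:R - N.+1%:R * p)).
have E c : \sum_(j < N.+1) (j%:R - N%:R * p + c) * bern N p j = c.
  under eq_bigr do rewrite mulrDl.
  by rewrite big_split/= IH -mulr_sumr bern_sum1 add0r mulr1.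
rewrite (eq_bigr (fun j : 'I_N.+1 => (j%:R - N%:R * p + (- p)) * bern N p j)); last first.
  by move=> j _; rewrite -natr1; congr (_ * _); ring.
rewrite E (eq_bigr (fun j : 'I_N.+1 => (j%:R - N%:R * p + (1 - p)) * bern N p j)); last first.
  by move=> j _; rewrite -natr1 -(natr1 N); congr (_ * _); ring.
by rewrite E; ring.
Qed.

Lemma bern_variance N p :
  \sum_(j < N.+1) (j%:R - N%:R * p) ^+ 2 * bern N p j = N%:R * p * (1 - p).
Proof.
elim: N => [|N IH]; first by rewrite big_ord1/= !mul0r subrr expr0n mul0r.
rewrite (bern_sumS N p (fun j => (j%:R - N.+1%:R * p) ^+ 2)).
have E c : \sum_(j < N.+1) (j%:R - N%:R * p + c) ^+ 2 * bern N p j =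
    N%:R * p * (1 - p) + c ^+ 2.
  rewrite (eq_bigr (fun j : 'I_N.+1 => (j%:R - N%:R * p) ^+ 2 * bern N p j +
    (c *+ 2 * ((j%:R - N%:R * p) * bern N p j) + c ^+ 2 * bern N p j))); last first.
    by move=> j _; rewrite mulr2n; ring.
  by rewrite !big_split/= IH -!mulr_sumr bern_mean bern_sum1 mulr0 add0r mulr1.
rewrite (eq_bigr (fun j : 'I_N.+1 => (j%:R - N%:R * p + (- p)) ^+ 2 * bern N p j)); last first.
  by move=> j _; rewrite -natr1; congr (_ ^+ 2 * _); ring.
rewrite E (eq_bigr (fun j : 'I_N.+1 => (j%:R - N%:R * p + (1 - p)) ^+ 2 * bern N p j)); last first.
  by move=> j _; rewrite -natr1 -(natr1 N); congr (_ ^+ 2 * _); ring.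
by rewrite E -natr1; ring.
Qed.

Lemma bern_variance_le N p : 0 <= p <= 1 ->
  \sum_(j < N.+2) (p - j%:R / N.+1%:R) ^+ 2 * bern N.+1 p j <= N.+1%:R^-1.
Proof.
move=> p01.
have N0 : (N.+1%:R : R) != 0 by [].
rewrite (eq_bigr (fun j : 'I_N.+2 => N.+1%:R ^- 2 *
    ((j%:R - N.+1%:R * p) ^+ 2 * bern N.+1 p j))); last first.
  by move=> j _; rewrite mulrA; congr (_ * _); field; rewrite addrC natr1.
rewrite -mulr_sumr bern_variance.
have -> : N.+1%:R ^- 2 * (N.+1%:R * p * (1 - p)) = N.+1%:R^-1 * (p * (1 - p)).
  by field; rewrite addrC natr1.
rewrite ler_piMr ?invr_ge0//; have /andP[p0 p1] := p01; nra.
Qed.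

Variables (m : nat).
Implicit Types (q : 'I_m -> R).

(** The law of [m] independent binomial variables, which makes
    multivariate Bernstein polynomials into expectations. *)
Definition bernW N q (f : {ffun 'I_m -> 'I_N.+1}) : R := \prod_i bern N (q i) (f i).

Lemma bernW_ge0 N q f : (forall i, 0 <= q i <= 1) -> 0 <= @bernW N q f.
Proof. by move=> q01; apply: prodr_ge0 => i _; exact: bern_ge0. Qed.

Lemma bernW_sum1 N q : \sum_(f : {ffun 'I_m -> 'I_N.+1}) bernW q f = 1.
Proof.
rewrite -(bigA_distr_bigA (fun i (j : 'I_N.+1) => bern N (q i) j)) big1// => i _.
exact: bern_sum1.
Qed.

Lemma bernW_coord N q (i : 'I_m) (phi : nat -> R) :
  \sum_(f : {ffun 'I_m -> 'I_N.+1}) phi (f i) * bernW q f = \sum_(j < N.+1) phi j * bern N (q i) j.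
Proof.
transitivity (\sum_(f : {ffun 'I_m -> 'I_N.+1})
   \prod_k ((if k == i then phi (f k) else 1) * bern N (q k) (f k))).
  apply: eq_bigr => f _; rewrite big_split/=; congr (_ * _).
  by rewrite (bigD1 i)//= eqxx big1 ?mulr1// => k /negbTE ->.
rewrite -(bigA_distr_bigA (fun k (j : 'I_N.+1) => (if k == i then phi j else 1) * bern N (q k) j)).
rewrite (bigD1 i)//= eqxx [X in _ * X]big1 ?mulr1// => k /negbTE ->.
under eq_bigr do rewrite mul1r.
exact: bern_sum1.
Qed.

(** Bernstein's argument: where the grid point is within [dl] of [q] the error is
    at most [e], and Chebyshev's inequality bounds the weight of the rest. *)
Lemma bernW_approx N q (gam : ('I_m -> R) -> R) (M e dl : R) :
  (forall i, 0 <= q i <= 1) -> 0 < dl -> 0 <= e ->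
  (forall p, `|gam p| <= M) ->
  (forall p, (forall i, `|q i - p i| < dl) -> `|gam q - gam p| <= e) ->
  `|gam q - \sum_(f : {ffun 'I_m -> 'I_N.+2}) gam (fun i => (f i)%:R / N.+1%:R) * bernW q f|
   <= e + M *+ 2 / dl ^+ 2 * (m%:R / N.+1%:R).
Proof.
move=> q01 dl0 e0 gM ge.
have M0 : 0 <= M by exact: le_trans (gM q).
have -> : gam q = \sum_(f : {ffun 'I_m -> 'I_N.+2}) gam q * bernW q f.
  by rewrite -mulr_sumr bernW_sum1 mulr1.
rewrite -sumrB.
apply: (le_trans (ler_norm_sum _ _ _)).
pose V (f : {ffun 'I_m -> 'I_N.+2}) := \sum_i (q i - (f i)%:R / N.+1%:R) ^+ 2.
apply: (@le_trans _ _ (\sum_(f : {ffun 'I_m -> 'I_N.+2}) (e + M *+ 2 / dl ^+ 2 * V f) * bernW q f)).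
  apply: ler_sum => f _; rewrite -mulrBl normrM [X in _ * X]ger0_norm ?bernW_ge0//.
  rewrite ler_wpM2r ?bernW_ge0//.
  have V0 : 0 <= V f by apply: sumr_ge0 => i _; exact: sqr_ge0.
  have c0 : 0 <= M *+ 2 / dl ^+ 2 by rewrite divr_ge0 ?mulrn_wge0// sqr_ge0.
  have [|/existsNP] := pselect (forall i, `|q i - (f i)%:R / N.+1%:R| < dl).
    by move=> /ge /le_trans; apply; rewrite lerDl mulr_ge0.
  move=> [i /negP]; rewrite -leNgt => dli.
  apply: (@le_trans _ _ (M *+ 2)).
    by rewrite (le_trans (ler_normB _ _))// mulr2n lerD.
  apply: (@le_trans _ _ (M *+ 2 / dl ^+ 2 * V f)); last by rewrite lerDr.
  rewrite -[leLHS]mulr1 -mulrA ler_wpM2l ?mulrn_wge0//.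
  rewrite ler_pdivlMl ?exprn_gt0// mulr1 /V (bigD1 i)//=.
  apply: (@le_trans _ _ ((q i - (f i)%:R / N.+1%:R) ^+ 2)).
    by rewrite -(real_normK (num_real (q i - _))) ler_sqr ?nnegrE// ltW.
  by rewrite lerDl sumr_ge0// => k _; exact: sqr_ge0.
under eq_bigr do rewrite mulrDl.
rewrite big_split/= -mulr_sumr bernW_sum1 mulr1 lerD2l.
under eq_bigr do rewrite -mulrA.
rewrite -mulr_sumr ler_wpM2l ?divr_ge0 ?mulrn_wge0 ?sqr_ge0//.
under eq_bigr do rewrite /V mulr_suml.
rewrite exchange_big/=.
apply: (@le_trans _ _ (\sum_(i < m) N.+1%:R^-1)).
  apply: ler_sum => i _.
  rewrite (bernW_coord N.+1 q i (fun j => (q i - j%:R / N.+1%:R) ^+ 2)).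
  exact: bern_variance_le.
by rewrite sumr_const card_ord -[leLHS]mulr_natl.
Qed.

End bernstein.

Section trig_poly.
Context {R : realType} (m : nat).
Implicit Types (t y : 'I_m -> R).

(** The functions whose means converge as soon as those of the cosines of affine
    forms do. *)
Inductive trig_poly : (('I_m -> R) -> R) -> Prop :=
| trig_cos t b : trig_poly (fun y => cos (\sum_i t i * y i + b))
| trig_add f g : trig_poly f -> trig_poly g -> trig_poly (fun y => f y + g y)
| trig_scale a f : trig_poly f -> trig_poly (fun y => a * f y).

(** A product of two cosines is half the sum of the cosines of the sum and of the
    difference: this is what makes Bernstein polynomials available. *)
Lemma trig_mul f g : trig_poly f -> trig_poly g -> trig_poly (fun y => f y * g y).
Proof.
move=> + tg; elim=> {f} [t b|f f' _ IH _ IH'|a f _ IH].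
- elim: tg => {g} [t' b'|f f' _ IH _ IH'|a f _ IH].
  + rewrite (_ : (fun _ => _) = (fun y =>
      2^-1 * cos (\sum_i (t i + t' i) * y i + (b + b')) +
      2^-1 * cos (\sum_i (t i - t' i) * y i + (b - b')))).
      by apply: trig_add; apply: trig_scale; apply: (trig_cos (fun i => _)).
    apply/funext => y.
    under [in RHS]eq_bigr do rewrite mulrDl.
    under [X in _ + _ * cos (X + _)]eq_bigr do rewrite mulrBl.
    rewrite big_split/= sumrB.
    set A := \sum_i t i * y i; set B := \sum_i t' i * y i.
    have -> : A + B + (b + b') = (A + b) + (B + b') by ring.
    have -> : A - B + (b - b') = (A + b) - (B + b') by ring.
    by rewrite (cosD (A + b) (B + b')) (cosB (A + b) (B + b')); field.
  + rewrite (_ : (fun _ => _) = (fun y => cos (\sum_i t i * y i + b) * f y +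
      cos (\sum_i t i * y i + b) * f' y)); first exact: trig_add.
    by apply/funext => y; rewrite mulrDr.
  + rewrite (_ : (fun _ => _) = (fun y => a * (cos (\sum_i t i * y i + b) * f y))).
      exact: trig_scale.
    by apply/funext => y; rewrite mulrCA.
- rewrite (_ : (fun _ => _) = (fun y => f y * g y + f' y * g y)); first exact: trig_add.
  by apply/funext => y; rewrite mulrDl.
- rewrite (_ : (fun _ => _) = (fun y => a * (f y * g y))); first exact: trig_scale.
  by apply/funext => y; rewrite mulrA.
Qed.

Lemma trig_cst c : trig_poly (fun=> c).
Proof.
rewrite (_ : (fun=> c) = fun y : 'I_m -> R => c * cos (\sum_i 0 * y i + 0)).
  exact: trig_scale (trig_cos (fun=> 0) 0).
apply/funext => y; rewrite big1 ?addr0 ?cos0 ?mulr1// => i _.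
by rewrite mul0r.
Qed.

Lemma trig_sum (I : Type) (r : seq I) (F : I -> ('I_m -> R) -> R) :
  (forall i, trig_poly (F i)) -> trig_poly (fun y => \sum_(i <- r) F i y).
Proof.
move=> tF; elim: r => [|i r IH].
  by under eq_fun do rewrite big_nil; exact: trig_cst.
by under eq_fun do rewrite big_cons; exact: trig_add.
Qed.

Lemma trig_prod (I : Type) (r : seq I) (F : I -> ('I_m -> R) -> R) :
  (forall i, trig_poly (F i)) -> trig_poly (fun y => \prod_(i <- r) F i y).
Proof.
move=> tF; elim: r => [|i r IH].
  by under eq_fun do rewrite big_nil; exact: trig_cst.
by under eq_fun do rewrite big_cons; exact: trig_mul.
Qed.

Lemma trig_bern N (p : ('I_m -> R) -> R) j : trig_poly p -> trig_poly (fun y => bern N (p y) j).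
Proof.
move=> tp; elim: N j => [|N IH] j /=; first exact: trig_cst.
apply: trig_add; apply: trig_mul => //.
- apply: trig_add; first exact: trig_cst.
  under eq_fun do rewrite -mulN1r; exact: trig_scale.
- by case: j => [|j]; [exact: trig_cst|exact: IH].
Qed.

Lemma trig_sin_coord (a : R) (i : 'I_m) : trig_poly (fun y => sin (a * y i)).
Proof.
rewrite (_ : (fun _ => _) = fun y : 'I_m -> R =>
  cos (\sum_k (if k == i then a else 0) * y k + (- (pi / 2)))).
  exact: (trig_cos (fun k => _)).
apply/funext => y; rewrite (bigD1 i)//= eqxx big1 ?addr0.
  by rewrite cosB cos_pihalf sin_pihalf mulr0 add0r mulr1.
by move=> k /negbTE ->; rewrite mul0r.
Qed.

Lemma trig_bounded f : trig_poly f -> exists M, forall y, `|f y| <= M.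
Proof.
elim=> {f} [t b|f f' _ [M fM] _ [M' fM']|a f _ [M fM]].
- by exists 1 => y; exact: cos_max.
- by exists (M + M') => y; rewrite (le_trans (ler_normD _ _))// lerD.
- by exists (`|a| * M) => y; rewrite normrM ler_wpM2l.
Qed.

Lemma trig_measurable d (T : measurableType d) (Y : 'I_m -> T -> R) f : trig_poly f ->
  (forall i, measurable_fun setT (Y i)) -> measurable_fun setT (fun w => f (Y ^~ w)).
Proof.
move=> + mY; elim=> {f} [t b|f f' _ mf _ mf'|a f _ mf].
- apply: measurableT_comp; first by apply: continuous_measurable_fun; exact: continuous_cos.
  apply: measurable_funD => //; apply: measurable_sum => i.
  exact: measurable_funM.
- exact: measurable_funD.
- exact: measurable_funM.
Qed.

(** Only the first point is confined to the cube; the second one may leave it. *)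
Lemma heine_cantor_cube (gam : 'rV[R]_m -> R) (e : R) : continuous gam -> 0 < e ->
  exists2 dl, 0 < dl & forall v v' : 'rV[R]_m, (forall i, 0 <= v ord0 i <= 1) ->
    (forall i, `|v ord0 i - v' ord0 i| < dl) -> `|gam v - gam v'| <= e.
Proof.
move=> cg e0.
have cK : compact [set v : 'rV[R]_m | forall i, `[0, 1]%classic (v ord0 i)].
  by apply: (@rV_compact R m (fun=> `[0, 1]%classic)) => i; exact: segment_compact.
move/compact_near_coveringP : cK => /(_ R (0^'+) (fun dl v => forall v' : 'rV[R]_m,
   (forall i, `|v ord0 i - v' ord0 i| < dl) -> `|gam v - gam v'| <= e)) H.
have : \forall dl \near 0^'+, [set v : 'rV[R]_m | forall i, `[0, 1]%classic (v ord0 i)] `<=`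
  (fun v : 'rV[R]_m => forall v' : 'rV[R]_m,
   (forall i, `|v ord0 i - v' ord0 i| < dl) -> `|gam v - gam v'| <= e).
  apply: H => v _.
  have /cvg_ballP/(_ (e / 2)) := cg v.
  rewrite divr_gt0// => /(_ isT) /nbhs_ballP[r /= r0 vr].
  have r20 : 0 < r / 2 by rewrite divr_gt0.
  exists (ball v (r / 2), [set dl | dl < r / 2]).
    by split => /=; [exact: nbhsx_ballx|exact: nbhs_right_lt].
  move=> [v1 dl] /= [b1 dlr] v' v1v'.
  have b2 : ball v1 (r / 2) v'.
    by split => // i j; rewrite (ord1 i); apply: lt_trans (v1v' j) dlr.
  have h1 : `|gam v - gam v1| < e / 2.
    by apply: vr; apply: le_ball b1; rewrite ler_pdivrMr// ler_peMr ?ler1n// ltW.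
  have h2 : `|gam v - gam v'| < e / 2.
    by apply: vr; rewrite [r]splitr; exact: ball_triangle b1 b2.
  rewrite -(subrKA (gam v)) (le_trans (ler_normD _ _))// [e]splitr.
  by rewrite distrC lerD// ltW.
move=> H'; have [dl [dl0 Hdl]] : exists dl, 0 < dl /\
   [set v : 'rV[R]_m | forall i, `[0, 1]%classic (v ord0 i)] `<=`
  (fun v : 'rV[R]_m => forall v' : 'rV[R]_m,
   (forall i, `|v ord0 i - v' ord0 i| < dl) -> `|gam v - gam v'| <= e).
  near (0 : R)^'+ => dl; exists dl; split; first by [].
  by near: dl.
exists dl => // v v' v01; apply: Hdl => i /=.
by rewrite in_itv/=; exact: v01.
Unshelve. all: by end_near. Qed.

(* Truncation to [-1/2, 1/2] keeps [asin] away from its endpoints, where it is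
   not differentiable. *)
Let clamp (x : R) : R := Num.max (- 2^-1) (Num.min 2^-1 x).

Let clamp_id x : `|x| <= 2^-1 -> clamp x = x.
Proof. by rewrite ler_norml => /andP[x1 x2]; rewrite /clamp min_r// max_r. Qed.

Let clamp_in x : - 1 < clamp x < 1.
Proof.
have h : (- 2^-1 : R) <= 2^-1 by lra.
rewrite /clamp lt_max gt_max gt_min.
apply/andP; split; first by apply/orP; left; lra.
by apply/andP; split; [lra|apply/orP; left; lra].
Qed.

Let continuous_clamp : continuous clamp.
Proof.
move=> x; apply: (@continuous_max R R (cst (- 2^-1)) (cst 2^-1 \min id)).
  exact: cvg_cst.
by apply: continuous_min; [exact: cvg_cst|exact: cvg_id].
Qed.

(** On the box [`|y i| <= L] the variable [y i] is a continuous function [th] of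
    [q i = (1 + sin (y i / (2 * L))) / 2], which lies in [[0, 1]]. The Bernstein polynomial
    of [g] as a function of [q] is trigonometric, close to [g] on the box and
    bounded by [M] everywhere, as an average of values of [g]. *)
Lemma trig_approx (g : 'rV[R]_m -> R) (M L e : R) : continuous g ->
  (forall v, `|g v| <= M) -> 0 < L -> 0 < e ->
  exists2 f, trig_poly f & (forall y, `|f y| <= M) /\
    (forall y, (forall i, `|y i| <= L) -> `|g (\row_i y i) - f y| <= e).
Proof.
move=> cg gM L0 e0; have M0 : 0 <= M := le_trans (normr_ge0 _) (gM 0).
(* [th] inverts [y |-> (1 + sin (y / (2 * L))) / 2] on [[- L, L]]; the factor [2]
   keeps the sine within [-1/2, 1/2] there. *)
pose th (x : R) : R := 2 * L * asin (clamp (2 * x - 1)).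
have cth : continuous th.
  move=> x; apply: cvgMr.
  apply: (cvg_comp (fun x => clamp (2 * x - 1)) asin); last first.
    by apply: continuous_asin; exact: clamp_in.
  apply: (cvg_comp (fun x => 2 * x - 1) clamp); last exact: continuous_clamp.
  by apply: cvgB; [apply: cvgMr; exact: cvg_id|exact: cvg_cst].
pose gam (v : 'rV[R]_m) : R := g (\row_i th (v ord0 i)).
have cgam : continuous gam.
  move=> v; apply: (cvg_comp (fun v : 'rV[R]_m => \row_i th (v ord0 i)) g); last exact: cg.
  move=> A /nbhs_ballP[r /= r0 rA].
  have : nbhs v [set v' : 'rV[R]_m | forall i : 'I_m, `|th (v ord0 i) - th (v' ord0 i)| < r].
    exists (fun _ j => [set x | `|th (v ord0 j) - th x| < r]) => [i j|v' Hv' i].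
      by rewrite (ord1 i); have /cvgrPdist_lt/(_ r r0) := cth (v ord0 j).
    exact: Hv'.
  apply: filterS => v' Hv'; apply: rA; split => // i j; rewrite !mxE; exact: Hv'.
have e20 : 0 < e / 2 by rewrite divr_gt0.
have [dl dl0 Hdl] := heine_cantor_cube cgam e20.
pose c := M *+ 2 / dl ^+ 2 * m%:R.
have [N HN] : exists N : nat, c / N.+1%:R <= e / 2.
  have c0 : 0 <= c by rewrite mulr_ge0// divr_ge0 ?mulrn_wge0// sqr_ge0.
  exists (Num.trunc (c / (e / 2))).
  rewrite ler_pdivrMr// mulrC -ler_pdivrMr//.
  by apply: ltW; exact: truncnS_gt.
pose q (y : 'I_m -> R) i : R := (1 + sin ((2 * L)^-1 * y i)) / 2.
have q01 y i : 0 <= q y i <= 1.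
  rewrite /q; have := sin_le1 ((2 * L)^-1 * y i); have := sin_geN1 ((2 * L)^-1 * y i).
  by move=> h1 h2; apply/andP; split; lra.
pose gq (p : 'I_m -> R) := gam (\row_i p i).
pose f y := \sum_(h : {ffun 'I_m -> 'I_N.+2}) gq (fun i => (h i)%:R / N.+1%:R) * bernW (q y) h.
have tq i : trig_poly (fun y => q y i).
  rewrite /q; under eq_fun do rewrite mulrC.
  apply: trig_scale; apply: trig_add; first exact: trig_cst.
  exact: trig_sin_coord.
exists f.
  apply: trig_sum => h; apply: trig_scale; apply: trig_prod => i.
  exact: trig_bern.
split=> [y|y yL].
  apply: (le_trans (ler_norm_sum _ _ _)).
  apply: (@le_trans _ _ (\sum_(h : {ffun 'I_m -> 'I_N.+2}) M * bernW (q y) h)).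
    apply: ler_sum => h _; rewrite normrM [X in _ * X]ger0_norm ?bernW_ge0//.
    by rewrite ler_wpM2r ?bernW_ge0//; exact: gM.
  by rewrite -mulr_sumr bernW_sum1 mulr1.
have gE : g (\row_i y i) = gq (q y).
  rewrite /gq /gam; congr g; apply/rowP => i; rewrite !mxE /th /q.
  have yi : `|(2 * L)^-1 * y i| <= 2^-1.
    rewrite normrM normfV (gtr0_norm (_ : 0 < 2 * L)) ?mulr_gt0// ler_pdivrMl ?mulr_gt0//.
    by rewrite mulrAC divff// mul1r.
  rewrite (_ : 2 * _ - 1 = sin ((2 * L)^-1 * y i)); last by field.
  rewrite clamp_id ?(le_trans (abs_sin_le _))// sinK.
    by field; rewrite gt_eqF.
  rewrite in_itv/=; move: yi; rewrite ler_norml => /andP[y1 y2].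
  by have := pi_ge2 R; lra.
rewrite gE.
have ge p : (forall i, `|q y i - p i| < dl) -> `|gq (q y) - gq p| <= e / 2.
  by move=> qp; apply: Hdl => i; rewrite !mxE.
have gqM p : `|gq p| <= M by exact: gM.
have := bernW_approx N (q01 y) dl0 (ltW e20) gqM ge.
move=> /le_trans; apply.
rewrite [leRHS]splitr lerD2l; apply: le_trans HN.
by rewrite /c mulrA.
Qed.

End trig_poly.

Section weak_convergence.
Context {R : realType} (m : nat).

(** Outside of the box the two functions differ by at most [2 * M], and that
    event has probability at most [m * K / L ^+ 2] by Chebyshev's inequality. *)
Lemma trig_error d (Om : measurableType d) (P : probability Om R) (Y : 'I_m -> Om -> R)
   (g : 'rV[R]_m -> R) (f : ('I_m -> R) -> R) (M L e K : R) :
  (forall i, measurable_fun setT (Y i)) ->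
  (forall i, \int[P]_w (Y i w ^+ 2)%:E <= K%:E)%E ->
  continuous g -> (forall v, `|g v| <= M) -> 0 < L -> 0 <= e ->
  trig_poly f -> (forall y, `|f y| <= M) ->
  (forall y, (forall i, `|y i| <= L) -> `|g (\row_i y i) - f y| <= e) ->
  `|\int[P]_w g (\row_i Y i w) - \int[P]_w f (Y ^~ w)| <= e + M *+ 2 / L ^+ 2 * (m%:R * K).
Proof.
move=> mY YK cg gM L0 e0 tf fM gf.
have M0 : 0 <= M := le_trans (normr_ge0 _) (gM 0).
have bi (h : Om -> R) : measurable_fun setT h -> (forall w, `|h w| <= M) ->
    P.-integrable setT (EFin \o h).
  move=> mh hM; apply: measurable_bounded_integrable => //.
    by rewrite (le_lt_trans (probability_le1 _ measurableT)) ?ltry.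
  by exists M; split; [exact: num_real|move=> M' MM' w _]; rewrite /= (le_trans (hM w)) ?ltW.
have mg : measurable_fun setT (fun w => g (\row_i Y i w)) by exact: measurable_continuous_row.
have mf : measurable_fun setT (fun w => f (Y ^~ w)) by exact: trig_measurable.
have ig := bi _ mg (fun w => gM _).
have iff := bi _ mf (fun w => fM _).
have iY i : P.-integrable setT (EFin \o (fun w => Y i w ^+ 2)).
  apply/integrableP; split; first by apply/measurable_EFinP; exact: measurable_funX.
  under eq_integral do rewrite gee0_abs ?lee_fin ?sqr_ge0//.
  by rewrite (le_lt_trans (YK i))// ltry.
have iS : P.-integrable setT (EFin \o (fun w => \sum_i Y i w ^+ 2)).
  rewrite (_ : EFin \o _ = (fun w => \sum_i (Y i w ^+ 2)%:E)%E).
    by apply: integrable_sum => // i _; exact: iY.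
  by apply/funext => w; rewrite /= sumEFin.
have c0 : 0 <= M *+ 2 / L ^+ 2 by rewrite divr_ge0 ?mulrn_wge0// sqr_ge0.
have iB : P.-integrable setT (EFin \o (fun w => e + M *+ 2 / L ^+ 2 * \sum_i Y i w ^+ 2)).
  rewrite (_ : EFin \o _ = (cst e%:E \+ (fun w => (M *+ 2 / L ^+ 2)%:E * (\sum_i Y i w ^+ 2)%:E))%E)//.
  apply: integrableD => //; first exact: finite_measure_integrable_cst.
  exact: integrableZl.
have iD : P.-integrable setT (EFin \o (fun w => g (\row_i Y i w) - f (Y ^~ w))).
  rewrite (_ : EFin \o _ = ((EFin \o (fun w => g (\row_i Y i w))) \- (EFin \o (fun w => f (Y ^~ w))))%E)//.
  exact: integrableB.
rewrite -RintegralB//; apply: le_trans (le_normr_Rintegral _ iD) _ => //.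
apply: (@le_trans _ _ (\int[P]_w (e + M *+ 2 / L ^+ 2 * \sum_i Y i w ^+ 2))).
  apply: le_Rintegral => //; first exact: integrable_norm iD.
  move=> w _.
  have S0 : 0 <= \sum_i Y i w ^+ 2 by apply: sumr_ge0 => i _; exact: sqr_ge0.
  have [|/existsNP] := pselect (forall i, `|Y i w| <= L).
    by move=> /(gf (Y ^~ w)) /le_trans; apply; rewrite lerDl mulr_ge0.
  move=> [i /negP]; rewrite -ltNge => Li.
  apply: (@le_trans _ _ (M *+ 2)).
    by rewrite (le_trans (ler_normB _ _))// mulr2n lerD.
  apply: (@le_trans _ _ (M *+ 2 / L ^+ 2 * \sum_i Y i w ^+ 2)); last by rewrite lerDr.
  rewrite -[leLHS]mulr1 -mulrA ler_wpM2l ?mulrn_wge0//.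
  rewrite ler_pdivlMl ?exprn_gt0// mulr1 (bigD1 i)//=.
  apply: (@le_trans _ _ (Y i w ^+ 2)).
    by rewrite -(real_normK (num_real (Y i w))) ler_sqr ?nnegrE// ltW.
  by rewrite lerDl sumr_ge0// => k _; exact: sqr_ge0.
rewrite RintegralD//; last 2 first.
- exact: finite_measure_integrable_cst.
- exact: (integrableZl measurableT _ iS).
rewrite /Rintegral integral_prob_cst/= -/(Rintegral _ _ _) lerD2l.
rewrite RintegralZl// ler_wpM2l//.
rewrite -lee_fin /Rintegral fineK; last exact: integrable_fin_num.
under eq_integral do rewrite /= -sumEFin.
rewrite integral_sum//.
apply: (@le_trans _ _ (\sum_(i < m) K%:E)%E); first by apply: lee_sum => i _; exact: YK.
by rewrite sumEFin lee_fin sumr_const card_ord -[leLHS]mulr_natl.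
Qed.

Variables (dOm : nat -> measure_display) (Om : forall k, measurableType (dOm k)).
Variables (P : forall k, probability (Om k) R) (Y : forall k, 'I_m -> Om k -> R).
Arguments Y : clear implicits.
Variables (d : measure_display) (Om' : measurableType d) (Q : probability Om' R).
Variables (X : 'I_m -> Om' -> R) (K : R).
Hypothesis mY : forall k i, measurable_fun setT (Y k i).
Hypothesis mX : forall i, measurable_fun setT (X i).
Hypothesis YK : forall k i, (\int[P k]_w (Y k i w ^+ 2)%:E <= K%:E)%E.
Hypothesis XK : forall i, (\int[Q]_w (X i w ^+ 2)%:E <= K%:E)%E.
Hypothesis YX : forall t b,
  \int[P k]_w cos (\sum_i t i * Y k i w + b) @[k --> \oo] -->
  \int[Q]_w cos (\sum_i t i * X i w + b).

Let trig_integrable d1 (Om1 : measurableType d1) (P1 : probability Om1 R) (Z : 'I_m -> Om1 -> R) f :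
  trig_poly f -> (forall i, measurable_fun setT (Z i)) ->
  P1.-integrable setT (EFin \o (fun w => f (Z ^~ w))).
Proof.
move=> tf mZ; have [M fM] := trig_bounded tf.
apply: measurable_bounded_integrable => //.
- by rewrite (le_lt_trans (probability_le1 _ measurableT)) ?ltry.
- exact: trig_measurable.
- by exists M; split; [exact: num_real|move=> M' MM' w _]; rewrite /= (le_trans (fM _)) ?ltW.
Qed.

Lemma trig_cvg f : trig_poly f ->
  \int[P k]_w f (Y k ^~ w) @[k --> \oo] --> \int[Q]_w f (X ^~ w).
Proof.
elim=> {f} [t b|f f' tf cf tf' cf'|a f tf cf].
- exact: YX.
- rewrite RintegralD//; [|exact: trig_integrable|exact: trig_integrable].
  have -> : (fun k => \int[P k]_w (f (Y k ^~ w) + f' (Y k ^~ w))) =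
      (fun k => \int[P k]_w f (Y k ^~ w) + \int[P k]_w f' (Y k ^~ w)).
    by apply/funext => k; rewrite RintegralD//; exact: trig_integrable.
  exact: cvgD.
- rewrite RintegralZl//; last exact: trig_integrable.
  have -> : (fun k => \int[P k]_w (a * f (Y k ^~ w))) =
      (fun k => a * \int[P k]_w f (Y k ^~ w)).
    by apply/funext => k; rewrite RintegralZl//; exact: trig_integrable.
  exact: cvgMr.
Qed.

(** The bounded second moments provide tightness; trigonometric approximation on
    a large box replaces the inversion of characteristic functions. *)
Theorem cramer_wold (g : 'rV[R]_m -> R) (M : R) : continuous g -> (forall v, `|g v| <= M) ->
  \int[P k]_w g (\row_i Y k i w) @[k --> \oo] --> \int[Q]_w g (\row_i X i w).
Proof.
move=> cg gM; have M0 : 0 <= M := le_trans (normr_ge0 _) (gM 0).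
apply/cvgrPdist_le => e e0.
have e60 : 0 < e / 6 by rewrite divr_gt0.
pose c := M *+ 2 * (m%:R * K).
pose L := 1 + `|c| / (e / 6).
have L1 : 1 <= L by rewrite lerDl divr_ge0// ltW.
have L0 : 0 < L by exact: lt_le_trans L1.
have HL : M *+ 2 / L ^+ 2 * (m%:R * K) <= e / 6.
  rewrite mulrAC -/c ler_pdivrMr ?exprn_gt0//.
  apply: le_trans (ler_norm _) _; apply: (@le_trans _ _ (e / 6 * L)).
    by rewrite /L mulrDr mulr1 mulrCA divff ?gt_eqF// mulr1 lerDr ltW.
  by rewrite ler_pM2l// expr2 ler_peMr// ltW.
have [f tf [fM gf]] := trig_approx cg gM L0 e60.
have /cvgrPdist_le/(_ _ e60) := trig_cvg tf.
apply: filterS => k Hk.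
have h1 := le_trans (trig_error mX XK cg gM L0 (ltW e60) tf fM gf) (lerD (lexx _) HL).
have h2 := le_trans (trig_error (@mY k) (@YK k) cg gM L0 (ltW e60) tf fM gf) (lerD (lexx _) HL).
move: h1 h2 Hk; set a := \int[Q]_w _; set a' := \int[Q]_w _.
set b := \int[P k]_w _; set b' := \int[P k]_w _ => h1 h2 h3.
rewrite (_ : a - b = (a - a') + (a' - b') - (b - b')); last by ring.
apply: le_trans (ler_normB _ _) _.
apply: le_trans (lerD (ler_normD _ _) (lexx _)) _.
by lra.
Qed.

End weak_convergence.

(** * Gaussian variables *)

Section integral_density.
Local Open Scope ereal_scope.
Context d (T : measurableType d) (R : realType).
Variables (mu nu : {measure set T -> \bar R}) (p : T -> R).
Hypothesis p0 : forall x, (0 <= p x)%R.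
Hypothesis mp : measurable_fun setT p.
Hypothesis nuE : forall A, measurable A -> nu A = \int[mu]_(x in A) (p x)%:E.

Import HBNNSimple.

Let density_nnsfun (f : {nnsfun T >-> R}) :
  \int[nu]_x (f x)%:E = \int[mu]_x ((f x)%:E * (p x)%:E).
Proof.
transitivity (\int[mu]_x \sum_(r \in range f) (r%:E * (\1_(f @^-1` [set r]) x)%:E * (p x)%:E)); last first.
  apply: eq_integral => x _; rewrite (fimfunE f x) -fsumEFin//.
  rewrite ge0_mule_fsuml//; last first.
    by move=> r; rewrite EFinM nnfun_muleindic_ge0.
have mf r : measurable (f @^-1` [set r]) by rewrite -[X in measurable X]setTI; exact: measurable_funP.
rewrite ge0_integral_fsum//; last 2 first.
- move=> r; apply: emeasurable_funM; last exact/measurable_EFinP.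
  by apply: measurable_funeM; exact/measurable_EFinP.
- move=> r x _; rewrite mule_ge0 ?lee_fin//.
  exact: nnfun_muleindic_ge0.
rewrite integralT_nnsfun sintegralE; apply: eq_fsbigr => r _.
have [r0|r0] := leP 0%R r; last first.
  rewrite preimage_nnfun0// measure0 mule0 integral0_eq// => x _.
  by rewrite indic0 mule0 mul0e.
under eq_integral do rewrite -muleA.
rewrite ge0_integralZl//; last 2 first.
- apply: emeasurable_funM; exact/measurable_EFinP.
- by move=> x _; rewrite mule_ge0// lee_fin.
rewrite nuE// [in LHS]integral_mkcond; congr (_ * _).
apply: eq_integral => x _; rewrite patchE indicE.
by case: ifP => _; rewrite ?mul1e ?mul0e.
Qed.

Lemma ge0_integral_density (f : T -> \bar R) : measurable_fun setT f ->
  (forall x, 0 <= f x) -> \int[nu]_x f x = \int[mu]_x (f x * (p x)%:E).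
Proof.
move=> mf f0; pose f_ := nnsfun_approx measurableT mf.
have fE z : lim ((f_ n z)%:E @[n --> \oo]) = f z.
  by apply/cvg_lim => //=; exact: cvg_nnsfun_approx.
transitivity (lim ((\int[nu]_z (f_ n z)%:E) @[n --> \oo])).
  rewrite -monotone_convergence//; first by apply: eq_integral => z _; rewrite fE.
  - by move=> n; exact/measurable_EFinP.
  - by move=> n z _; rewrite lee_fin.
  - by move=> z _ a b ab; rewrite lee_fin; exact/lefP/nd_nnsfun_approx.
transitivity (lim ((\int[mu]_z ((f_ n z)%:E * (p z)%:E)) @[n --> \oo])).
  by congr (limn _); apply/funext => n; exact: density_nnsfun.
rewrite -monotone_convergence//.
- apply: eq_integral => z _; rewrite muleC -fE -limeMl//.
    by congr (limn _); apply/funext => n; rewrite muleC.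
  by apply/cvg_ex; eexists; exact: cvg_nnsfun_approx.
- by move=> n; apply: emeasurable_funM; exact/measurable_EFinP.
- by move=> n z _; rewrite mule_ge0// lee_fin.
- move=> z _ a b ab; apply: lee_wpmul2r; rewrite lee_fin//.
  exact/lefP/nd_nnsfun_approx.
Qed.

Lemma integrable_density (f : T -> R) : measurable_fun setT f ->
  mu.-integrable setT (EFin \o (fun x => f x * p x)%R) ->
  nu.-integrable setT (EFin \o f).
Proof.
move=> mf /integrableP[_ fp]; apply/integrableP; split; first exact/measurable_EFinP.
rewrite ge0_integral_density//; last first.
  by apply: measurableT_comp => //; exact/measurable_EFinP.
apply: le_lt_trans fp; rewrite le_eqVlt; apply/orP; left; apply/eqP.
by apply: eq_integral => x _; rewrite /= -EFinM normrM (ger0_norm (p0 x)).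
Qed.

Lemma integral_density (f : T -> R) : measurable_fun setT f ->
  \int[nu]_x (f x)%:E = \int[mu]_x (f x * p x)%:E.
Proof.
move=> mf; have mfE : measurable_fun setT (EFin \o f) by exact/measurable_EFinP.
rewrite integralE [RHS]integralE; congr (_ - _).
- rewrite ge0_integral_density//; last exact: measurable_funepos.
  apply: eq_integral => x _.
  by rewrite !funeposE -!EFin_max -EFinM maxr_pMl// mul0r.
- rewrite ge0_integral_density//; last exact: measurable_funeneg.
  apply: eq_integral => x _.
  by rewrite !funenegE -!EFinN -!EFin_max -EFinM maxr_pMl// mul0r mulNr.
Qed.

End integral_density.

Section gaussian.
Context {R : realType}.
Local Notation leb := (@lebesgue_measure R).

(** The fundamental theorem of calculus on [[- n, n]] and dominated convergence. *)
Lemma integral_derive_vanish (G g : R -> R) : (forall x, is_derive x (1 : R) G (g x)) ->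
  continuous g -> leb.-integrable setT (EFin \o g) ->
  G n%:R @[n --> \oo] --> 0 -> G (- n%:R) @[n --> \oo] --> 0 ->
  \int[leb]_x g x = 0.
Proof.
move=> dG cg ig Gp Gm.
pose f n := (EFin \o g) \_ (`[(- n.+1%:R), n.+1%:R] : set R).
have mg : measurable_fun setT (EFin \o g) by exact: measurable_int ig.
have mf n : measurable_fun setT (f n).
  by apply/(measurable_restrictT _ _).1 => //; exact: measurable_funTS.
have H : (\int[leb]_x f n x @[n --> \oo] --> \int[leb]_x (EFin \o g) x)%E.
  apply: (@dominated_cvg _ _ _ leb setT measurableT f (EFin \o g) (fun x => `|(EFin \o g) x|)%E) => //.
  - move=> x _; apply: cvg_near_cst; near=> n; rewrite /f patchE.
    have : `|x| < n%:R by near: n; exact: nbhs_infty_gtr.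
    rewrite ltr_norml => /andP[x1 x2].
    rewrite mem_set//= in_itv/=; apply/andP; split.
      by rewrite lerNl ltW// -natr1; lra.
    by rewrite -natr1; lra.
  - exact: integrable_abse.
  - move=> n x _; rewrite /f patchE; case: ifP => // _.
    by rewrite abse0 abse_ge0.
have fE n : (\int[leb]_x f n x = (G n.+1%:R - G (- n.+1%:R))%:E)%E.
  rewrite -integral_mkcond (@continuous_FTC2 _ g G) ?EFinB//.
  - by rewrite gtrN// ltr0n.
  - exact: continuous_subspaceT.
  - split.
    + by move=> x _; have [] := dG x.
    + by apply: cvg_at_right_filter; apply: differentiable_continuous; apply/derivable1_diffP; have [] := dG (- n.+1%:R).
    + by apply: cvg_at_left_filter; apply: differentiable_continuous; apply/derivable1_diffP; have [] := dG n.+1%:R.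
  - by move=> x _; rewrite derive1E; have [_ ->] := dG x.
have H0 : (\int[leb]_x f n x @[n --> \oo] --> 0%:E)%E.
  under eq_fun do rewrite fE.
  apply: cvg_EFin; first exact: nearW.
  rewrite -(subrr (0 : R)); apply: cvgB.
    by rewrite (cvg_shiftS (fun n => G n%:R)).
  by rewrite (cvg_shiftS (fun n => G (- n%:R))).
by rewrite /Rintegral -(cvg_unique _ H0 H).
Unshelve. all: by end_near. Qed.

Variables (m s : R).
Hypothesis s0 : s != 0.
Let p : R -> R := normal_pdf m s.

Let pE : p = (fun x => normal_peak s * normal_fun m s x).
Proof. by rewrite /p normal_pdfE. Qed.

Let p_ge0 x : 0 <= p x. Proof. exact: normal_pdf_ge0. Qed.

Let dp x : is_derive x (1 : R) p (- (x - m) / s ^+ 2 * p x).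
Proof.
rewrite pE /normal_fun.
apply: is_derive_eq; rewrite /GRing.scale/=.
by field.
Qed.

Let s2_gt0 : 0 < s ^+ 2. Proof. by rewrite exprn_even_gt0. Qed.

(* The normal density with twice the standard deviation absorbs a quadratic
   factor, with this constant; it serves as a dominating function. *)
Let K := (1 + 4 * s ^+ 2) * normal_peak s / normal_peak (2 * s).

Let p_dom x : (1 + (x - m) ^+ 2) * p x <= K * normal_pdf m (2 * s) x.
Proof.
have s20 : 2 * s != 0 by rewrite mulf_neq0.
rewrite normal_pdfE// pE /K.
set w := (x - m) ^+ 2; have w0 : 0 <= w by exact: sqr_ge0.
have -> : (1 + 4 * s ^+ 2) * normal_peak s / normal_peak (2 * s) *
   (normal_peak (2 * s) * normal_fun m (2 * s) x) =
   normal_peak s * ((1 + 4 * s ^+ 2) * normal_fun m (2 * s) x).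
  by field; rewrite gt_eqF// normal_peak_gt0.
rewrite mulrCA ler_wpM2l ?normal_peak_ge0// /normal_fun.
rewrite -/w; set v := w / (4 * s ^+ 2).
have v0 : 0 <= v by rewrite divr_ge0// mulr_ge0// ltW.
have wE : w = 4 * s ^+ 2 * v by rewrite /v mulrC divfK// mulf_neq0// gt_eqF.
have -> : - w / (s ^+ 2 *+ 2) = - v + - v.
  by rewrite wE -mulr_natr; field.
have -> : - w / ((2 * s) ^+ 2 *+ 2) = - v / 2 by rewrite wE -mulr_natr; field.
have e1 : expR (- v) <= expR (- v / 2) by rewrite ler_expR; lra.
rewrite expRD mulrA; apply: ler_pM => //.
  by rewrite mulr_ge0 ?addr_ge0 ?expR_ge0.
rewrite mulrDl mul1r lerD//.
  by rewrite -expR0 ler_expR oppr_le0.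
(* [w = 4 * s ^+ 2 * v], so one factor [expR (- v)] pays for the quadratic term. *)
have ve : v * expR (- v) <= 1.
  rewrite expRN ler_pdivrMr ?expR_gt0// mul1r.
  by have := expR_ge1Dx v; lra.
have s4 : 0 <= 4 * s ^+ 2 by rewrite mulr_ge0// ltW.
by have := ler_wpM2l s4 ve; rewrite mulr1 mulrA -wE.
Qed.

Let mp : measurable_fun setT p. Proof. exact: measurable_normal_pdf. Qed.
Let cp : continuous p. Proof. exact: continuous_normal_pdf. Qed.

Let K_ge0 : 0 <= K.
Proof.
by rewrite /K divr_ge0 ?normal_peak_ge0// mulr_ge0 ?normal_peak_ge0// addr_ge0// mulr_ge0// ltW.
Qed.

Let imaj : leb.-integrable setT (EFin \o (fun x => (1 + (x - m) ^+ 2) * p x)).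
Proof.
have iK : leb.-integrable setT (fun x => K%:E * (normal_pdf m (2 * s) x)%:E)%E.
  by apply: integrableZl => //; exact: integrable_normal_pdf.
apply: le_integrable iK => //.
  apply/measurable_EFinP; apply: measurable_funM => //; apply: measurable_funD => //.
  by apply: measurable_funX; exact: measurable_funB.
move=> x _; rewrite /= lee_fin ger0_norm ?mulr_ge0 ?addr_ge0 ?sqr_ge0//.
by rewrite [leRHS]ger0_norm; [exact: p_dom|exact: mulr_ge0 K_ge0 (normal_pdf_ge0 _ _ _)].
Qed.

Let integrable_gauss (h : R -> R) : measurable_fun setT h ->
  (forall x, `|h x| <= 1 + (x - m) ^+ 2) -> leb.-integrable setT (EFin \o (fun x => h x * p x)).
Proof.
move=> mh hb; apply: le_integrable imaj => //.
  by apply/measurable_EFinP; exact: measurable_funM.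
move=> x _; rewrite /= lee_fin normrM (ger0_norm (p_ge0 x)) [leRHS]ger0_norm.
  by rewrite ler_wpM2r.
by rewrite mulr_ge0// addr_ge0// sqr_ge0.
Qed.

Lemma integrable_gaussC (h : R -> R) (C : R) : measurable_fun setT h ->
  (forall x, `|h x| <= C * (1 + (x - m) ^+ 2)) -> leb.-integrable setT (EFin \o (fun x => h x * p x)).
Proof.
move=> mh hb; apply: (le_integrable _ _ _ (integrableZl measurableT C imaj)) => //.
  by apply/measurable_EFinP; exact: measurable_funM.
move=> x _; rewrite /= lee_fin normrM (ger0_norm (p_ge0 x)); apply: le_trans (ler_norm _).
by rewrite mulrA ler_wpM2r.
Qed.

Let abs_le_sqr x : `|x - m| <= 1 + (x - m) ^+ 2.
Proof.
rewrite -(real_normK (num_real (x - m))); have := normr_ge0 (x - m).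
by set a := `|_|; nra.
Qed.

(* The second alternative only occurs for finitely many [n]. *)
Let gauss_vanish (h : R -> R) (u : nat -> R) : (forall x, `|h x| <= 1 + (x - m) ^+ 2) ->
  (forall n, (n%:R - `|m|) ^+ 2 <= (u n - m) ^+ 2 \/ n%:R < `|m|) ->
  h (u n) * p (u n) @[n --> \oo] --> 0.
Proof.
move=> hb un; have s20 : 2 * s != 0 by rewrite mulf_neq0.
pose c := K * normal_peak (2 * s) * (8 * s ^+ 2).
have c0 : 0 <= c.
  apply: mulr_ge0; first exact: mulr_ge0 K_ge0 (normal_peak_ge0 _).
  by apply: mulr_ge0 => //; exact: ltW.
apply/cvgrPdist_le => e e0; near=> n; rewrite sub0r normrN.
have nm : `|m| + 1 <= n%:R by near: n; exact: nbhs_infty_ger.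
have nc : `|m| + c / e <= n%:R by near: n; exact: nbhs_infty_ger.
case: (un n) => [un'|]; last by move=> h1; lra.
rewrite normrM (ger0_norm (p_ge0 _)).
apply: le_trans (ler_wpM2r (p_ge0 _) (hb _)) _; apply: le_trans (p_dom _) _.
rewrite normal_pdfE// /normal_fun; set w := (u n - m) ^+ 2.
have w1 : 0 < w by apply: lt_le_trans un'; rewrite exprn_gt0//; lra.
have -> : (2 * s) ^+ 2 *+ 2 = 8 * s ^+ 2 by rewrite -mulr_natr; ring.
have s8 : 0 < 8 * s ^+ 2 by exact: mulr_gt0.
have ew : expR (- w / (8 * s ^+ 2)) <= 8 * s ^+ 2 / w.
  rewrite mulNr expRN -[leRHS]invrK lef_pV2 ?posrE ?expR_gt0 ?invr_gt0 ?(divr_gt0 s8 w1)//.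
  by rewrite invf_div; have := expR_ge1Dx (w / (8 * s ^+ 2)); lra.
rewrite [X in X <= _](_ : _ = K * normal_peak (2 * s) * expR (- w / (8 * s ^+ 2))); last by rewrite mulrA.
apply: (@le_trans _ _ (c / w)).
  rewrite /c -[leRHS]mulrA ler_wpM2l//.
  exact: mulr_ge0 K_ge0 (normal_peak_ge0 _).
rewrite ler_pdivrMr// mulrC -ler_pdivrMr//; apply: le_trans un'.
have h2 : c / e <= n%:R - `|m| by lra.
have h3 : 1 <= n%:R - `|m| by lra.
apply: le_trans h2 _; rewrite expr2 ler_peMr//; lra.
Unshelve. all: by end_near. Qed.

(** Stein's identity: [s ^+ 2 * (psi * p)' = s ^+ 2 * psi' * p - (x - m) * psi * p]
    integrates to zero. It yields the mean with [psi = 1], the variance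
    with [psi = x - m] and the cosine transform with [psi] a sine. *)
Lemma stein (psi dpsi : R -> R) (C : R) : (forall x, is_derive x (1 : R) psi (dpsi x)) ->
  continuous dpsi -> (forall x, `|psi x| <= 1 + (x - m) ^+ 2) ->
  (forall x, `|dpsi x| <= C * (1 + (x - m) ^+ 2)) ->
  (forall x, `|(x - m) * psi x| <= 1 + (x - m) ^+ 2) ->
  \int[leb]_x ((x - m) * psi x * p x) = s ^+ 2 * \int[leb]_x (dpsi x * p x).
Proof.
move=> dP cd bP bd bx.
have cP : continuous psi.
  by move=> x; apply: differentiable_continuous; apply/derivable1_diffP; have [] := dP x.
have cx : continuous (fun x => (x - m) * psi x).
  by move=> x; apply: cvgM; [apply: cvgB; [exact: cvg_id|exact: cvg_cst]|exact: cP].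
have mx : measurable_fun setT (fun x : R => (x - m) * psi x) by exact: continuous_measurable_fun.
have md : measurable_fun setT dpsi by exact: continuous_measurable_fun.
pose g x := dpsi x * p x - s ^- 2 * ((x - m) * psi x * p x).
have dG x : is_derive x (1 : R) (fun x => psi x * p x) (g x).
  apply: (is_derive_eq (is_deriveM (dP x) (dp x))).
  by rewrite /GRing.scale/= /g; field.
have i1 := integrable_gaussC md bd.
have i2 := integrable_gauss mx bx.
have ig : leb.-integrable setT (EFin \o g).
  rewrite (_ : EFin \o g = (EFin \o (fun x => dpsi x * p x)%R) \-
     (fun x => (s ^- 2)%:E * (EFin \o (fun x => (x - m) * psi x * p x)%R) x))%E.
    by apply: integrableB => //; exact: integrableZl.
  by apply/funext => x; rewrite /g/= EFinB EFinM.
have cg : continuous g.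
  move=> x; apply: cvgB; first by apply: cvgM; [exact: cd|exact: cp].
  by apply: cvgMr; apply: cvgM; [exact: cx|exact: cp].
have h := integral_derive_vanish dG cg ig _ _.
have : \int[leb]_x g x = 0.
  apply: h; apply: gauss_vanish => // n.
  - have [nm|nm] := leP `|m| n%:R; [left|by right].
    rewrite ler_sqr ?nnegrE; first by rewrite lerB// ler_norm.
      by rewrite subr_ge0.
    by rewrite subr_ge0 (le_trans (ler_norm _)).
  - have [nm|nm] := leP `|m| n%:R; [left|by right].
    rewrite -[leRHS]sqrrN opprB opprK ler_sqr ?nnegrE.
    + by rewrite addrC lerD2r lerNl -normrN ler_norm.
    + by rewrite subr_ge0.
    + by rewrite addrC -lerBlDr sub0r (le_trans _ nm)// -normrN ler_norm.
rewrite /g RintegralB//; last exact: (integrableZl measurableT (s ^- 2) i2).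
rewrite RintegralZl// => /eqP; rewrite subr_eq0 => /eqP ->.
by rewrite mulrA divff ?mul1r// expf_neq0.
Qed.

Lemma normal_mean : \int[leb]_x (x * p x) = m.
Proof.
have h : \int[leb]_x ((x - m) * 1 * p x) = s ^+ 2 * \int[leb]_x (0 * p x).
  apply: (stein (psi := fun=> 1) (dpsi := fun=> 0) (C := 1)) => [x|x|x|x].
  - exact: cvg_cst.
  - by rewrite normr1 lerDl sqr_ge0.
  - by rewrite normr0 mul1r addr_ge0// sqr_ge0.
  - by rewrite mulr1.
have i1 : leb.-integrable setT (EFin \o (fun x => (x - m) * p x)).
  by apply: integrable_gauss => //; exact: measurable_funB.
have i2 : leb.-integrable setT (EFin \o p) by exact: integrable_normal_pdf.
transitivity (\int[leb]_x ((x - m) * p x + m * p x)).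
  by apply: eq_Rintegral => x _; ring.
rewrite RintegralD//; last exact: (integrableZl measurableT m i2).
rewrite RintegralZl//.
have -> : \int[leb]_x p x = 1 by rewrite /Rintegral integral_normal_pdf.
rewrite mulr1 (_ : Rintegral _ _ _ = 0) ?add0r//.
under eq_Rintegral => x _ do rewrite -[x - m]mulr1.
rewrite h; under eq_Rintegral do rewrite mul0r.
by rewrite /Rintegral integral0 mulr0.
Qed.

Lemma normal_variance : \int[leb]_x ((x - m) ^+ 2 * p x) = s ^+ 2.
Proof.
transitivity (\int[leb]_x ((x - m) * (x - m) * p x)) => //.
transitivity (s ^+ 2 * \int[leb]_x (1 * p x)); last first.
  by under eq_Rintegral do rewrite mul1r; rewrite /Rintegral integral_normal_pdf mulr1.
apply: (@stein (fun x => x - m) (fun=> 1) 1).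
- by move=> x; apply: is_derive_eq; rewrite subr0.
- by move=> x; exact: cvg_cst.
- exact: abs_le_sqr.
- by move=> x; rewrite mul1r normr1 lerDl sqr_ge0.
- by move=> x; rewrite -expr2 ger0_norm ?sqr_ge0// lerDr.
Qed.

Let icos t b : leb.-integrable setT (EFin \o (fun x => cos (t * (x - m) + b) * p x)).
Proof.
apply: integrable_gauss.
  apply: measurableT_comp; first by apply: continuous_measurable_fun; exact: continuous_cos.
  by apply: measurable_funD => //; apply: measurable_funM => //; exact: measurable_funB.
by move=> x; rewrite (le_trans (cos_max _))// lerDl sqr_ge0.
Qed.

Let charb b t := \int[leb]_x (cos (t * (x - m) + b) * p x).

(* Differentiate under the integral, then apply [stein] to the sine: the
   transform solves [y' = - s ^+ 2 * t * y]. *)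
Let dcharb b t : is_derive t (1 : R) (charb b) (- s ^+ 2 * t * charb b t).
Proof.
pose F (t x : R) := cos (t * (x - m) + b) * p x.
have dF u x : is_derive u (1 : R) (F ^~ x) (- (x - m) * sin (u * (x - m) + b) * p x).
  by apply: is_derive_eq; rewrite /GRing.scale/=; ring.
have pF u x : partial1of2 F u x = - (x - m) * sin (u * (x - m) + b) * p x.
  by rewrite partial1of2E; have [_ ->] := dF u x.
have tI : `]t - 1, t + 1[%classic t by rewrite /= in_itv/=; apply/andP; split; lra.
have dcl u x : `]t - 1, t + 1[%classic u -> [set: R] x -> derivable (F ^~ x) u 1.
  by move=> _ _; have [] := dF u x.
have bnd u x : `|- (x - m) * sin (u * (x - m) + b) * p x| <= (1 + (x - m) ^+ 2) * p x.
  rewrite normrM (ger0_norm (p_ge0 x)) ler_wpM2r// normrM normrN.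
  by apply: le_trans (abs_le_sqr x); rewrite ler_piMr// sin_max.
have G0 x : 0 <= (1 + (x - m) ^+ 2) * p x by rewrite mulr_ge0 ?addr_ge0 ?sqr_ge0.
have bnd' u x : `]t - 1, t + 1[%classic u -> [set: R] x ->
    `|partial1of2 F u x| <= (1 + (x - m) ^+ 2) * p x.
  by move=> _ _; rewrite pF.
have dc := @derivable_under_integral R _ _ leb F setT measurableT t _ _ tI
  (fun u _ => icos u b) dcl _ G0 imaj bnd'.
have ec := @differentiation_under_integral R _ _ leb F setT measurableT t _ _ tI
  (fun u _ => icos u b) dcl _ G0 imaj bnd'.
apply: DeriveDef; first exact: dc.
rewrite -derive1E ec.
have h : \int[leb]_x ((x - m) * sin (t * (x - m) + b) * p x) =
   s ^+ 2 * \int[leb]_x (t * cos (t * (x - m) + b) * p x).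
  apply: (@stein (fun x => sin (t * (x - m) + b)) (fun x => t * cos (t * (x - m) + b)) `|t|).
  - by move=> x; apply: is_derive_eq; rewrite /GRing.scale/=; ring.
  - move=> x; apply: cvgMr; apply: (cvg_comp (fun x => t * (x - m) + b) cos); last exact: continuous_cos.
    by apply: cvgD; [apply: cvgMr; apply: cvgB; [exact: cvg_id|exact: cvg_cst]|exact: cvg_cst].
  - by move=> x; rewrite (le_trans (sin_max _))// lerDl sqr_ge0.
  - move=> x; rewrite normrM ler_wpM2l// (le_trans (cos_max _))// lerDl sqr_ge0//.
  - by move=> x; apply: le_trans (abs_le_sqr x); rewrite normrM ler_piMr// sin_max.
have isin : leb.-integrable setT (EFin \o (fun x => (x - m) * sin (t * (x - m) + b) * p x)).
  apply: integrable_gauss.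
    apply: measurable_funM; first exact: measurable_funB.
    apply: measurableT_comp; first by apply: continuous_measurable_fun; exact: continuous_sin.
    by apply: measurable_funD => //; apply: measurable_funM => //; exact: measurable_funB.
  by move=> x; apply: le_trans (abs_le_sqr x); rewrite normrM ler_piMr// sin_max.
transitivity (\int[leb]_x (-1 * ((x - m) * sin (t * (x - m) + b) * p x))).
  by apply: eq_Rintegral => x _; rewrite pF; ring.
rewrite RintegralZl// h.
under eq_Rintegral do rewrite -mulrA.
by rewrite RintegralZl// /charb; ring.
Qed.

Lemma normal_cos b t : \int[leb]_x (cos (t * (x - m) + b) * p x) =
  expR (- (s ^+ 2 * t ^+ 2 / 2)) * cos b.
Proof.
rewrite -/(charb b t).
pose E u := expR (s ^+ 2 * u ^+ 2 / 2).
have dE u : is_derive u (1 : R) E (s ^+ 2 * u * E u).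
  by apply: is_derive_eq; rewrite /GRing.scale/= /E; field.
have dH u : is_derive u (1 : R) (charb b * E) 0.
  by apply: (is_derive_eq (is_deriveM (dcharb b u) (dE u))); rewrite /GRing.scale/=; ring.
have := is_derive_0_is_cst t 0 dH; rewrite !fctE.
have -> : E 0 = 1 by rewrite /E expr0n mulr0 mul0r expR0.
have -> : charb b 0 = cos b.
  rewrite /charb; under eq_Rintegral do rewrite mul0r add0r.
  rewrite RintegralZl//; last exact: integrable_normal_pdf.
  by rewrite [Rintegral _ _ _](_ : _ = 1) ?mulr1// /Rintegral integral_normal_pdf.
by rewrite mulr1 expRN => <-; rewrite /E mulrC mulfK// gt_eqF// expR_gt0.
Qed.

End gaussian.

Section gaussian_variable.
Context d (Om : measurableType d) (R : realType) (Q : probability Om R).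
Variable V : {RV Q >-> R}.
Local Notation leb := (@lebesgue_measure R).

(* The same variable, with values in the copy of [R] that carries the Lebesgue
   measure. *)
Let VL : Om -> measurableTypeR R := V.
Let mVL : measurable_fun setT VL. Proof. exact: (measurable_funP V). Qed.
HB.instance Definition _ := isMeasurableFun.Build _ _ _ _ VL mVL.
Let D : {measure set (measurableTypeR R) -> \bar R} := distribution Q VL.

Lemma integrable_distribution (h : R -> R) :
  D.-integrable setT (EFin \o h) -> Q.-integrable setT (fun w => (h (V w))%:E).
Proof.
move=> /integrableP[mh hoo]; apply/integrableP; split.
  exact: (measurableT_comp mh mVL).
move: hoo; rewrite /D ge0_integral_distribution//.
exact: measurableT_comp.
Qed.

Lemma Rintegral_distribution (h : R -> R) :
  D.-integrable setT (EFin \o h) ->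
  \int[Q]_w h (V w) = \int[D]_x h x.
Proof.
move=> ih; rewrite /Rintegral /D integral_distribution//; first exact: measurable_int ih.
exact: integrable_distribution.
Qed.

(** One statement for the Dirac and the normal case; the integrability clause
    covers all functions of at most quadratic growth. *)
Lemma gaussian_moments : is_gaussian Q V -> exists m s : R,
  [/\ forall (h : R -> R) C, measurable_fun setT h -> (forall x, `|h x| <= C * (1 + (x - m) ^+ 2)) ->
        Q.-integrable setT (fun w => (h (V w))%:E),
    \int[Q]_w V w = m, \int[Q]_w ((V w - m) ^+ 2) = s ^+ 2 &
    forall b, \int[Q]_w cos (V w - m + b) = expR (- (s ^+ 2 / 2)) * cos b].
Proof.
move=> [m [s [s_ge0 law]]]; exists m, s.
have bd1 (x : R) : `|x| <= (1 + `|m|) * (1 + (x - m) ^+ 2).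
  have : `|x - m| <= 1 + (x - m) ^+ 2.
    rewrite -(real_normK (num_real (x - m))); have := normr_ge0 (x - m).
    by set a := `|_|; nra.
  have := ler_normD (x - m) m; rewrite subrK; have := normr_ge0 m; have := sqr_ge0 (x - m).
  by set A := _ ^+ 2; nra.
have bd2 (x : R) : `|(x - m) ^+ 2| <= 1 * (1 + (x - m) ^+ 2).
  by rewrite mul1r ger0_norm ?sqr_ge0// lerDr.
have bd3 b (x : R) : `|cos (x - m + b)| <= 1 * (1 + (x - m) ^+ 2).
  by rewrite mul1r (le_trans (cos_max _))// lerDl sqr_ge0.
have m1 : measurable_fun setT (id : R -> R) by [].
have m2 : measurable_fun setT (fun x : R => (x - m) ^+ 2).
  by apply: measurable_funX; exact: measurable_funB.
have m3 b : measurable_fun setT (fun x : R => cos (x - m + b)).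
  by apply: measurable_cos; apply: measurable_funD => //; exact: measurable_funB.
have [s0|s0] := eqVneq s 0.
  have ED (h : R -> R) : measurable_fun setT h ->
      (\int[D]_x (h x)%:E = (h m)%:E)%E.
    move=> mh; rewrite (eq_measure_integral (\d_(m : measurableTypeR R) : {measure set (measurableTypeR R) -> \bar R})).
      by rewrite integral_dirac// ?diracT ?mul1e//; exact/measurable_EFinP.
    by move=> A mA _ /=; rewrite /D/= /distribution/= /pushforward law// s0 eqxx.
  have iD (h : R -> R) : measurable_fun setT h -> D.-integrable setT (EFin \o h).
    move=> mh; apply/integrableP; split; first exact/measurable_EFinP.
    by rewrite /= (ED (fun x => `|h x|)) ?ltry//; exact: measurableT_comp.
  split.
  - by move=> h C mh _; apply: integrable_distribution; exact: iD.
  - by rewrite (Rintegral_distribution (iD id _))// /Rintegral ED.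
  - by rewrite (Rintegral_distribution (iD _ m2))// /Rintegral ED//= subrr s0.
  - move=> b; rewrite (Rintegral_distribution (iD _ (m3 b)))// /Rintegral ED//= subrr add0r.
    by rewrite s0 expr0n mul0r oppr0 expR0 mul1r.
have DE A : measurable A -> D A = (\int[leb]_(x in A) (normal_pdf m s x)%:E)%E.
  by move=> mA; rewrite /D/= /distribution/= /pushforward law// (negbTE s0).
have p0 (x : measurableTypeR R) : 0 <= normal_pdf m s x by exact: normal_pdf_ge0.
have mp : measurable_fun setT (normal_pdf m s) by exact: measurable_normal_pdf.
have iD (h : R -> R) C : measurable_fun setT h -> (forall x, `|h x| <= C * (1 + (x - m) ^+ 2)) ->
    D.-integrable setT (EFin \o h).
  move=> mh hC.
  apply: (@integrable_density _ (measurableTypeR R) R leb D _ p0 mp DE h mh).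
  exact: integrable_gaussC hC.
have ED (h : R -> R) : measurable_fun setT h ->
    \int[D]_x h x = \int[leb]_x (h x * normal_pdf m s x).
  by move=> mh; rewrite /Rintegral (@integral_density _ (measurableTypeR R) R leb D _ p0 mp DE h mh).
split.
- by move=> h C mh hC; apply: integrable_distribution; exact: iD hC.
- by rewrite (Rintegral_distribution (iD _ _ m1 bd1)) ED// normal_mean.
- by rewrite (Rintegral_distribution (iD _ _ m2 bd2)) ED// normal_variance.
- move=> b; rewrite (Rintegral_distribution (iD _ _ (m3 b) (bd3 b))) ED//.
  have := normal_cos m s0 b 1; rewrite expr1n mulr1 => <-.
  by apply: eq_Rintegral => x _; rewrite mul1r.
Qed.

Lemma gaussian_sqr_integrable : is_gaussian Q V -> Q.-integrable setT (fun w => (V w ^+ 2)%:E).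
Proof.
move=> /gaussian_moments[m [s [int _ _ _]]].
apply: (int (fun x => x ^+ 2) (2 * (1 + m ^+ 2))); first exact: measurable_funX.
move=> x; rewrite ger0_norm ?sqr_ge0//.
have -> : x ^+ 2 = ((x - m) + m) ^+ 2 by rewrite subrK.
set a := x - m; have := sqr_ge0 (a - m); have := mulr_ge0 (sqr_ge0 a) (sqr_ge0 m).
by move=> *; nra.
Qed.

Lemma gaussian_cos b : is_gaussian Q V -> \int[Q]_w (V w) = 0 ->
  \int[Q]_w cos (V w + b) = expR (- ((\int[Q]_w (V w ^+ 2)) / 2)) * cos b.
Proof.
move=> /gaussian_moments[m [s [_ -> + +]]] m0; rewrite m0 => vE cE.
have -> : \int[Q]_w (V w ^+ 2) = s ^+ 2.
  by rewrite -vE; apply: eq_Rintegral => w _; rewrite subr0.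
by rewrite -cE; apply: eq_Rintegral => w _; rewrite subr0.
Qed.

End gaussian_variable.

(** * Integrals over products *)

Section product_integral.
Local Open Scope ereal_scope.
Context d1 d2 (T1 : measurableType d1) (T2 : measurableType d2) (R : realType).
Variable m1 : {sigma_finite_measure set T1 -> \bar R}.
Variable m2 : {sigma_finite_measure set T2 -> \bar R}.

Let product_sigma_finite : sigma_finite setT (m1 \x m2).
Proof.
have [F TF mF] := sigma_finiteT m1; have [G TG mG] := sigma_finiteT m2.
exists (fun n => if unpickle n is Some (i, j) then F i `*` G j else set0).
  apply/seteqP; split => // -[x y] _.
  have [i _ Fi] : (\bigcup_i F i) x by rewrite -TF.
  have [j _ Gj] : (\bigcup_i G i) y by rewrite -TG.
  by exists (pickle (i, j)) => //=; rewrite pickleK.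
move=> n; case: (unpickle n) => [[i j]|]; last by split => //; rewrite measure0.
have [mFi Fioo] := mF i; have [mGj Gjoo] := mG j.
split; first exact: measurableX.
by rewrite product_measure1E// lte_mul_pinfty// ge0_fin_numE.
Qed.

(** Makes Tonelli's theorem available when one factor is itself a product, such
    as the Lebesgue measure of the plane. *)
Definition sigma_finite_product :
    {sigma_finite_measure set (T1 * T2)%type -> \bar R} :=
  HB.pack_for {sigma_finite_measure set (T1 * T2)%type -> \bar R} (m1 \x m2)
    (Measure_isSigmaFinite.Build _ _ _ (m1 \x m2) product_sigma_finite).

Lemma ge0_integral_prod (g1 : T1 -> \bar R) (g2 : T2 -> \bar R) :
  measurable_fun setT g1 -> measurable_fun setT g2 ->
  (forall x, 0 <= g1 x) -> (forall y, 0 <= g2 y) ->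
  \int[m1 \x m2]_z (g1 z.1 * g2 z.2) = (\int[m1]_x g1 x) * \int[m2]_y g2 y.
Proof.
move=> mg1 mg2 g10 g20.
rewrite fubini_tonelli1; last 2 first.
- by apply: emeasurable_funM; exact: measurableT_comp.
- by move=> z; exact: mule_ge0.
rewrite /fubini_F /=; under eq_integral do rewrite ge0_integralZl//.
by rewrite ge0_integralZr// integral_ge0.
Qed.

End product_integral.

(** * Densities with decay and the masses of rectangles *)

Section weight.
Context {R : realType}.
Implicit Types x y r : R.
Local Notation leb := (@lebesgue_measure R).

(** It is integrable, loses only a factor [4] when its argument is halved
    ([segment_weight_le_majorant]), and dominates [(1 + `|x|)^-1 ^+ 2]
    ([sqr_mass_le]). *)
Definition weight y : R := (oneDsqr y)^-1.

Definition weight_mass : R := fine (\int[leb]_y (weight y)%:E)%E.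

Lemma oneDsqr_gt0 y : 0 < oneDsqr y.
Proof. exact: lt_le_trans ltr01 (oneDsqr_ge1 y). Qed.

Lemma weight_gt0 y : 0 < weight y.
Proof. by rewrite invr_gt0 oneDsqr_gt0. Qed.

Lemma weight_le1 y : weight y <= 1.
Proof. exact: oneDsqrV_le1. Qed.

Lemma measurable_weight : measurable_fun setT weight.
Proof. by apply: continuous_measurable_fun; exact: continuous_oneDsqrV. Qed.

Lemma weight_massE : (\int[leb]_y (weight y)%:E)%E = weight_mass%:E.
Proof.
rewrite fineK// ge0_symfun_integralT; last 3 first.
- by move=> x; exact/ltW/weight_gt0.
- exact: continuous_oneDsqrV.
- by move=> x; rewrite /= /weight /oneDsqr sqrrN.
by rewrite -set_itvcy integral0y_oneDsqr.
Qed.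

Lemma weight_mass_ge0 : 0 <= weight_mass.
Proof. by apply/fine_ge0/integral_ge0 => y _; rewrite lee_fin ltW// weight_gt0. Qed.

(** An exponential tail lies below the weight, because [expR] dominates a
    quadratic: [expR z = expR (z / 2) ^+ 2 >= (1 + z / 2) ^+ 2]. *)
Lemma exp_le_weight (c : R) : 0 < c ->
  exists2 K, 0 < K & forall y, expR (- c * `|y|) <= K * weight y.
Proof.
move=> c0; have c2 : 0 < c ^+ 2 by rewrite exprn_gt0.
exists (1 + 4 / c ^+ 2) => [|y]; first by rewrite addr_gt0// divr_gt0.
rewrite /weight ler_pdivlMr ?oneDsqr_gt0// mulNr expRN mulrC.
rewrite ler_pdivrMr ?expR_gt0//.
have h : 1 + c ^+ 2 * y ^+ 2 / 4 <= expR (c * `|y|).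
  have cy0 : 0 <= c * `|y| by rewrite mulr_ge0// ltW.
  have -> : c ^+ 2 * y ^+ 2 = (c * `|y|) ^+ 2.
    by rewrite exprMn real_normK ?num_real.
  rewrite (_ : expR _ = expR (c * `|y| / 2) ^+ 2); last first.
    by rewrite -expRM_natl; congr expR; field.
  have := expR_ge1Dx (c * `|y| / 2); set z := c * _ in cy0 *.
  by move=> e1; nra.
apply: (@le_trans _ _ ((1 + 4 / c ^+ 2) * (1 + c ^+ 2 * y ^+ 2 / 4))); last first.
  by rewrite ler_wpM2l// addr_ge0// divr_ge0// sqr_ge0.
have -> : (1 + 4 / c ^+ 2) * (1 + c ^+ 2 * y ^+ 2 / 4) =
  oneDsqr y + (4 / c ^+ 2 + c ^+ 2 * y ^+ 2 / 4).
  by rewrite /oneDsqr; field; rewrite gt_eqF.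
rewrite lerDl addr_ge0// divr_ge0//; first exact: ltW.
by rewrite mulr_ge0// sqr_ge0.
Qed.

Definition segment x r : set R := `[x - r / 2, x + r / 2].

Lemma segmentP x r y : segment x r y -> `|x - y| <= r / 2.
Proof.
by rewrite /segment /= in_itv /= => /andP[h1 h2]; rewrite ler_norml; apply/andP; split; lra.
Qed.

Lemma measurable_segment x r :
  measurable (segment x r : set (measurableTypeR R)).
Proof. exact: measurable_itv. Qed.

Lemma leb_segment x r : 0 <= r -> leb (segment x r) = r%:E.
Proof.
move=> r0; rewrite lebesgue_measure_itv /= lte_fin; case: ifPn => h.
  by rewrite -EFinB; congr EFin; lra.
by congr EFin; move: h; rewrite -leNgt; lra.
Qed.

(** On the segment [1 + `|x| <= 1 + `|y| + r / 2]; the weight times [1 + `|y|]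
    is at most [2] and the weight alone has finite integral. *)
Lemma segment_weight_le x r : 0 <= r ->
  (\int[leb]_(y in segment x r) (weight y)%:E <=
   ((2 + weight_mass / 2) * r / (1 + `|x|))%:E)%E.
Proof.
move=> r0; have mS := measurable_segment x r; have x1 : 0 < 1 + `|x| by rewrite ltr_pwDl.
have mw (D : set (measurableTypeR R)) : measurable_fun D (fun y => (weight y)%:E).
  by apply/measurable_EFinP; apply: measurable_funTS; exact: measurable_weight.
have w0 y : 0 <= weight y by exact/ltW/weight_gt0.
rewrite EFinM muleC lee_pdivlMl//.
rewrite -ge0_integralZl//.
apply: (@le_trans _ _ (\int[leb]_(y in segment x r) (2%:E + (r / 2)%:E * (weight y)%:E)))%E.
  apply: ge0_le_integral => //.
  - by move=> y _; rewrite lee_fin mulr_ge0// ltW.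
  - by apply: measurable_funeM; exact: mw.
  - apply: emeasurable_funD => //; apply: measurable_funeM; exact: mw.
  move=> y /segmentP xy; rewrite lee_fin.
  have h : (1 + `|y|) * weight y <= 2.
    rewrite ler_pdivrMr ?oneDsqr_gt0// /oneDsqr -(real_normK (num_real y)).
    by have := sqr_ge0 (`|y| - 1); set z := `|y|; nra.
  have h2 : `|x| <= `|y| + r / 2.
    by have := lerB_dist x y; lra.
  by have := w0 y; nra.
2: by move=> y _; rewrite lee_fin.
rewrite ge0_integralD//; [|by move=> y _; rewrite lee_fin mulr_ge0// divr_ge0|].
  apply: (@le_trans _ _ ((2 * r)%:E + (r / 2 * weight_mass)%:E))%E.
    apply: leeD; first by rewrite integral_cst//= leb_segment.
    rewrite ge0_integralZl//; first last.
    - by rewrite lee_fin divr_ge0.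
    - by move=> y _; rewrite lee_fin.
    rewrite (EFinM (r / 2)); apply: lee_wpmul2l; first by rewrite lee_fin divr_ge0.
    rewrite -weight_massE; apply: ge0_subset_integral => //.
    by move=> y _; rewrite lee_fin.
  by rewrite -EFinD lee_fin; lra.
by apply: measurable_funeM; exact: mw.
Qed.

(** If [r <= `|x|] then [`|x| <= 2 * `|y|] on the segment, so the weight is at
    most four times its value at [x]; if not, the whole mass of the
    weight is a bound. The right-hand side, unlike that of [segment_weight_le], is
    integrable in [x]. *)
Lemma segment_weight_le_majorant x r : 0 <= r ->
  (\int[leb]_(y in segment x r) (weight y)%:E <=
   (4 * r * weight x + weight_mass * \1_(`]- r, r[%classic : set R) x)%:E)%E.
Proof.
move=> r0; have mS := measurable_segment x r.
have mw (D : set (measurableTypeR R)) : measurable_fun D (fun y => (weight y)%:E).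
  by apply/measurable_EFinP; apply: measurable_funTS; exact: measurable_weight.
have w0 y : 0 <= weight y by exact/ltW/weight_gt0.
have memE : (x \in (`]- r, r[%classic : set R)) = (`|x| < r).
  by rewrite mem_setE in_itv /= ltr_norml.
rewrite indicE memE EFinD; case: (ltP `|x| r) => xr.
  apply: (@le_trans _ _ (\int[leb]_y (weight y)%:E)%E).
    apply: ge0_subset_integral => //.
    by move=> y _; rewrite lee_fin.
  by rewrite weight_massE mulr1 leeDr// lee_fin !mulr_ge0.
rewrite mulr0 adde0.
apply: (@le_trans _ _ (\int[leb]_(y in segment x r) (4 * weight x)%:E)%E).
  apply: ge0_le_integral => //; first by move=> y _; rewrite lee_fin.
  move=> y /segmentP xy; rewrite lee_fin /weight -[leLHS]mul1r.
  rewrite ler_pdivrMr ?oneDsqr_gt0// mulrAC ler_pdivlMr ?oneDsqr_gt0// /oneDsqr mul1r.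
  have h2 : `|x| <= 2 * `|y| by have := lerB_dist x y; lra.
  rewrite -(real_normK (num_real x)) -(real_normK (num_real y)).
  by have := normr_ge0 x; have := normr_ge0 y; nra.
by rewrite integral_cst//= leb_segment// -EFinM lee_fin; lra.
Qed.
End weight.

Section product_setX.
Local Open Scope ereal_scope.
Context d1 d2 (T1 : measurableType d1) (T2 : measurableType d2) (R : realType).
Variable m1 : {sigma_finite_measure set T1 -> \bar R}.
Variable m2 : {sigma_finite_measure set T2 -> \bar R}.

Lemma ge0_integral_setX (A : set T1) (B : set T2) (g1 : T1 -> \bar R) (g2 : T2 -> \bar R) :
  measurable A -> measurable B ->
  measurable_fun A g1 -> measurable_fun B g2 ->
  (forall x, A x -> 0 <= g1 x) -> (forall y, B y -> 0 <= g2 y) ->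
  \int[m1 \x m2]_(z in A `*` B) (g1 z.1 * g2 z.2) =
  (\int[m1]_(x in A) g1 x) * \int[m2]_(y in B) g2 y.
Proof.
move=> mA mB mg1 mg2 g10 g20.
rewrite integral_mkcond [in RHS]integral_mkcond [X in _ * X]integral_mkcond.
rewrite -ge0_integral_prod//; first last.
- by apply: erestrict_ge0.
- by apply: erestrict_ge0.
- exact/(measurable_restrictT _ _).1.
- exact/(measurable_restrictT _ _).1.
apply: eq_integral => -[x y] _ /=; rewrite !patchE in_setX /=.
case: (x \in A); case: (y \in B) => //=; rewrite ?mul0e ?mule0//.
Qed.

End product_setX.

Section Rintegral_sum.
Context d (T : measurableType d) (R : realType).
Variables (mu : {measure set T -> \bar R}) (D : set T).
Hypothesis mD : measurable D.

Lemma integrable_Rintegral_sum n (t : 'I_n -> R) (h : 'I_n -> T -> R) :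
  (forall i, mu.-integrable D (EFin \o h i)) ->
  mu.-integrable D (EFin \o (fun x => \sum_(i < n) t i * h i x)) /\
  \int[mu]_(x in D) (\sum_(i < n) t i * h i x) =
  \sum_(i < n) t i * \int[mu]_(x in D) h i x.
Proof.
elim: n t h => [|n ih] t h hi.
  under eq_Rintegral do rewrite big_ord0.
  rewrite big_ord0 /Rintegral integral0; split => //.
  under eq_fun do rewrite /= big_ord0.
  exact: integrable0.
have [is_ Es] := ih (fun i => t (lift ord0 i)) (fun i => h (lift ord0 i)) (fun i => hi _).
have i0 : mu.-integrable D (EFin \o (fun x => t ord0 * h ord0 x)).
  exact: (integrableZl mD (t ord0) (hi ord0)).
split.
  rewrite (_ : EFin \o _ = (fun x => (t ord0 * h ord0 x)%:E +
    (\sum_(i < n) t (lift ord0 i) * h (lift ord0 i) x)%:E)%E); last first.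
    by apply/funext => x /=; rewrite big_ord_recl.
  exact: integrableD.
under eq_Rintegral do rewrite big_ord_recl.
by rewrite RintegralD// RintegralZl// Es big_ord_recl.
Qed.

End Rintegral_sum.

Section mass.
Context {R : realType}.
Implicit Types (f : R * R -> R) (x u : R * R) (z : (R * R) * (R * R)).
Local Notation leb := (@lebesgue_measure R).
Local Notation GR := (measurableTypeR R).

Definition plane_weight x : R := weight x.1 * weight x.2.

(** What the proof retains of a continuous density with exponential decay; such
    functions are stable under linear combinations. *)
Definition tame (C : R) f :=
  [/\ 0 <= C, continuous f & forall x, `|f x| <= C * plane_weight x].

Definition mass f z : R := \int[leb2 R]_(y in rectangle z.1 z.2) f y.

Lemma plane_weight_ge0 x : 0 <= plane_weight x.
Proof. by rewrite mulr_ge0// ltW// weight_gt0. Qed.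

Lemma exp_decay_tame f : continuous f -> exp_decay f -> exists C, tame C f.
Proof.
move=> cf [C [c [C0 c0 fC]]]; have [K K0 hK] := exp_le_weight c0.
exists (C * (K * K)); split => //; first by rewrite !mulr_ge0// ltW.
move=> x; apply: (le_trans (fC x)); rewrite -mulrA ler_wpM2l ?(ltW C0)//.
rewrite mulrDr expRD /plane_weight mulrACA.
by apply: ler_pM; rewrite ?expR_ge0//.
Qed.

Lemma measurable_rectangle x u : measurable (rectangle x u : set (GR * GR)%type).
Proof. by apply: measurableX; exact: measurable_segment. Qed.

Lemma leb2_rectangle x u : 0 <= u.1 -> 0 <= u.2 ->
  leb2 R (rectangle x u) = (u.1 * u.2)%:E.
Proof.
move=> u1 u2; rewrite EFinM -(leb_segment x.1 u1) -(leb_segment x.2 u2).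
by rewrite product_measure1E//; exact: measurable_segment.
Qed.

Lemma measurable_weightE (D : set GR) : measurable_fun D (fun y => (weight y)%:E).
Proof. by apply/measurable_EFinP; apply: measurable_funTS; exact: measurable_weight. Qed.

Lemma measurable_plane_weight : measurable_fun [set: GR * GR] plane_weight.
Proof.
by apply: measurable_funM; apply: measurableT_comp => //; exact: measurable_weight.
Qed.

Lemma plane_weight_rectangle x u :
  (\int[leb2 R]_(y in rectangle x u) (plane_weight y)%:E =
  (\int[leb]_(y in segment x.1 u.1) (weight y)%:E) *
  (\int[leb]_(y in segment x.2 u.2) (weight y)%:E))%E.
Proof.
have w0 y : (0 <= (weight y)%:E)%E by rewrite lee_fin ltW// weight_gt0.
have := @ge0_integral_setX _ _ GR GR R leb leb (segment x.1 u.1) (segment x.2 u.2) (fun y => (weight y)%:E) (fun y => (weight y)%:E).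
move=> <-//; [exact: measurable_segment..| exact: measurable_weightE| exact: measurable_weightE].
Qed.

Lemma integral_plane_weight :
  (\int[leb2 R]_y (plane_weight y)%:E = (weight_mass * weight_mass)%:E)%E.
Proof.
have w0 y : (0 <= (weight y)%:E)%E by rewrite lee_fin ltW// weight_gt0.
have := @ge0_integral_prod _ _ GR GR R leb leb (fun y => (weight y)%:E) (fun y => (weight y)%:E).
by rewrite !weight_massE EFinM => <-//; exact: measurable_weightE.
Qed.

Lemma integrable_plane_weight : (leb2 R).-integrable setT (EFin \o plane_weight).
Proof.
apply/(@integrableP _ (GR * GR)%type); split.
  by apply/measurable_EFinP; exact: measurable_plane_weight.
under eq_integral do rewrite /= ger0_norm ?plane_weight_ge0//.
by rewrite integral_plane_weight ltry.
Qed.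

Lemma tame_measurable C f : tame C f -> measurable_fun [set: GR * GR] f.
Proof. by move=> [_ cf _]; exact: continuous_prod_measurable. Qed.

Lemma tame_integrable C f : tame C f -> (leb2 R).-integrable setT (EFin \o f).
Proof.
move=> tf; have [C0 cf fC] := tf.
apply: (@le_integrable _ (GR * GR)%type R (leb2 R) setT measurableT _ (EFin \o (fun y => C * plane_weight y))) => //.
- by apply/measurable_EFinP; exact: tame_measurable tf.
- move=> y _; rewrite lee_fin; apply: (le_trans (fC y)).
  by rewrite ler_norm.
- exact: (@integrableZl _ (GR * GR)%type R (leb2 R) setT measurableT C _ integrable_plane_weight).
Qed.

Lemma mass_le C f z : tame C f ->
  (`|mass f z|%:E <= C%:E * ((\int[leb]_(y in segment z.1.1 z.2.1) (weight y)%:E) *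
    (\int[leb]_(y in segment z.1.2 z.2.2) (weight y)%:E)))%E.
Proof.
move=> tf; have [C0 cf fC] := tf; have mR := measurable_rectangle z.1 z.2.
have iR : (leb2 R).-integrable (rectangle z.1 z.2) (EFin \o f).
  by apply: integrableS (tame_integrable tf).
rewrite -plane_weight_rectangle -abse_EFin /mass /Rintegral fineK; last first.
  exact: integrable_fin_num.
have h := le_abse_integral (leb2 R) mR (measurable_int _ iR).
apply: (le_trans h).
rewrite -ge0_integralZl//; first last.
- by move=> y _; rewrite lee_fin plane_weight_ge0.
- by apply/measurable_EFinP; apply: measurable_funTS; exact: measurable_plane_weight.
apply: ge0_le_integral => //.
- by apply: measurableT_comp => //; exact: (measurable_int _ iR).
- by apply/measurable_EFinP; apply: measurable_funTS; apply: measurable_funM => //; exact: measurable_plane_weight.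
by move=> y _; rewrite lee_fin.
Qed.

Definition segment_const : R := 2 + weight_mass / 2.

Definition majorant (x r : R) : R :=
  4 * r * weight x + weight_mass * \1_(`]- r, r[%classic : set R) x.

Lemma majorant_ge0 (x r : R) : 0 <= r -> 0 <= majorant x r.
Proof.
move=> r0; rewrite /majorant addr_ge0// mulr_ge0//; last exact: weight_mass_ge0.
- by rewrite mulr_ge0.
- by rewrite ltW// weight_gt0.
Qed.

(** Used for the integrability of the masses. *)
Lemma mass_le_majorant C f z : tame C f -> 0 <= z.2.1 -> 0 <= z.2.2 ->
  `|mass f z| <= C * (majorant z.1.1 z.2.1 * majorant z.1.2 z.2.2).
Proof.
move=> tf u1 u2; have [C0 _ _] := tf; rewrite -lee_fin.
apply: (le_trans (mass_le z tf)); rewrite [leRHS]EFinM lee_wpmul2l// EFinM.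
apply: lee_pmul; rewrite ?segment_weight_le_majorant//;
  by apply: integral_ge0 => y _; rewrite lee_fin ltW// weight_gt0.
Qed.

(** The dominating function for the second-order terms: the square of
    [segment_weight_le] in each direction, with [(1 + `|x|)^-1 ^+ 2 <= weight x]. *)
Lemma sqr_mass_le C f z : tame C f -> 0 <= z.2.1 -> 0 <= z.2.2 ->
  mass f z ^+ 2 <= C ^+ 2 * segment_const ^+ 4 *
     (plane_weight z.1 * (z.2.1 ^+ 2 * z.2.2 ^+ 2)).
Proof.
move=> tf u1 u2; have [C0 _ _] := tf.
have wle (y : R) : (1 + `|y|)^-1 ^+ 2 <= weight y.
  rewrite exprVn /weight lef_pV2 ?posrE ?oneDsqr_gt0//.
  by rewrite /oneDsqr -(real_normK (num_real y)); have := normr_ge0 y; nra.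
have h : `|mass f z| <= C * ((segment_const * z.2.1 / (1 + `|z.1.1|)) *
    (segment_const * z.2.2 / (1 + `|z.1.2|))).
  rewrite -lee_fin.
  apply: (le_trans (mass_le z tf)); rewrite [leRHS]EFinM lee_wpmul2l// EFinM.
  apply: lee_pmul; rewrite ?segment_weight_le//;
    by apply: integral_ge0 => y _; rewrite lee_fin ltW// weight_gt0.
rewrite -[leLHS]real_normK ?num_real//.
apply: (@le_trans _ _ ((C * ((segment_const * z.2.1 / (1 + `|z.1.1|)) *
    (segment_const * z.2.2 / (1 + `|z.1.2|)))) ^+ 2)).
  by rewrite lerXn2r ?nnegrE// (le_trans (normr_ge0 (mass f z)) h).
rewrite [leLHS](_ : _ = C ^+ 2 * segment_const ^+ 4 * (((1 + `|z.1.1|)^-1 ^+ 2 *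
  (1 + `|z.1.2|)^-1 ^+ 2) * (z.2.1 ^+ 2 * z.2.2 ^+ 2))); last first.
  by ring.
have K4 : 0 <= segment_const ^+ 4 by rewrite (exprM _ 2 2) sqr_ge0.
apply: ler_wpM2l; first by rewrite mulr_ge0// sqr_ge0.
by apply: ler_wpM2r; [rewrite mulr_ge0// sqr_ge0|apply: ler_pM; rewrite ?sqr_ge0].
Qed.

Lemma mass_sum n (t : 'I_n -> R) (f : 'I_n -> R * R -> R) (C : 'I_n -> R) z :
  (forall i, tame (C i) (f i)) ->
  mass (fun y => \sum_(i < n) t i * f i y) z = \sum_(i < n) t i * mass (f i) z.
Proof.
move=> tf; have mR := measurable_rectangle z.1 z.2.
have iR i : (leb2 R).-integrable (rectangle z.1 z.2) (EFin \o f i).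
  by apply: integrableS (tame_integrable (tf i)).
exact: (integrable_Rintegral_sum mR t iR).2.
Qed.

Lemma tame_sum n (t : 'I_n -> R) (f : 'I_n -> R * R -> R) (C : 'I_n -> R) :
  (forall i, tame (C i) (f i)) ->
  tame (\sum_(i < n) `|t i| * C i) (fun y => \sum_(i < n) t i * f i y).
Proof.
move=> tf; split.
- by apply: sumr_ge0 => i _; rewrite mulr_ge0//; have [] := tf i.
- apply: continuous_big => [|i _]; first exact: add_continuous.
  by move=> x; apply: cvgM; [exact: cvg_cst|have [_ + _] := tf i; apply].
move=> x; rewrite mulr_suml; apply: (le_trans (ler_norm_sum _ _ _)).
apply: ler_sum => i _; rewrite normrM -mulrA ler_wpM2l//.
by have [_ _] := tf i; apply.
Qed.

(** The rectangle is a section of a measurable set described by four linear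
    inequalities, so this is the measurability part of Tonelli's theorem. *)
Lemma measurable_integral_rectangle (g : GR * GR -> \bar R) :
  measurable_fun setT g -> (forall y, 0 <= g y)%E ->
  measurable_fun [set: (R * R) * (R * R)]
    (fun z => \int[leb2 R]_(y in rectangle z.1 z.2) g y)%E.
Proof.
move=> mg g0.
pose b (p : ((R * R) * (R * R)) * (GR * GR)) : bool :=
  ((p.1.1.1 - p.1.2.1 / 2 <= p.2.1) && (p.2.1 <= p.1.1.1 + p.1.2.1 / 2)) &&
  ((p.1.1.2 - p.1.2.2 / 2 <= p.2.2) && (p.2.2 <= p.1.1.2 + p.1.2.2 / 2)).
have mb : measurable_fun setT b.
  have m1 : measurable_fun setT (fun p : ((R * R) * (R * R)) * (GR * GR) => p.2.1 : R).
    exact: (measurableT_comp measurable_fst measurable_snd).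
  have m2 : measurable_fun setT (fun p : ((R * R) * (R * R)) * (GR * GR) => p.2.2 : R).
    exact: (measurableT_comp measurable_snd measurable_snd).
  have x1 : measurable_fun setT (fun p : ((R * R) * (R * R)) * (GR * GR) => p.1.1.1).
    exact: (measurableT_comp measurable_fst (measurableT_comp measurable_fst measurable_fst)).
  have x2 : measurable_fun setT (fun p : ((R * R) * (R * R)) * (GR * GR) => p.1.1.2).
    exact: (measurableT_comp measurable_snd (measurableT_comp measurable_fst measurable_fst)).
  have u1 : measurable_fun setT (fun p : ((R * R) * (R * R)) * (GR * GR) => p.1.2.1 / 2).
    apply: measurable_funM => //.
    exact: (measurableT_comp measurable_fst (measurableT_comp measurable_snd measurable_fst)).
  have u2 : measurable_fun setT (fun p : ((R * R) * (R * R)) * (GR * GR) => p.1.2.2 / 2).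
    apply: measurable_funM => //.
    exact: (measurableT_comp measurable_snd (measurableT_comp measurable_snd measurable_fst)).
  by repeat apply: measurable_and; apply: measurable_fun_ler => //;
    do ?[exact: measurable_funB|exact: measurable_funD].
pose phi p := if b p then g p.2 else 0%E.
have mphi : measurable_fun setT phi.
  apply: measurable_fun_if => //.
  by apply: measurable_funTS; exact: (measurableT_comp mg measurable_snd).
have phi0 p : (0 <= phi p)%E by rewrite /phi; case: ifP.
have h := @measurable_fun_fubini_tonelli_F _ _ ((R * R) * (R * R))%type (GR * GR)%type R
  (sigma_finite_product leb leb) phi mphi phi0.
rewrite (_ : (fun z => _) = fubini_F (leb2 R) phi)//.
apply/funext => z; rewrite integral_mkcond; apply: eq_integral => y _.
rewrite patchE /phi /b /=; congr (if _ then _ else _).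
by rewrite /rectangle in_setX !mem_setE !in_itv.
Qed.

Lemma measurable_mass C f : tame C f -> measurable_fun setT (mass f).
Proof.
move=> tf; have mf : measurable_fun [set: GR * GR] (EFin \o f).
  by apply/measurable_EFinP; exact: tame_measurable tf.
apply: measurableT_comp => //.
under eq_fun do rewrite integralE.
apply: emeasurable_funB.
  apply: (measurable_integral_rectangle (measurable_funepos mf)) => y.
  exact: funepos_ge0.
apply: (measurable_integral_rectangle (measurable_funeneg mf)) => y.
exact: funeneg_ge0.
Qed.

(** For small [rho n] the rectangle lies in a neighbourhood of [x] on which [f] is
    within [e] of [f x]. *)
Lemma mass_average f x u (rho : R^nat) : continuous f -> 0 < u.1 -> 0 < u.2 ->
  (forall n, 0 < rho n) -> rho n @[n --> \oo] --> 0 ->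
  mass f (x, dilation (rho n) u) / (rho n ^+ 2 * (u.1 * u.2)) @[n --> \oo] --> f x.
Proof.
move=> cf u1 u2 r0 rho0; apply/cvgrPdist_le => e e0.
have /cvgrPdist_le/(_ _ e0) := cf x.
rewrite near_nbhs => -[[A B] [/= nA nB] AB].
move: nA => [d1 /= d10 dA]; move: nB => [d2 /= d20 dB].
have h1 : \forall n \near \oo, rho n * u.1 < d1.
  have : rho n * u.1 @[n --> \oo] --> 0 * u.1 by apply: cvgM => //; exact: cvg_cst.
  by rewrite mul0r => /cvgr_lt; apply.
have h2 : \forall n \near \oo, rho n * u.2 < d2.
  have : rho n * u.2 @[n --> \oo] --> 0 * u.2 by apply: cvgM => //; exact: cvg_cst.
  by rewrite mul0r => /cvgr_lt; apply.
near=> n.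
have n1 : rho n * u.1 < d1 by near: n.
have n2 : rho n * u.2 < d2 by near: n.
have r1 : 0 < rho n * u.1 by rewrite mulr_gt0.
have r2 : 0 < rho n * u.2 by rewrite mulr_gt0.
pose D : set (GR * GR) := rectangle x (dilation (rho n) u).
have mD : measurable D by exact: measurable_rectangle.
have Dfx y : D y -> `|f x - f y| <= e.
  move=> [/segmentP /= y1 /segmentP /= y2]; apply: AB; split => /=.
    by apply: dA; rewrite /ball_ /=; lra.
  by apply: dB; rewrite /ball_ /=; lra.
have DE : leb2 R D = (rho n ^+ 2 * (u.1 * u.2))%:E.
  by rewrite leb2_rectangle /= ?ltW//; congr EFin; ring.
have v0 : 0 < rho n ^+ 2 * (u.1 * u.2) by rewrite !mulr_gt0// exprn_gt0.
have iD (k : R) : (leb2 R).-integrable D (EFin \o cst k).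
  apply/(@integrableP _ (GR * GR)%type); split; first by apply/measurable_EFinP; exact: measurable_cst.
  have := @integral_cst _ (GR * GR)%type R (leb2 R) D mD `|k|%:E.
  by move=> /= ->; rewrite DE -EFinM ltry.
have cE (k : R) : \int[leb2 R]_(y in D) k = k * (rho n ^+ 2 * (u.1 * u.2)).
  have -> : rho n ^+ 2 * (u.1 * u.2) = fine (leb2 R D) by rewrite DE.
  exact: Rintegral_cst.
have if_ : (leb2 R).-integrable D (EFin \o f).
  apply: (@le_integrable _ (GR * GR)%type R (leb2 R) D mD _ (EFin \o cst (`|f x| + e))) => //.
    apply/measurable_EFinP; apply: measurable_funTS; exact: continuous_prod_measurable.
  move=> y /Dfx fxy; rewrite lee_fin /= [leRHS]ger0_norm ?addr_ge0 ?(ltW e0)//.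
  by have := lerB_dist (f y) (f x); rewrite distrC in fxy; lra.
have up : mass f (x, dilation (rho n) u) <= (f x + e) * (rho n ^+ 2 * (u.1 * u.2)).
  rewrite -cE.
  apply: le_Rintegral => //; first exact: iD.
  by move=> y /Dfx; rewrite ler_norml => /andP[? ?]; lra.
have dn : (f x - e) * (rho n ^+ 2 * (u.1 * u.2)) <= mass f (x, dilation (rho n) u).
  rewrite -cE.
  apply: le_Rintegral => //; first exact: iD.
  by move=> y /Dfx; rewrite ler_norml => /andP[? ?]; lra.
rewrite -ler_pdivlMr// in dn; rewrite -ler_pdivrMr// in up.
by rewrite ler_norml; apply/andP; split; lra.
Unshelve. all: by end_near.
Qed.

End mass.

(** * The intensity measure and the moments of the edge lengths *)

Section density_of_M_P.
Context {R : realType}.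

(** Both densities are limits of the averages of [mu] over shrinking squares. *)
Lemma continuous_density_unique (mu : signed_measure R) f g :
  continuous_density mu f -> continuous_density mu g -> f = g.
Proof.
move=> [cf fE] [cg gE]; apply/funext => x.
pose rho (n : nat) : R := n.+1%:R^-1.
have r0 n : 0 < rho n by rewrite invr_gt0.
have rho0 : rho n @[n --> \oo] --> 0 by exact: cvg_harmonic.
have af := @mass_average R f x (1, 1) rho cf ltr01 ltr01 r0 rho0.
have ag := @mass_average R g x (1, 1) rho cg ltr01 ltr01 r0 rho0.
have E : mass f = mass g.
  apply/funext => z; rewrite /mass /Rintegral -fE; last exact: measurable_rectangle.
  by rewrite -gE//; exact: measurable_rectangle.
rewrite E in af.
exact: (cvg_unique (@norm_hausdorff R R^o) af ag).
Qed.

Lemma M_P_tame (mu : signed_measure R) : M_P mu -> exists2 C, tame C (density mu) &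
  forall z, fine (mu (rectangle z.1 z.2)) = mass (density mu) z.
Proof.
move=> [f fd fe]; have dd : continuous_density mu (density mu).
  by apply: (xgetPex (fun=> 0)); exists f.
rewrite (continuous_density_unique fd dd) in fe.
have [C tC] := exp_decay_tame (proj1 dd) fe; exists C => // z.
by rewrite (proj2 dd)//; exact: measurable_rectangle.
Qed.

End density_of_M_P.

Section moments.
Local Open Scope ereal_scope.
Context {R : realType}.
Variables f1 f2 : R -> R.
Hypothesis mf1 : measurable_fun (`]0%R, +oo[%classic : set R) f1.
Hypothesis mf2 : measurable_fun (`]0%R, +oo[%classic : set R) f2.
Hypothesis f1_ge0 : forall u, (0 < u)%R -> (0 <= f1 u)%R.
Hypothesis f2_ge0 : forall u, (0 < u)%R -> (0 <= f2 u)%R.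
Variable F : probability (R * R)%type R.
Hypothesis FE : forall A : set (R * R), measurable A ->
  F A = \int[leb2 R]_(u in A `&` quadrant) (f1 u.1 * f2 u.2)%:E.
Local Notation leb := (@lebesgue_measure R).
Local Notation GR := (measurableTypeR R).

Lemma measurable_quadrant : measurable (quadrant : set (R * R)).
Proof. by apply: measurableX; exact: measurable_itv. Qed.

(** Independence of the two edge lengths, in the form of Tonelli's theorem. *)
Lemma ge0_integral_quadrant (g1 g2 : R -> R) :
  measurable_fun setT g1 -> measurable_fun setT g2 ->
  (forall x, 0 <= g1 x)%R -> (forall x, 0 <= g2 x)%R ->
  \int[F]_(u in quadrant) (g1 u.1 * g2 u.2)%:E =
  (\int[leb]_(x in `]0%R, +oo[) (g1 x * f1 x)%:E) *
  (\int[leb]_(x in `]0%R, +oo[) (g2 x * f2 x)%:E).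
Proof.
move=> mg1 mg2 g10 g20.
pose p := (fun u : GR * GR => f1 u.1 * f2 u.2)%R \_ (quadrant : set (GR * GR)).
have mq : measurable (quadrant : set (GR * GR)) by exact: measurable_quadrant.
have p0 u : (0 <= p u)%R.
  rewrite /p patchE; case: ifPn => //; rewrite inE => -[/=].
  by rewrite !in_itv /= !andbT => u1 u2; rewrite mulr_ge0 ?f1_ge0 ?f2_ge0.
have mp : measurable_fun setT p.
  apply/(measurable_restrictT _ mq).
  apply: measurable_funM.
    apply: (@measurable_comp _ _ _ (GR * GR)%type R R (`]0%R, +oo[%classic : set R) f1 quadrant fst) => //.
      by move=> _ [u [u1 _] <-].
    exact: measurable_funTS.
  apply: (@measurable_comp _ _ _ (GR * GR)%type R R (`]0%R, +oo[%classic : set R) f2 quadrant snd) => //.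
    by move=> _ [u [_ u2] <-].
  exact: measurable_funTS.
have mid : measurable_fun [set: R * R] (id : R * R -> GR * GR) by exact: measurable_id.
pose F' := measure_function_pushforward__canonical__measure_function_Measure F mid.
have F'E A : measurable A -> F' A = \int[leb2 R]_(u in A) (p u)%:E.
  move=> mA; have -> : F' A = F A by [].
  rewrite FE// integral_mkcondr; apply: eq_integral => u _.
  by rewrite /p restrict_EFin.
have mg : measurable_fun [set: GR * GR] (fun u => g1 u.1 * g2 u.2)%R.
  by apply: measurable_funM; exact: measurableT_comp.
pose G (u : GR * GR) : \bar R := ((fun u => (g1 u.1 * g2 u.2)%:E) \_ (quadrant : set (GR * GR))) u.
have mG : measurable_fun setT G.
  apply/(measurable_restrictT _ mq); apply: measurable_funTS; exact/measurable_EFinP.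
have G0 u : 0 <= G u.
  by rewrite /G patchE; case: ifP => // _; rewrite lee_fin mulr_ge0.
have h1 : \int[F]_(u in quadrant) (g1 u.1 * g2 u.2)%:E = \int[F']_u G u.
  rewrite ge0_integral_pushforward//=.
  by rewrite integral_mkcond.
rewrite h1 (ge0_integral_density p0 mp F'E mG G0).
have := @ge0_integral_setX _ _ GR GR R leb leb `]0%R, +oo[%classic `]0%R, +oo[%classic
  (fun x => (g1 x * f1 x)%:E) (fun x => (g2 x * f2 x)%:E).
move=> <-//; first last.
- by move=> y; rewrite /= in_itv /= andbT => y0; rewrite lee_fin mulr_ge0 ?f2_ge0.
- by move=> y; rewrite /= in_itv /= andbT => y0; rewrite lee_fin mulr_ge0 ?f1_ge0.
- by apply/measurable_EFinP; apply: measurable_funM => //; exact: measurable_funTS.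
- by apply/measurable_EFinP; apply: measurable_funM => //; exact: measurable_funTS.
rewrite [RHS]integral_mkcond; apply: eq_integral => u _.
rewrite /G /p !patchE; case: ifP => // _; last by rewrite mul0e.
by rewrite -!EFinM; congr EFin; ring.
Qed.

Lemma second_moment_quadrant :
  \int[F]_(u in quadrant) (u.1 ^+ 2 * u.2 ^+ 2)%:E =
  second_moment f1 * second_moment f2.
Proof.
rewrite (@ge0_integral_quadrant (fun x => x ^+ 2)%R (fun x => x ^+ 2)%R)//.
- by move=> x; exact: sqr_ge0.
- by move=> x; exact: sqr_ge0.
Qed.

Lemma densities_mass1 :
  (\int[leb]_(x in `]0%R, +oo[) (f1 x)%:E) *
  (\int[leb]_(x in `]0%R, +oo[) (f2 x)%:E) = 1.
Proof.
transitivity (\int[F]_(u in quadrant) (1 * 1)%:E).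
  rewrite (@ge0_integral_quadrant (cst 1%R) (cst 1%R))//.
  by congr (_ * _); apply: eq_integral => x _; rewrite mul1r.
rewrite (eq_integral (cst 1)); last by move=> u _; rewrite mul1r.
rewrite integral_cst ?mul1e//; last exact: measurable_quadrant.
rewrite /= -(probability_setT F) FE; last exact: measurable_quadrant.
by rewrite setIid FE// setTI.
Qed.

(** A zero second moment would force [f] to vanish almost everywhere. With
    [densities_mass1] this makes the normalising constant of the theorem nonzero. *)
Lemma second_moment_gt0 (f : R -> R) :
  measurable_fun (`]0%R, +oo[%classic : set R) f ->
  (forall u, (0 < u)%R -> (0 <= f u)%R) ->
  \int[leb]_(x in `]0%R, +oo[) (f x)%:E != 0 -> 0 < second_moment f.
Proof.
move=> mf f0; apply: contraNT; rewrite -leNgt => v0.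
have mD : measurable (`]0%R, +oo[%classic : set GR) by exact: measurable_itv.
have fx0 x : `]0%R, +oo[%classic x -> (0 <= f x)%R.
  by rewrite /= in_itv /= andbT; exact: f0.
have mfE : measurable_fun (`]0%R, +oo[%classic : set GR) (EFin \o f).
  exact/measurable_EFinP.
have m2 : measurable_fun (`]0%R, +oo[%classic : set GR) (fun x => (x ^+ 2 * f x)%:E).
  apply/measurable_EFinP; exact: measurable_funM.
have /(ae_eq_integral_abs leb mD m2) h : \int[leb]_(x in `]0%R, +oo[) `|(x ^+ 2 * f x)%:E| = 0.
  apply/eqP; rewrite eq_le integral_ge0// andbT; apply: le_trans v0.
  rewrite le_eqVlt; apply/orP; left; apply/eqP; apply: eq_integral => x.
  by rewrite inE => x0; rewrite gee0_abs// lee_fin mulr_ge0 ?sqr_ge0 ?fx0.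
have /(ae_eq_integral_abs leb mD mfE) : ae_eq leb `]0%R, +oo[%classic (EFin \o f) (cst 0).
  apply: filterS h => x /= h Dx; move: (h Dx) => /eqP.
  rewrite eqe mulf_eq0 expf_eq0 /= => /orP[/eqP x0|/eqP ->//].
  by move: Dx; rewrite x0 /= in_itv /= ltxx.
move=> h2; apply/eqP; rewrite -[RHS]h2; apply: eq_integral => x.
by rewrite inE => /fx0 x0 /=; rewrite ger0_norm.
Qed.

Lemma second_moments_gt0 : (0 < second_moment f1) /\ (0 < second_moment f2).
Proof.
have h := densities_mass1; split; apply: second_moment_gt0 => //; apply/eqP => h0;
  move/eqP: h; rewrite h0 ?mul0e ?mule0; apply/negP; by rewrite eq_sym onee_eq0.
Qed.

End moments.

(* A measure of the form used for the intensity. The map [f] will be the identity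
   between two copies of the same space. *)
Section scaled_image.
Local Open Scope ereal_scope.
Context d1 d2 (T1 : measurableType d1) (T2 : measurableType d2) (R : realType).
Variables (r : {nonneg R}) (m : {measure set T1 -> \bar R}) (f : T1 -> T2).
Hypothesis mf : measurable_fun setT f.

Definition scaled_image : {measure set T2 -> \bar R} :=
  measure_function_pushforward__canonical__measure_function_Measure (mscale r m) mf.

Lemma ge0_integral_scaled_image (phi : T2 -> \bar R) :
  measurable_fun setT phi -> (forall z, 0 <= phi z) ->
  \int[scaled_image]_z phi z = r%:num%:E * \int[m]_x phi (f x).
Proof.
move=> mphi phi0; rewrite ge0_integral_pushforward// preimage_setT ge0_integral_mscale//.
  exact: (measurableT_comp mphi mf).
by move=> x _; exact: phi0.
Qed.

End scaled_image.

Section intensity_measure.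
Local Open Scope ereal_scope.
Context {R : realType}.
Variables (F : probability (R * R)%type R) (lambda rho : R).
Hypothesis lambda0 : (0 <= lambda)%R.
Local Notation GR := (measurableTypeR R).
Local Notation E := ((R * R) * (R * R))%type.

Let mid : measurable_fun setT (id : (GR * GR) * (R * R) -> E).
Proof. exact: measurable_id. Qed.

Let m := product_measure1 (leb2 R) (distribution F (dilation rho)).

Definition intensity_measure : {measure set E -> \bar R} :=
  scaled_image (NngNum lambda0) m mid.

Lemma ge0_integral_intensity (phi : E -> \bar R) :
  measurable_fun setT phi -> (forall z, 0 <= phi z) ->
  \int[intensity_measure]_z phi z =
  lambda%:E * \int[product_measure1 (leb2 R) F]_z phi (z.1, dilation rho z.2).
Proof.
move=> mphi phi0.
have e1 := @ge0_integral_scaled_image _ _ _ _ R (NngNum lambda0) m _ mid phi mphi phi0.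
apply: (etrans e1).
apply: (congr1 (fun t => lambda%:E * t)%E).
have h1 := @fubini_tonelli1 _ _ (GR * GR)%type (R * R)%type R
  (sigma_finite_product (@lebesgue_measure R) (@lebesgue_measure R))
  (distribution F (dilation rho)) phi mphi phi0.
have mphi' : measurable_fun [set: (GR * GR) * (R * R)]
    (fun z => phi (z.1, dilation rho z.2)).
  apply: (measurableT_comp mphi); apply: measurable_fun_pair => //.
  exact: measurableT_comp.
have h2 := @fubini_tonelli1 _ _ (GR * GR)%type (R * R)%type R
  (sigma_finite_product (@lebesgue_measure R) (@lebesgue_measure R))
  F (fun z => phi (z.1, dilation rho z.2)) mphi' (fun z => phi0 _).
apply: (etrans h1); apply/esym/(etrans h2)/esym.
apply: eq_integral => x _; rewrite /fubini_F ge0_integral_distribution//.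
exact: (measurableT_comp mphi (measurable_pair1 x)).
Qed.

End intensity_measure.

(** * Second-order expansion under the integral sign *)

(* As [lambda n * a n ^+ 2] stays bounded at each point and [lambda n] tends to
   infinity, [a n] tends to zero, so all terms of order three or more vanish in the
   limit. *)
Section second_order.
Context d (T : measurableType d) (R : realType) (mu : {measure set T -> \bar R}).
Variables (a : (T -> R)^nat) (lambda : R^nat) (G g : T -> R).
Hypothesis ma : forall n, measurable_fun setT (a n).
Hypothesis lambda0 : forall n, 0 < lambda n.
Hypothesis lambday : lambda n @[n --> \oo] --> +oo.
Hypothesis iG : mu.-integrable setT (EFin \o G).
Hypothesis aG : forall n x, lambda n * a n x ^+ 2 <= G x.
Hypothesis ag : forall x, lambda n * a n x ^+ 2 @[n --> \oo] --> g x.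

Let lambdaV0 : (lambda n)^-1 @[n --> \oo] --> 0.
Proof. by apply/gtr0_cvgV0 => //; near=> n. Unshelve. all: by end_near. Qed.

Let sqr_a0 x : a n x ^+ 2 @[n --> \oo] --> 0.
Proof.
have : lambda n * a n x ^+ 2 * (lambda n)^-1 @[n --> \oo] --> g x * 0.
  exact: cvgM.
rewrite mulr0; apply: cvg_trans; apply: near_eq_cvg; apply: nearW => n.
by rewrite mulrAC divff ?mul1r// gt_eqF.
Qed.

Lemma cvg_integral_1Bcos :
  (\int[mu]_x (lambda n * (1 - cos (a n x)))%:E @[n --> \oo] -->
   \int[mu]_x (g x / 2)%:E)%E.
Proof.
apply: (@dominated_cvg _ _ _ mu setT measurableT
  (fun n x => (lambda n * (1 - cos (a n x)))%:E) _ (EFin \o G)) => //.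
- move=> n; apply/measurable_EFinP; apply: measurable_funM => //.
  by apply: measurable_funB => //; exact: measurable_cos.
- move=> x _; apply: cvg_EFin; first by near=> n.
  have h : (lambda n * (1 - cos (a n x)) - lambda n * a n x ^+ 2 / 2) @[n --> \oo] --> 0.
    apply/norm_cvg0P; apply: (@squeeze_cvgr _ _ _ _ (fun=> 0) (fun n =>
      lambda n * a n x ^+ 2 * a n x ^+ 2)); last 2 first.
    + exact: cvg_cst.
    + by rewrite -[X in _ --> X](mulr0 (g x)); exact: cvgM.
    apply: nearW => n; rewrite normr_ge0 /= -mulrA -mulrBr normrM gtr0_norm//.
    rewrite -mulrA ler_wpM2l ?(ltW (lambda0 n))//.
    apply: (le_trans (dist_1Bcos_sqr _)).
    by rewrite -[a n x ^+ 2]real_normK ?num_real// -exprD.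
  have h2 : lambda n * a n x ^+ 2 / 2 @[n --> \oo] --> g x / 2.
    by apply: cvgM; [exact: ag|exact: cvg_cst].
  have h3 := cvgD h h2; rewrite add0r in h3.
  rewrite (_ : fine \o _ = (fun n => lambda n * (1 - cos (a n x)) -
    lambda n * a n x ^+ 2 / 2) \+ (fun n => lambda n * a n x ^+ 2 / 2)); first exact: h3.
  by apply/funext => n /=; rewrite subrK.
- move=> n x _; rewrite lee_fin ger0_norm; last first.
    by rewrite mulr_ge0 ?(ltW (lambda0 n))// subr_ge0 cos_le1.
  apply: le_trans (aG n x); rewrite ler_wpM2l ?(ltW (lambda0 n))//.
  by apply: (le_trans (le1Bcos_sqr _)); have := sqr_ge0 (a n x); lra.
Unshelve. all: by end_near.
Qed.

Lemma cvg_integral_Bsin :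
  (\int[mu]_x (lambda n * `|a n x - sin (a n x)|)%:E @[n --> \oo] --> 0)%E.
Proof.
rewrite -[X in _ --> X](integral0 mu setT).
apply: (@dominated_cvg _ _ _ mu setT measurableT
  (fun n x => (lambda n * `|a n x - sin (a n x)|)%:E) _ (EFin \o G)) => //.
- move=> n; apply/measurable_EFinP; apply: measurable_funM => //.
  apply: measurableT_comp => //.
  by apply: measurable_funB => //; exact: measurable_sin.
- move=> x _; apply: cvg_EFin; first by near=> n.
  apply: (@squeeze_cvgr _ _ _ _ (fun=> 0) (fun n =>
      lambda n * a n x ^+ 2 * Num.sqrt (a n x ^+ 2))); last 2 first.
    + exact: cvg_cst.
    + rewrite -[X in _ --> X](mulr0 (g x)) -(sqrtr0 R); apply: cvgM => //.
      exact: (cvg_comp _ _ (sqr_a0 x) (@sqrt_continuous R 0)).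
  apply: nearW => n; rewrite mulr_ge0 ?(ltW (lambda0 n))//= -mulrA ler_wpM2l ?(ltW (lambda0 n))//.
  apply: (le_trans (dist_sin_id _)); rewrite sqrtr_sqr.
  rewrite -[X in _ <= X * _]real_normK ?num_real// -exprSr.
  by have := exprn_ge0 3 (normr_ge0 (a n x)); lra.
- move=> n x _; rewrite lee_fin ger0_norm; last by rewrite mulr_ge0 ?(ltW (lambda0 n)).
  apply: le_trans (aG n x); rewrite ler_wpM2l ?(ltW (lambda0 n))//.
  exact: dist_sin_id_sqr.
Unshelve. all: by end_near.
Qed.

End second_order.

(** * Integrals of rectangle masses against the intensity *)

Section cell.
Context {R : realType}.
Local Notation leb := (@lebesgue_measure R).
Local Notation GR := (measurableTypeR R).
Local Notation E := ((R * R) * (R * R))%type.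
Local Notation S := (@weight_mass R).

(** The integrand of [J]: the mass of the rectangle, cut off outside of the
    quadrant of edge lengths. *)
Definition cell (f : R * R -> R) : E -> R := mass f \_ (setT `*` quadrant).

Definition sqr_area : R * R -> R := (fun u => u.1 ^+ 2 * u.2 ^+ 2) \_ quadrant.

Lemma quadrantP (u : R * R) : quadrant u <-> 0 < u.1 /\ 0 < u.2.
Proof. by rewrite /quadrant /= !in_itv /= !andbT. Qed.

Lemma quadrant_dilation rho (u : R * R) : 0 < rho ->
  quadrant (dilation rho u) <-> quadrant u.
Proof. by move=> r0; rewrite !quadrantP /= !pmulr_rgt0. Qed.

Lemma sqr_area_ge0 u : 0 <= sqr_area u.
Proof. by rewrite /sqr_area patchE; case: ifP => // _; rewrite mulr_ge0// sqr_ge0. Qed.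

Lemma measurable_sqr_area : measurable_fun setT sqr_area.
Proof.
apply/(measurable_restrictT _ measurable_quadrant); apply: measurable_funTS.
by apply: measurable_funM; apply: measurable_funX; [exact: measurable_fst|exact: measurable_snd].
Qed.

Lemma cell_in f x u : quadrant u -> cell f (x, u) = mass f (x, u).
Proof. by move=> qu; rewrite /cell patchE mem_set. Qed.

Lemma cell_out f x u : ~ quadrant u -> cell f (x, u) = 0.
Proof. by move=> qu; rewrite /cell patchE memNset//= => -[]. Qed.

Lemma cell_sum n (t : 'I_n -> R) (f : 'I_n -> R * R -> R) (C : 'I_n -> R) z :
  (forall i, tame (C i) (f i)) ->
  cell (fun y => \sum_(i < n) t i * f i y) z = \sum_(i < n) t i * cell (f i) z.
Proof.
move=> tf; case: z => x u; have [qu|qu] := pselect (quadrant u).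
  rewrite cell_in// (mass_sum _ _ tf); apply: eq_bigr => i _.
  by rewrite cell_in.
by rewrite cell_out// big1// => i _; rewrite cell_out// mulr0.
Qed.

Variables (C : R) (f : R * R -> R).
Hypothesis tf : tame C f.

Lemma measurable_cell : measurable_fun setT (cell f).
Proof.
have mq : measurable ([set: R * R] `*` (quadrant : set (R * R))).
  by apply: measurableX => //; exact: measurable_quadrant.
by apply/(measurable_restrictT _ mq); apply: measurable_funTS; exact: measurable_mass tf.
Qed.

Definition cell_const : R := C ^+ 2 * segment_const ^+ 4.

Lemma cell_const_ge0 : 0 <= cell_const.
Proof. by rewrite /cell_const (exprM _ 2 2) mulr_ge0// sqr_ge0. Qed.

(** The factor [rho ^+ 4] is the one that the normalisation removes. *)
Lemma sqr_cell_le rho x u : 0 < rho ->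
  cell f (x, dilation rho u) ^+ 2 <=
  cell_const * rho ^+ 4 * (plane_weight x * sqr_area u).
Proof.
move=> r0; have [qu|qu] := pselect (quadrant u); last first.
  rewrite cell_out ?quadrant_dilation// expr0n.
  rewrite mulr_ge0//; first by rewrite mulr_ge0 ?cell_const_ge0// exprn_ge0// ltW.
  by rewrite mulr_ge0 ?plane_weight_ge0 ?sqr_area_ge0.
rewrite cell_in ?quadrant_dilation// /sqr_area patchE mem_set//.
have /quadrantP[u1 u2] := qu.
apply: (le_trans (sqr_mass_le tf _ _)); rewrite /= ?mulr_ge0 ?(ltW r0) ?(ltW u1) ?(ltW u2)//.
by rewrite le_eqVlt; apply/orP; left; apply/eqP; rewrite /cell_const; ring.
Qed.

End cell.

Section intensity_integrals.
Context {R : realType}.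
Local Notation leb := (@lebesgue_measure R).
Local Notation GR := (measurableTypeR R).
Local Notation E := ((R * R) * (R * R))%type.
Local Notation S := (@weight_mass R).
Variables (F : probability (R * R)%type R) (v : R).
Hypothesis v0 : 0 < v.
Hypothesis Fv : (\int[F]_(u in quadrant) (u.1 ^+ 2 * u.2 ^+ 2)%:E = v%:E)%E.
Local Notation M := (product_measure1 (leb2 R) F).

Lemma integral_sqr_area : (\int[F]_u (sqr_area u)%:E = v%:E)%E.
Proof.
rewrite -Fv [RHS]integral_mkcond; apply: eq_integral => u _.
by rewrite restrict_EFin.
Qed.

Lemma ge0_integral_prod_area (p : R * R -> R) : measurable_fun [set: GR * GR] p ->
  (forall x, 0 <= p x) ->
  (\int[M]_z (p z.1 * sqr_area z.2)%:E = (\int[leb2 R]_x (p x)%:E) * v%:E)%E.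
Proof.
move=> mp p0; rewrite -integral_sqr_area.
have h := @ge0_integral_prod _ _ (GR * GR)%type (R * R)%type R
  (sigma_finite_product leb leb) F (fun x => (p x)%:E) (fun u => (sqr_area u)%:E).
apply: (etrans _ (h _ _ _ _)) => //.
- by apply/measurable_EFinP.
- by apply/measurable_EFinP; exact: measurable_sqr_area.
- by move=> x; rewrite lee_fin sqr_area_ge0.
Qed.

Lemma measurable_dilate (phi : E -> R) rho : measurable_fun setT phi ->
  measurable_fun [set: (GR * GR) * (R * R)] (fun z => phi (z.1, dilation rho z.2)).
Proof.
move=> mphi; apply: (measurableT_comp mphi); apply: measurable_fun_pair => //.
exact: measurableT_comp.
Qed.

Variables (C : R) (f : R * R -> R).
Hypothesis tf : tame C f.

(** With [prm_variance_le] this bounds the variance of [J] by a multiple of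
    the square of the normalisation, uniformly in [rho]. *)
Lemma integral_sqr_cell_le lambda rho (l0 : 0 <= lambda) : 0 < rho ->
  (\int[intensity_measure F rho l0]_z (cell f z ^+ 2)%:E <=
   (lambda * (cell_const C * rho ^+ 4 * (S * S) * v))%:E)%E.
Proof.
move=> r0; rewrite ge0_integral_intensity; last 2 first.
- by apply/measurable_EFinP; apply: measurable_funX; exact: measurable_cell tf.
- by move=> z; rewrite lee_fin sqr_ge0.
have K0 : 0 <= cell_const C * rho ^+ 4 by rewrite mulr_ge0 ?cell_const_ge0// exprn_ge0// ltW.
rewrite EFinM; apply: lee_wpmul2l; first by rewrite lee_fin.
apply: (@le_trans _ _ (\int[M]_z (cell_const C * rho ^+ 4 * plane_weight z.1 * sqr_area z.2)%:E)%E).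
  apply: ge0_le_integral => //.
  - by move=> z _; rewrite lee_fin sqr_ge0.
  - apply/measurable_EFinP; apply: measurable_funX; apply: measurable_dilate.
    exact: measurable_cell tf.
  - apply/measurable_EFinP; apply: measurable_funM.
      apply: measurable_funM => //.
      exact: (measurableT_comp measurable_plane_weight measurable_fst).
    exact: (measurableT_comp measurable_sqr_area measurable_snd).
  by move=> z _; rewrite lee_fin -mulrA; exact: (sqr_cell_le tf).
rewrite (@ge0_integral_prod_area (fun x => cell_const C * rho ^+ 4 * plane_weight x)); last 2 first.
- by apply: measurable_funM => //; exact: measurable_plane_weight.
- by move=> x; rewrite mulr_ge0// plane_weight_ge0.
rewrite [in leRHS]EFinM; apply: lee_wpmul2r; first by rewrite lee_fin ltW.
under eq_integral do rewrite EFinM.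
rewrite ge0_integralZl//; last 2 first.
- by apply/measurable_EFinP; exact: measurable_plane_weight.
- by move=> x _; rewrite lee_fin plane_weight_ge0.
by rewrite integral_plane_weight -EFinM.
Qed.

Lemma integral_majorant r : 0 <= r ->
  (\int[leb]_x (majorant x r)%:E = (6 * S * r)%:E)%E.
Proof.
move=> r0.
have S0 : 0 <= S := weight_mass_ge0.
have mI : measurable (`]- r, r[%classic : set GR) by exact: measurable_itv.
transitivity (\int[leb]_x ((4 * r)%:E * (weight x)%:E + S%:E * (\1_(`]- r, r[%classic : set GR) x)%:E))%E.
  apply: eq_integral => x _; by rewrite /majorant EFinD !EFinM.
rewrite ge0_integralD//; last 4 first.
- by move=> x _; rewrite -EFinM lee_fin !mulr_ge0// ltW// weight_gt0.
- by apply: measurable_funeM; exact: measurable_weightE.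
- by move=> x _; rewrite -EFinM lee_fin mulr_ge0.
- by apply: measurable_funeM; apply/measurable_EFinP; exact: measurable_indic.
rewrite !ge0_integralZl//; last 4 first.
- by apply/measurable_EFinP; exact: measurable_indic.
- exact: measurable_weightE.
- by move=> x _; rewrite lee_fin ltW// weight_gt0.
- by rewrite lee_fin mulr_ge0.
rewrite weight_massE integral_indic// setIT.
have volE : leb (`]- r, r[%classic : set GR) = (2 * r)%:E.
  rewrite lebesgue_measure_itv /= lte_fin; case: ifPn => h.
    by rewrite -EFinB; congr EFin; ring.
  by congr EFin; move: h; rewrite -leNgt; lra.
transitivity ((4 * r)%:E * S%:E + S%:E * (2 * r)%:E)%E; first by rewrite -volE.
by rewrite -!EFinM -EFinD; congr EFin; ring.
Qed.

(** Integrate [mass_le_majorant] in [x] first: this gives a multiple of [u.1 * u.2],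
    which [1 + u.1 ^+ 2 * u.2 ^+ 2] dominates. *)
Lemma integrable_cell lambda rho (l0 : 0 <= lambda) : 0 < rho ->
  (intensity_measure F rho l0).-integrable setT (EFin \o cell f).
Proof.
move=> r0; have mc := measurable_cell tf; have [C0 _ _] := tf.
apply/integrableP; split; first exact/measurable_EFinP.
have mn : measurable_fun setT (fun z => `|(cell f z)%:E|%E).
  by apply: measurableT_comp => //; exact/measurable_EFinP.
rewrite ge0_integral_intensity//.
pose phi (z : (GR * GR) * (R * R)) := `|(cell f (z.1, dilation rho z.2))%:E|%E.
have mphi : measurable_fun setT phi.
  by apply: measurableT_comp => //; apply/measurable_EFinP; exact: measurable_dilate.
have phi0 z : (0 <= phi z)%E by exact: abse_ge0.
pose m1 := sigma_finite_product leb leb.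
have e1 := @fubini_tonelli2 _ _ (GR * GR)%type (R * R)%type R m1 F phi mphi phi0.
rewrite lte_mul_pinfty ?lee_fin//.
pose K := C * (36 * (S * S) * rho ^+ 2).
have K0 : 0 <= K.
  by rewrite /K mulr_ge0// mulr_ge0 ?sqr_ge0// mulr_ge0// mulr_ge0 ?weight_mass_ge0.
apply: (@le_lt_trans _ _ (\int[F]_u (K%:E * (1%:E + (sqr_area u)%:E)))%E); last first.
  rewrite ge0_integralZl//; last 2 first.
  - apply: emeasurable_funD => //.
    by apply/measurable_EFinP; exact: measurable_sqr_area.
  - by move=> u _; rewrite lee_fin addr_ge0 ?sqr_area_ge0.
  rewrite ge0_integralD//; last 2 first.
  - by move=> u _; rewrite lee_fin sqr_area_ge0.
  - by apply/measurable_EFinP; exact: measurable_sqr_area.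
  by rewrite integral_sqr_area integral_prob_cst -EFinD -EFinM ltry.
rewrite [leLHS](_ : _ = \int[F]_u fubini_G m1 phi u)%E; last exact: e1.
apply: ge0_le_integral => //.
- by move=> u _; apply: integral_ge0.
- exact: (@measurable_fun_fubini_tonelli_G _ _ (GR * GR)%type (R * R)%type R m1 phi mphi phi0).
- by apply: measurable_funeM; apply: emeasurable_funD => //; apply/measurable_EFinP; exact: measurable_sqr_area.
move=> u _; rewrite /fubini_G /phi /=.
have [qu|qu] := pselect (quadrant u); last first.
  rewrite integral0_eq; first by rewrite -EFinD -EFinM lee_fin mulr_ge0// addr_ge0 ?sqr_area_ge0.
  by move=> x _; rewrite cell_out ?quadrant_dilation// normr0.
have /quadrantP[u1 u2] := qu.
have ru1 : 0 <= rho * u.1 by rewrite mulr_ge0 ?ltW.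
have ru2 : 0 <= rho * u.2 by rewrite mulr_ge0 ?ltW.
have mmaj (r : R) : measurable_fun [set: GR] (fun x => (majorant x r)%:E).
  apply/measurable_EFinP; apply: measurable_funD.
    by apply: measurable_funM => //; exact: measurable_weight.
  by apply: measurable_funM => //; exact: measurable_indic.
apply: (@le_trans _ _ (\int[leb2 R]_x (C%:E * ((majorant x.1 (rho * u.1))%:E * (majorant x.2 (rho * u.2))%:E)))%E).
  apply: (@ge0_le_integral _ (GR * GR)%type R (leb2 R)) => //.
  - apply/measurable_EFinP; apply: measurableT_comp => //.
    have mcu : measurable_fun [set: R * R] (fun x => cell f (x, dilation rho u)).
      by apply: (measurableT_comp mc); exact: measurable_fun_pair.
    exact: mcu.
  - apply: measurable_funeM; apply: emeasurable_funM; exact: (measurableT_comp (mmaj _)).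
  move=> x _; rewrite cell_in ?quadrant_dilation// lee_fin.
  exact: (mass_le_majorant (z := (x, dilation rho u)) tf).
have j (x r : R) : 0 <= r -> (0 <= (majorant x r)%:E)%E by move=> ?; rewrite lee_fin majorant_ge0.
rewrite ge0_integralZl//; last 2 first.
- apply: emeasurable_funM; exact: (measurableT_comp (mmaj _)).
- by move=> x _; rewrite mule_ge0// j.
have e2 := @ge0_integral_prod _ _ GR GR R leb leb _ _ (mmaj (rho * u.1)) (mmaj (rho * u.2))
  (fun x => j _ _ ru1) (fun x => j _ _ ru2).
have -> : (K%:E * (1 + (sqr_area u)%:E) = (K * (1 + sqr_area u))%:E)%E by [].
rewrite e2 !integral_majorant// -!EFinM lee_fin /sqr_area patchE mem_set//.
have -> : C * (6 * S * (rho * u.1) * (6 * S * (rho * u.2))) = K * (u.1 * u.2) by rewrite /K; ring.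
by apply: ler_wpM2l => //; have := sqr_ge0 (u.1 * u.2 - 1); have := mulr_gt0 u1 u2; nra.
Qed.

End intensity_integrals.

(** * The limit along a sequence *)

Section poisson_mean.
Local Open Scope ereal_scope.
Context d (Om : measurableType d) (R : realType) (P : probability Om R).
Context d' (E : measurableType d') (nu : {measure set E -> \bar R}).
Variable N : R.-ker Om ~> E.
Hypothesis NP : is_poisson_random_measure P nu N.

(** Campbell's formula for signed integrands, from that for the positive and
    negative parts. *)
Lemma prm_mean (h : E -> R) : nu.-integrable setT (EFin \o h) ->
  \int[P]_w (\int[N w]_z h z)%:E = (\int[nu]_z h z)%R%:E.
Proof.
move=> ih; have mh := measurable_int _ ih; have mhR := (measurable_EFinP _ _).1 mh.
have mp := measurable_funepos mh; have mn := measurable_funeneg mh.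
pose Ap w := \int[N w]_z ((EFin \o h)^\+ z); pose An w := \int[N w]_z ((EFin \o h)^\- z).
have mAp : measurable_fun setT Ap by apply: measurable_kernel_integral => // z; exact: funepos_ge0.
have mAn : measurable_fun setT An by apply: measurable_kernel_integral => // z; exact: funeneg_ge0.
have EAp : \int[P]_w Ap w = \int[nu]_z ((EFin \o h)^\+ z).
  by apply: (campbell NP mp) => z; exact: funepos_ge0.
have EAn : \int[P]_w An w = \int[nu]_z ((EFin \o h)^\- z).
  by apply: (campbell NP mn) => z; exact: funeneg_ge0.
have iAp : P.-integrable setT Ap.
  apply/integrableP; split => //; under eq_integral => w _ do rewrite gee0_abs ?integral_ge0//.
  by rewrite EAp; have /integrableP[_] := integrable_funepos measurableT ih;
    under eq_integral => z _ do rewrite gee0_abs ?funepos_ge0//.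
have iAn : P.-integrable setT An.
  apply/integrableP; split => //; under eq_integral => w _ do rewrite gee0_abs ?integral_ge0//.
  by rewrite EAn; have /integrableP[_] := integrable_funeneg measurableT ih;
    under eq_integral => z _ do rewrite gee0_abs ?funeneg_ge0//.
transitivity (\int[P]_w (Ap w - An w)).
  apply: ae_eq_integral => //.
  - by apply/measurable_EFinP; exact: measurable_kernel_Rintegral.
  - exact: emeasurable_funB.
  apply: filterS (integrable_prm NP ih) => w iw _.
  rewrite /Rintegral fineK; last exact: integrable_fin_num.
  by rewrite integralE.
by rewrite integralB// EAp EAn -integralE /Rintegral fineK//; exact: integrable_fin_num.
Qed.

End poisson_mean.

Section quadratic_form.
Context d (T : measurableType d) (R : realType) (mu : {measure set T -> \bar R}).
Variables (n : nat) (h : 'I_n -> T -> R).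
Hypothesis ih : forall i j, mu.-integrable setT (EFin \o (fun x => h i x * h j x)).

(** Used both for the variance of a linear combination of the limit field and for
    the squared [L^2] norm of a linear combination of densities, which are
    thereby identified. *)
Lemma integrable_Rintegral_sqr_sum (t : 'I_n -> R) :
  mu.-integrable setT (EFin \o (fun x => (\sum_(i < n) t i * h i x) ^+ 2)) /\
  \int[mu]_x ((\sum_(i < n) t i * h i x) ^+ 2) =
  \sum_(i < n) t i * \sum_(j < n) t j * \int[mu]_x (h i x * h j x).
Proof.
have E : (fun x => (\sum_(i < n) t i * h i x) ^+ 2) =
    (fun x => \sum_(i < n) t i * (\sum_(j < n) t j * (h i x * h j x))).
  apply/funext => x; rewrite expr2 mulr_suml; apply: eq_bigr => i _.
  rewrite -mulrA mulr_sumr; congr (_ * _); apply: eq_bigr => j _; ring.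
have h2 i := integrable_Rintegral_sum measurableT t (ih i).
have [h3 h4] := integrable_Rintegral_sum measurableT t (fun i => (h2 i).1).
rewrite E; split => //; rewrite h4; apply: eq_bigr => i _; congr (_ * _).
exact: (h2 i).2.
Qed.

End quadratic_form.

Section cell_limit.
Context {R : realType}.
Local Notation leb := (@lebesgue_measure R).
Local Notation GR := (measurableTypeR R).
Local Notation E := ((R * R) * (R * R))%type.
Local Notation S := (@weight_mass R).
Variables (F : probability (R * R)%type R) (v : R).
Hypothesis v0 : 0 < v.
Hypothesis Fv : (\int[F]_(u in quadrant) (u.1 ^+ 2 * u.2 ^+ 2)%:E = v%:E)%E.
Local Notation M := (product_measure1 (leb2 R) F).
Variables (rho lambda : R^nat).
Hypothesis rho_gt0 : forall n, 0 < rho n.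
Hypothesis rho_cvg : rho n @[n --> \oo] --> 0.
Hypothesis lambda_gt0 : forall n, 0 < lambda n.
Hypothesis lambda_cvg : lambda n @[n --> \oo] --> +oo.

Definition scaling (l r : R) : R := r ^+ 2 * Num.sqrt (l * v).

Lemma scaling_gt0 l r : 0 < l -> 0 < r -> 0 < scaling l r.
Proof. by move=> l0 r0; rewrite mulr_gt0 ?exprn_gt0// sqrtr_gt0 mulr_gt0. Qed.

Lemma sqr_scaling l r : 0 < l -> scaling l r ^+ 2 = r ^+ 4 * l * v.
Proof. by move=> l0; rewrite /scaling exprMn sqr_sqrtr ?mulr_ge0 ?ltW//; ring. Qed.

Let nu n := intensity_measure F (rho n) (ltW (lambda_gt0 n)).
Let sc n := scaling (lambda n) (rho n).

Let sc_gt0 n : 0 < sc n. Proof. exact: scaling_gt0. Qed.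

Section one_density.
Variables (C : R) (f : R * R -> R).
Hypothesis tf : tame C f.

Let a n (z : (GR * GR) * (R * R)) := cell f (z.1, dilation (rho n) z.2) / sc n.

Let ma n : measurable_fun setT (a n).
Proof.
by apply: measurable_funM => //; apply: measurable_dilate; exact: measurable_cell tf.
Qed.

Let G (z : (GR * GR) * (R * R)) := cell_const C / v * plane_weight z.1 * sqr_area z.2.

Let aG n z : lambda n * a n z ^+ 2 <= G z.
Proof.
rewrite /a exprMn exprVn sqr_scaling// mulrA.
have l0 := lambda_gt0 n; have r0 := rho_gt0 n.
have r4 : 0 < rho n ^+ 4 by rewrite exprn_gt0.
rewrite ler_pdivrMr; last by rewrite !mulr_gt0.
rewrite [leRHS](_ : _ = lambda n * (cell_const C * rho n ^+ 4 * (plane_weight z.1 * sqr_area z.2))).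
  by apply: ler_wpM2l; [exact: ltW|exact: (sqr_cell_le tf)].
by rewrite /G; field; rewrite gt_eqF.
Qed.

Let iG : M.-integrable setT (EFin \o G).
Proof.
apply/(@integrableP _ ((GR * GR) * (R * R))%type); split.
  apply/measurable_EFinP; apply: measurable_funM.
    apply: measurable_funM => //.
    exact: (measurableT_comp measurable_plane_weight measurable_fst).
  exact: (measurableT_comp measurable_sqr_area measurable_snd).
have K0 : 0 <= cell_const C / v by rewrite divr_ge0 ?cell_const_ge0// ltW.
under eq_integral => z _.
  rewrite gee0_abs; last first.
    by rewrite lee_fin mulr_ge0 ?sqr_area_ge0// mulr_ge0// plane_weight_ge0.
  over.
rewrite (ge0_integral_prod_area Fv (p := fun x => cell_const C / v * plane_weight x)); last 2 first.
- by apply: measurable_funM => //; exact: measurable_plane_weight.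
- by move=> x; rewrite mulr_ge0// plane_weight_ge0.
under eq_integral do rewrite EFinM.
rewrite ge0_integralZl//; last 2 first.
- by apply/measurable_EFinP; exact: measurable_plane_weight.
- by move=> x _; rewrite lee_fin plane_weight_ge0.
by rewrite integral_plane_weight -!EFinM ltry.
Qed.

Let g (z : (GR * GR) * (R * R)) := f z.1 ^+ 2 / v * sqr_area z.2.

(* [mass_average], squared and multiplied by [u.1 ^+ 2 * u.2 ^+ 2 / v]. *)
Let ag z : lambda n * a n z ^+ 2 @[n --> \oo] --> g z.
Proof.
case: z => x u; rewrite /g /=; have [qu|qu] := pselect (quadrant u); last first.
  rewrite /sqr_area patchE memNset// mulr0.
  rewrite (_ : (fun n => _) = cst 0); first exact: cvg_cst.
  apply/funext => n; rewrite /a cell_out ?quadrant_dilation//.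
  by rewrite mul0r expr0n mulr0.
have /quadrantP[u1 u2] := qu.
have [_ cf _] := tf.
have h := @mass_average R f x u rho cf u1 u2 rho_gt0 rho_cvg.
rewrite /sqr_area patchE mem_set//.
rewrite (_ : (fun n => _) = (fun n => (mass f (x, dilation (rho n) u) /
  (rho n ^+ 2 * (u.1 * u.2))) ^+ 2 / v * (u.1 ^+ 2 * u.2 ^+ 2))).
  by apply: cvgM; [apply: cvgM; [exact: (cvg_comp _ _ h (@exprn_continuous R 2 _))|exact: cvg_cst]|exact: cvg_cst].
apply/funext => n; rewrite /a cell_in ?quadrant_dilation// exprMn exprVn sqr_scaling//.
have := rho_gt0 n; have := lambda_gt0 n => l0 r0.
by field; rewrite !gt_eqF.
Qed.

Let nuE (phi : R -> R) n : measurable_fun setT phi -> (forall x, 0 <= phi x) ->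
  (\int[nu n]_z (phi ((sc n)^-1 * cell f z))%:E =
   \int[M]_z (lambda n * phi (a n z))%:E)%E.
Proof.
move=> mphi phi0; rewrite ge0_integral_intensity; last 2 first.
- apply/measurable_EFinP; apply: (measurableT_comp mphi).
  by apply: measurable_funM => //; exact: measurable_cell tf.
- by move=> z; rewrite lee_fin.
transitivity ((lambda n)%:E * \int[M]_z (phi (a n z))%:E)%E.
  by congr (_ * _)%E; apply: eq_integral => z _; rewrite mulrC.
have mphia : measurable_fun setT (fun z => (phi (a n z))%:E).
  by apply/measurable_EFinP; exact: (measurableT_comp mphi (ma n)).
have l0 : (0 <= (lambda n)%:E)%E by rewrite lee_fin ltW.
have phia0 z : setT z -> (0 <= (phi (a n z))%:E)%E by rewrite lee_fin.
have e := @ge0_integralZl _ ((GR * GR) * (R * R))%type R M setT measurableT _ mphia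
  (lambda n)%:E phia0 l0.
exact/esym/e.
Qed.

Lemma cvg_cell_1Bcos :
  (\int[nu n]_z (1 - cos ((sc n)^-1 * cell f z))%:E @[n --> \oo] -->
   \int[leb2 R]_x (f x ^+ 2 / 2)%:E)%E.
Proof.
rewrite (_ : (fun n => _) = (fun n => \int[M]_z (lambda n * (1 - cos (a n z)))%:E)%E).
  have -> : (\int[leb2 R]_x (f x ^+ 2 / 2)%:E = \int[M]_z (g z / 2)%:E)%E.
    have [_ cf _] := tf.
    have mf := tame_measurable tf.
    have mf2 : measurable_fun [set: GR * GR] (fun x => (f x ^+ 2 / 2)%:E).
      by apply/measurable_EFinP; apply: measurable_funM => //; exact: measurable_funX.
    have f20 x : 0 <= f x ^+ 2 / 2 by rewrite divr_ge0// sqr_ge0.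
    have h := @ge0_integral_prod_area _ F v Fv (fun x => v^-1 * (f x ^+ 2 / 2)).
    transitivity (\int[M]_z (v^-1 * (f z.1 ^+ 2 / 2) * sqr_area z.2)%:E)%E; last first.
      by apply: eq_integral => z _; rewrite /g; congr EFin; field; rewrite gt_eqF.
    rewrite h; last 2 first.
    - apply: measurable_funM => //; exact/measurable_EFinP.
    - by move=> x; rewrite mulr_ge0// invr_ge0 ltW.
    under [in RHS]eq_integral do rewrite EFinM.
    rewrite (@ge0_integralZl _ (GR * GR)%type R (leb2 R))//; last 2 first.
    - by move=> x _; rewrite lee_fin.
    - by rewrite lee_fin invr_ge0 ltW.
    by rewrite muleAC -EFinM mulVf ?gt_eqF// mul1e.
  exact: (cvg_integral_1Bcos ma lambda_gt0 lambda_cvg iG aG ag).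
apply/funext => n; apply: (@nuE (fun x => 1 - cos x)).
  by apply: measurable_funB => //; exact: measurable_cos.
by move=> x; rewrite subr_ge0 cos_le1.
Qed.

Lemma cvg_cell_Bsin :
  (\int[nu n]_z `|(sc n)^-1 * cell f z - sin ((sc n)^-1 * cell f z)|%:E @[n --> \oo] --> 0)%E.
Proof.
rewrite (_ : (fun n => _) = (fun n => \int[M]_z (lambda n * `|a n z - sin (a n z)|)%:E)%E).
  exact: (cvg_integral_Bsin ma lambda_gt0 lambda_cvg iG aG ag).
apply/funext => n; apply: (@nuE (fun x => `|x - sin x|)) => //.
apply: measurableT_comp => //.
by apply: measurable_funB => //; exact: measurable_sin.
Qed.

Lemma cvg_cell_cosB1 : (leb2 R).-integrable setT (EFin \o (fun x => f x ^+ 2)) ->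
  \int[nu n]_z (cos ((sc n)^-1 * cell f z) - 1) @[n --> \oo] -->
  - ((\int[leb2 R]_x (f x ^+ 2)) / 2).
Proof.
move=> if2.
rewrite (_ : (fun n => _) = (fun n => - fine (\int[nu n]_z (1 - cos ((sc n)^-1 * cell f z))%:E)%E)).
  have h := cvg_cell_1Bcos; apply: cvgN.
  have if3 := integrableZr measurableT 2^-1 if2.
  have E2 : (\int[leb2 R]_x (f x ^+ 2 / 2)%:E = ((\int[leb2 R]_x (f x ^+ 2)) / 2)%:E)%E.
    rewrite -(RintegralZr 2^-1 measurableT if2) /Rintegral fineK//.
    exact: (@integrable_fin_num _ (GR * GR)%type _ _ _ measurableT _ if3).
  by rewrite E2 in h; move/fine_cvgP : h => [].
apply/funext => n; rewrite /Rintegral -fineN -integral_ge0N; last first.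
  by move=> z _; rewrite lee_fin subr_ge0 cos_le1.
by congr fine; apply: eq_integral => z _; rewrite -EFinN opprB.
Qed.

Lemma cvg_cell_sinB :
  \int[nu n]_z sin ((sc n)^-1 * cell f z) - (sc n)^-1 * \int[nu n]_z cell f z
    @[n --> \oo] --> 0.
Proof.
have ic n : (nu n).-integrable setT (EFin \o cell f) by exact: (integrable_cell Fv tf).
have isc n : (nu n).-integrable setT (EFin \o (fun z => (sc n)^-1 * cell f z)).
  exact: (integrableZl measurableT (sc n)^-1 (ic n)).
have msin n : measurable_fun setT (fun z => sin ((sc n)^-1 * cell f z)).
  by apply: measurable_sin; apply: measurable_funM => //; exact: measurable_cell tf.
have isin n : (nu n).-integrable setT (EFin \o (fun z => sin ((sc n)^-1 * cell f z))).
  apply: (le_integrable measurableT _ _ (isc n)); first exact/measurable_EFinP.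
  by move=> z _; rewrite lee_fin; exact: abs_sin_le.
have h := cvg_cell_Bsin; move/fine_cvgP : h => [_ h].
apply/norm_cvg0P; apply: (squeeze_cvgr _ (cvg_cst 0) h); apply: nearW => n.
rewrite normr_ge0 /= -RintegralZl// -RintegralB//.
have iB : (nu n).-integrable setT (EFin \o
    (fun z => sin ((sc n)^-1 * cell f z) - (sc n)^-1 * cell f z)).
  exact: (integrableB measurableT (isin n) (isc n)).
have h3 := le_normr_Rintegral measurableT iB; apply: (le_trans h3).
rewrite le_eqVlt; apply/orP; left; apply/eqP.
by congr fine; apply: eq_integral => z _; rewrite distrC.
Qed.

Variables (dOm : nat -> measure_display) (Om : forall n, measurableType (dOm n)).
Variables (P : forall n, probability (Om n) R) (N : forall n, R.-ker (Om n) ~> E).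
Hypothesis NP : forall n, is_poisson_random_measure (P n) (nu n) (N n).

(** The modulus and the phase given by [prm_cosZ] converge separately; the phase
    is [b] in the limit because the centring removes the first-order term. *)
Lemma cvg_char_cell b : (leb2 R).-integrable setT (EFin \o (fun x => f x ^+ 2)) ->
  \int[P n]_w cos ((sc n)^-1 * (\int[N n w]_z cell f z) +
     (b - (sc n)^-1 * \int[nu n]_z cell f z)) @[n --> \oo] -->
  expR (- ((\int[leb2 R]_x (f x ^+ 2)) / 2)) * cos b.
Proof.
move=> if2.
have ic n : (nu n).-integrable setT (EFin \o cell f) by exact: (integrable_cell Fv tf).
rewrite (_ : (fun n => _) = (fun n =>
  expR (\int[nu n]_z (cos ((sc n)^-1 * cell f z) - 1)) *
  cos ((\int[nu n]_z sin ((sc n)^-1 * cell f z) - (sc n)^-1 * \int[nu n]_z cell f z) + b))).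
  apply: cvgM.
    exact: (cvg_comp _ _ (cvg_cell_cosB1 if2) (@continuous_expR R _)).
  have h : (\int[nu n]_z sin ((sc n)^-1 * cell f z) - (sc n)^-1 * \int[nu n]_z cell f z) + b
      @[n --> \oo] --> 0 + b.
    by apply: cvgD; [exact: cvg_cell_sinB|exact: cvg_cst].
  rewrite -{2}(add0r b).
  exact: (cvg_comp _ _ h (@continuous_cos R _)).
apply/funext => n; rewrite {1}/Rintegral (prm_cosZ (NP n) (sc n)^-1 _ (ic n)).
rewrite [LHS](_ : _ = expR (\int[nu n]_z (cos ((sc n)^-1 * cell f z) - 1)) *
  cos (\int[nu n]_z sin ((sc n)^-1 * cell f z) +
    (b - (sc n)^-1 * \int[nu n]_z cell f z)))//.
by rewrite addrA addrAC.
Qed.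

End one_density.

Section family.
Variables (m : nat) (C : 'I_m -> R) (f : 'I_m -> R * R -> R).
Hypothesis tf : forall i, tame (C i) (f i).
Variables (dOm : nat -> measure_display) (Om : forall n, measurableType (dOm n)).
Variables (P : forall n, probability (Om n) R) (N : forall n, R.-ker (Om n) ~> E).
Hypothesis NP : forall n, is_poisson_random_measure (P n) (nu n) (N n).

Definition scaled_J n i w : R :=
  (\int[N n w]_z cell (f i) z - \int[nu n]_z cell (f i) z) / sc n.

Arguments scaled_J : clear implicits.

Lemma measurable_scaled_J n i : measurable_fun setT (scaled_J n i).
Proof.
apply: measurable_funM; last exact: measurable_cst.
apply: measurable_funB; last exact: measurable_cst.
by apply: measurable_kernel_Rintegral; exact: measurable_cell (tf i).
Qed.

Lemma sqr_scaled_J_le n i :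
  (\int[P n]_w (scaled_J n i w ^+ 2)%:E <= (cell_const (C i) * (S * S))%:E)%E.
Proof.
have l0 := lambda_gt0 n; have r0 := rho_gt0 n.
have ic := integrable_cell Fv (tf i) (ltW l0) r0.
have h := prm_variance_le (NP n) ic (integral_sqr_cell_le v0 Fv (tf i) (ltW l0) r0).
under eq_integral do rewrite /scaled_J exprMn exprVn EFinM.
rewrite ge0_integralZr//; last 3 first.
- apply/measurable_EFinP; apply: measurable_funX.
  apply: measurable_funB; last exact: measurable_cst.
  by apply: measurable_kernel_Rintegral; exact: measurable_cell (tf i).
- by move=> w _; rewrite lee_fin sqr_ge0.
- by rewrite lee_fin invr_ge0 sqr_ge0.
apply: (le_trans (lee_wpmul2r _ h)); first by rewrite lee_fin invr_ge0 sqr_ge0.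
rewrite -EFinM lee_fin sqr_scaling// le_eqVlt; apply/orP; left; apply/eqP.
by field; rewrite !gt_eqF.
Qed.

Lemma tame_mul_integrable i j : (leb2 R).-integrable setT (EFin \o (fun x => f i x * f j x)).
Proof.
have [Ci0 _ fi] := tf i; have [Cj0 _ fj] := tf j.
have iw := @integrableZl _ (GR * GR)%type R (leb2 R) setT measurableT (C i * C j) _ (@integrable_plane_weight R).
apply: (@le_integrable _ (GR * GR)%type R (leb2 R) setT measurableT _ _ _ _ iw).
  by apply/measurable_EFinP; apply: measurable_funM; apply: tame_measurable (tf _).
move=> x _; rewrite lee_fin /= normrM.
apply: (@le_trans _ _ ((C i * plane_weight x) * (C j * plane_weight x))); first exact: ler_pM.
have w0 := plane_weight_ge0 x.
have w1 : plane_weight x <= 1.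
  by rewrite /plane_weight mulr_ile1 ?weight_le1// ltW// weight_gt0.
rewrite [leRHS]ger0_norm; last by rewrite mulr_ge0// mulr_ge0.
by rewrite mulrACA ler_wpM2l ?mulr_ge0// ler_piMr.
Qed.

(** By linearity a combination of the [scaled_J] is, almost surely, the one for the
    combined density. *)
Lemma cvg_char_scaled_J (t : 'I_m -> R) b :
  \int[P n]_w cos (\sum_i t i * scaled_J n i w + b) @[n --> \oo] -->
  expR (- ((\int[leb2 R]_x ((\sum_i t i * f i x) ^+ 2)) / 2)) * cos b.
Proof.
pose ft y := \sum_(i < m) t i * f i y.
have tft : tame (\sum_(i < m) `|t i| * C i) ft by exact: tame_sum.
have ic n i : (nu n).-integrable setT (EFin \o cell (f i)).
  exact: (integrable_cell Fv (tf i)).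
have if2 := (@integrable_Rintegral_sqr_sum _ (GR * GR)%type R (leb2 R) m f tame_mul_integrable t).1.
have h := @cvg_char_cell _ _ tft _ _ _ _ NP b if2.
rewrite (_ : (fun n => _) = (fun n => \int[P n]_w cos ((sc n)^-1 * (\int[N n w]_z cell ft z) +
     (b - (sc n)^-1 * \int[nu n]_z cell ft z)))); first exact: h.
apply/funext => n.
have cE : cell ft = (fun z => \sum_(i < m) t i * cell (f i) z).
  by apply/funext => z; exact: (cell_sum _ _ tf).
have nE : \int[nu n]_z cell ft z = \sum_(i < m) t i * \int[nu n]_z cell (f i) z.
  by rewrite cE; exact: (integrable_Rintegral_sum measurableT t (ic n)).2.
congr fine; apply: ae_eq_integral => //.
- apply/measurable_EFinP; apply: measurable_cos; apply: measurable_funD => //.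
  by apply: measurable_sum => i; apply: measurable_funM => //; exact: measurable_scaled_J.
- apply/measurable_EFinP; apply: measurable_cos; apply: measurable_funD => //.
  apply: measurable_funM; first exact: measurable_cst.
  by apply: measurable_kernel_Rintegral; exact: measurable_cell tft.
have hN : {ae P n, forall w, forall i, (N n w).-integrable setT (EFin \o cell (f i))}.
  by apply: filter_forall => i; exact: (integrable_prm (NP n) (ic n i)).
apply: filterS hN => w iN _; congr (EFin (cos _)).
rewrite nE cE (integrable_Rintegral_sum measurableT t iN).2.
rewrite [RHS]addrCA -mulrBr -sumrB mulr_sumr [LHS]addrC; congr (_ + _).
apply: eq_bigr => i _; rewrite /scaled_J; ring.
Qed.

Variables (dX : measure_display) (OmX : measurableType dX) (Q : probability OmX R).
Variable X : 'I_m -> OmX -> R.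
Hypothesis mX : forall i, measurable_fun setT (X i).
Hypothesis iX : forall i, Q.-integrable setT (EFin \o (fun w => X i w ^+ 2)).
Hypothesis XE : forall i j,
  \int[Q]_w (X i w * X j w) = \int[leb2 R]_x (f i x * f j x).
Hypothesis X_char : forall (t : 'I_m -> R) b,
  \int[Q]_w cos (\sum_i t i * X i w + b) =
  expR (- ((\int[Q]_w ((\sum_i t i * X i w) ^+ 2)) / 2)) * cos b.

Lemma cvg_scaled_J (g : 'rV[R]_m -> R) (B : R) : continuous g ->
  (forall x, `|g x| <= B) ->
  \int[P n]_w g (\row_i scaled_J n i w) @[n --> \oo] --> \int[Q]_w g (\row_i X i w).
Proof.
move=> cg gB.
have iXX i j : Q.-integrable setT (EFin \o (fun w => X i w * X j w)).
  have i2 := integrableD measurableT (iX i) (iX j).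
  apply: (le_integrable measurableT _ _ i2).
    by apply/measurable_EFinP; exact: measurable_funM.
  move=> w _; rewrite lee_fin /= normrM [leRHS]ger0_norm ?addr_ge0 ?sqr_ge0//.
  rewrite -(real_normK (num_real (X i w))) -(real_normK (num_real (X j w))).
  by have := sqr_ge0 (`|X i w| - `|X j w|); nra.
have K0 i : 0 <= cell_const (C i) * (S * S).
  by rewrite mulr_ge0 ?cell_const_ge0// mulr_ge0 ?weight_mass_ge0.
have X0 i : 0 <= \int[Q]_w (X i w ^+ 2) by apply: Rintegral_ge0 => w _; exact: sqr_ge0.
have sumle (y : 'I_m -> R) j : (forall i, 0 <= y i) -> y j <= \sum_i y i.
  by move=> y0; rewrite (bigD1 j)//= lerDl sumr_ge0.
apply: (@cramer_wold R m _ _ P scaled_J _ _ Q X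
  (\sum_i (cell_const (C i) * (S * S) + \int[Q]_w (X i w ^+ 2)))) cg gB => //.
- exact: measurable_scaled_J.
- move=> n i; apply: (le_trans (sqr_scaled_J_le n i)); rewrite lee_fin.
  apply: le_trans (sumle (fun j => cell_const (C j) * (S * S) + _) i _); rewrite ?lerDl//.
  by move=> j; rewrite addr_ge0.
- move=> i; rewrite -[leLHS]fineK; last exact: (integrable_fin_num measurableT (iX i)).
  rewrite lee_fin.
  apply: le_trans (sumle (fun j => _ + \int[Q]_w (X j w ^+ 2)) i _); rewrite ?lerDr//.
  by move=> j; rewrite addr_ge0.
move=> t b; rewrite X_char.
have -> : \int[Q]_w ((\sum_i t i * X i w) ^+ 2) = \int[leb2 R]_x ((\sum_i t i * f i x) ^+ 2).
  rewrite (integrable_Rintegral_sqr_sum iXX t).2.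
  rewrite (@integrable_Rintegral_sqr_sum _ (GR * GR)%type R (leb2 R) m f tame_mul_integrable t).2.
  by apply: eq_bigr => i _; congr (_ * _); apply: eq_bigr => j _; rewrite XE.
exact: cvg_char_scaled_J.
Qed.

End family.

End cell_limit.

Lemma bounded_expectation d (T : measurableType d) (R : realType) (P : probability T R)
    (h : T -> R) (B : R) : measurable_fun setT h -> (forall w, `|h w| <= B) ->
  ('E_P[h] = (\int[P]_w h w)%:E)%E.
Proof.
move=> mh hB; rewrite unlock /Rintegral fineK//; apply: integrable_fin_num => //.
apply: measurable_bounded_integrable => //; first by rewrite (le_lt_trans (probability_le1 _ measurableT)) ?ltry.
exists B; split; first exact: num_real.
by move=> M BM x _; apply: (le_trans (hB x)); exact: ltW.
Qed.

(** * The limit field and the theorem *)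

Section limit_field.
Context {R : realType} d (Om : measurableType d) (Q : probability Om R).
Variable X : signed_measure R -> {RV Q >-> R}.
Hypothesis X_field : is_centred_gaussian_linear_field X.
Hypothesis X_cov : forall mu nu, M_P mu -> M_P nu ->
  covariance Q (X mu) (X nu) = cov_X mu nu.

Lemma field_sqr_integrable mu : M_P mu -> Q.-integrable setT (EFin \o (fun w => X mu w ^+ 2)).
Proof.
move=> Pmu.
have g := field_gaussian X_field (fun=> 1) (n := 1) (mu := fun=> mu) (fun=> Pmu).
have E : (fun w => \sum_(i < 1) 1 * X mu w) = X mu.
  by apply/funext => w; rewrite big_ord1 mul1r.
rewrite E in g; exact: gaussian_sqr_integrable g.
Qed.

Lemma field_mean mu : M_P mu -> \int[Q]_w X mu w = 0.
Proof.
by move=> Pmu; have := field_centred X_field Pmu; rewrite unlock /Rintegral => ->.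
Qed.

Lemma field_product mu nu : M_P mu -> M_P nu ->
  \int[Q]_w (X mu w * X nu w) = \int[leb2 R]_x (density mu x * density nu x).
Proof.
move=> Pmu Pnu; rewrite /Rintegral -[in RHS]/(cov_X mu nu) -X_cov// unlock.
rewrite (field_centred X_field Pmu) (field_centred X_field Pnu) unlock.
by congr fine; apply: eq_integral => w _; rewrite mulrfctE /= !subr0.
Qed.

Lemma field_char n (mu : 'I_n -> signed_measure R) (t : 'I_n -> R) b :
  (forall i, M_P (mu i)) ->
  \int[Q]_w cos (\sum_i t i * X (mu i) w + b) =
  expR (- ((\int[Q]_w ((\sum_i t i * X (mu i) w) ^+ 2)) / 2)) * cos b.
Proof.
move=> Pmu.
have mV : measurable_fun setT (fun w => \sum_(i < n) t i * X (mu i) w).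
  by apply: measurable_sum => i; exact: measurable_funM.
pose V : {RV Q >-> R} := HB.pack (fun w => \sum_(i < n) t i * X (mu i) w)
  (isMeasurableFun.Build _ _ _ _ _ mV).
have gV : is_gaussian Q V by exact: field_gaussian.
apply: (gaussian_cos b gV).
have iX i : Q.-integrable setT (EFin \o X (mu i)).
  have i1 := integrableD measurableT (finite_measure_integrable_cst Q 1 measurableT)
    (field_sqr_integrable (Pmu i)).
  apply: (le_integrable measurableT _ _ i1); first exact/measurable_EFinP.
  move=> w _; rewrite lee_fin [leRHS]ger0_norm ?addr_ge0 ?sqr_ge0//=.
  by rewrite ler_norml; apply/andP; split; nra.
rewrite (integrable_Rintegral_sum measurableT t iX).2 big1// => i _.
by rewrite field_mean// mulr0.
Qed.

End limit_field.

Theorem theorem9 (R : realType)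
    (f1 f2 : R -> R)
    (mf1 : measurable_fun (`]0, +oo[ : set R) f1) (mf2 : measurable_fun (`]0, +oo[ : set R) f2)
    (f1_ge0 : forall u, 0 < u -> 0 <= f1 u)
    (f2_ge0 : forall u, 0 < u -> 0 <= f2 u)
    (F : probability (R * R)%type R)
    (F_density : forall A : set (R * R), measurable A ->
       F A = (\int[leb2 R]_(u in A `&` quadrant) (f1 u.1 * f2 u.2)%:E)%E)
    (v1_fin : (second_moment f1 < +oo)%E) (v2_fin : (second_moment f2 < +oo)%E)
    (lambda : R -> R) (lambda_gt0 : forall rho, 0 < rho -> 0 < lambda rho)
    (lambda_cvg : lambda rho @[rho --> 0^'+] --> +oo)
    (dOm : R -> measure_display) (Om : forall rho, measurableType (dOm rho))
    (P : forall rho, probability (Om rho) R)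
    (N : forall rho, R.-ker (Om rho) ~> ((R * R) * (R * R))%type)
    (N_poisson : forall rho, 0 < rho ->
       is_poisson_random_measure (P rho) (intensity F (lambda rho) rho) (N rho))
    (dX : measure_display) (OmX : measurableType dX) (Q : probability OmX R)
    (X : signed_measure R -> {RV Q >-> R})
    (X_field : is_centred_gaussian_linear_field X)
    (X_cov : forall mu nu, M_P mu -> M_P nu ->
       covariance Q (X mu) (X nu) = cov_X mu nu) :
  cvg_fdd M_P P
    (fun rho mu w => J_centred (P rho) (N rho) mu w /
       (rho ^+ 2 * Num.sqrt (lambda rho * fine (second_moment f1)
                                        * fine (second_moment f2))))
    Q (fun mu => X mu).
Proof.
move=> m mu Pmu g cg [B gB].
rewrite (@bounded_expectation _ _ _ Q (fun w => g (\row_i X (mu i) w)) B); last 2 first.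
- by apply: measurable_continuous_row.
- by move=> w; exact: gB.
apply/cvge_at_rightP => rho [rho_gt0 rho_cvg].
have rho_right : rho n @[n --> \oo] --> 0^'+.
  move=> A [e /= e0 eA]; have /cvgrPdist_lt/(_ _ e0) := rho_cvg.
  by apply: filterS => n h; apply: eA; rewrite /= ?rho_gt0.
have l_cvg : lambda (rho n) @[n --> \oo] --> +oo by exact: cvg_comp rho_right lambda_cvg.
have l_gt0 n : 0 < lambda (rho n) by exact: lambda_gt0.
have [v1_gt0 v2_gt0] := second_moments_gt0 mf1 mf2 f1_ge0 f2_ge0 F_density.
pose v := fine (second_moment f1) * fine (second_moment f2).
have v_gt0 : 0 < v by rewrite mulr_gt0// fine_gt0// ?v1_gt0 ?v2_gt0.
have Fv : (\int[F]_(u in quadrant) (u.1 ^+ 2 * u.2 ^+ 2)%:E = v%:E)%E.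
  rewrite (second_moment_quadrant mf1 mf2 f1_ge0 f2_ge0 F_density) /v EFinM !fineK//;
    by rewrite ge0_fin_numE// ltW.
have /choice[C hC] : forall i, exists C, tame C (density (mu i)) /\
    forall z, fine (mu i (rectangle z.1 z.2)) = mass (density (mu i)) z.
  by move=> i; have [C tC mC] := M_P_tame (Pmu i); exists C.
have tf i : tame (C i) (density (mu i)) := (hC i).1.
pose nu n := intensity_measure F (rho n) (ltW (l_gt0 n)).
have NP n : is_poisson_random_measure (P (rho n)) (nu n) (N (rho n)) by exact: N_poisson.
have ic n i : (nu n).-integrable setT (EFin \o cell (density (mu i))).
  exact: (integrable_cell Fv (tf i)).
have JE n i w : J (N (rho n)) (mu i) w = \int[N (rho n) w]_z cell (density (mu i)) z.
  rewrite /J Rintegral_mkcond; congr fine; apply: eq_integral => z _.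
  by congr EFin; rewrite /cell !patchE; case: ifP => // _; exact: (hC i).2.
pose Y n i (w : Om (rho n)) := scaled_J F v rho l_gt0
  (fun i => density (mu i)) (fun n => N (rho n)) i w.
have YE n i w : J_centred (P (rho n)) (N (rho n)) (mu i) w /
    (rho n ^+ 2 * Num.sqrt (lambda (rho n) * fine (second_moment f1) * fine (second_moment f2))) =
    Y n i w.
  rewrite /Y /scaled_J /scaling /J_centred JE -mulrA -/v; congr ((_ - _) / _).
  rewrite unlock; under eq_integral do rewrite JE.
  by rewrite (prm_mean (NP n) (ic n i)).
rewrite (_ : (fun n => _) = (fun n => (\int[P (rho n)]_w g (\row_i Y n i w))%:E)); last first.
  apply/funext => n; under eq_fun do under eq_mx do rewrite YE.
  apply: (@bounded_expectation _ _ _ _ _ B) => [|w]; last exact: gB.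
  by apply: measurable_continuous_row => // i; exact: measurable_scaled_J.
apply: cvg_EFin; first exact: nearW.
apply: (cvg_scaled_J v_gt0 Fv rho_gt0 rho_cvg l_cvg tf NP) => //.
- by move=> i; exact: field_sqr_integrable.
- by move=> i j; exact: field_product.
- by move=> t b; exact: field_char.
Qed.
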